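(* Consider the fully-discrete problem (D1)--(D4) given in the context with no forcing ($f^{n+\theta}=0$), homogeneous boundary conditions ($h^{n+\theta}=0$ on $\Gamma_N$; the homogeneous Dirichlet condition on $\Gamma_D$ being built into $\bar V_h$) and $\theta\ge1/2$. For a suitably large penalty parameter $\alpha$ (i.e. there is $\alpha_0>0$ such that the following holds for all $\alpha\ge\alpha_0$): if $(u_h^n,\bar u_h^n,p_h^n,\bar p_h^n)\in V_h\times\bar V_h\times Q_h\times\bar Q_h$ and $(u_h^{n+1},\bar u_h^{n+1},p_h^{n+1},\bar p_h^{n+1})\in V_h\times\bar V_h\times Q_h\times\bar Q_h$ satisfy (D1)--(D4), where the time-level-$n$ pair $(u_h^n,\bar u_h^n)$ also satisfies the discrete mass conservation equations (D1)--(D2) with $n+1$ replaced by $n$, then $$\sum_{K\in\mathcal T}\int_K|u_h^{n+1}|^2\,dx\le\sum_{K\in\mathcal T}\int_K|u_h^n|^2\,dx.$$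
   Context: Setting. $\Omega\subset\mathbb R^d$ is a polygonal ($d=2$) or polyhedral ($d=3$) domain with outward unit normal $n$; $\partial\Omega=\Gamma_D\cup\Gamma_N$ with $\Gamma_D\cap\Gamma_N=\emptyset$; $\nu>0$ is the kinematic viscosity. $\mathcal T=\{K\}$ is a triangulation of $\Omega$ into non-overlapping simplices $K$; $n$ also denotes the outward unit normal on $\partial K$ (as a superscript, $n$ is the time-level index); $h_K$ is the size (diameter) of $K$. Two adjacent cells $K^+,K^-$ share an interior facet $F=\partial K^+\cap\partial K^-$; a facet of $\partial K$ lying on $\partial\Omega$ is a boundary facet. $\mathcal F$ is the set of all (interior and boundary) facets. Spaces. $P_l(D)$ denotes polynomials of degree (at most) $l$ on $D$, and $k\ge2$ is an integer. $V_h=\{v_h\in[L^2(\mathcal T)]^d: v_h|_K\in[P_k(K)]^d\ \forall K\in\mathcal T\}$; $\bar V_h=\{\bar v_h\in[L^2(\mathcal F)]^d:\bar v_h|_F\in[P_k(F)]^d\ \forall F\in\mathcal F,\ \bar v_h=0\text{ on }\Gamma_D\}$; $Q_h=\{q_h\in L^2(\mathcal T): q_h|_K\in P_{k-1}(K)\ \forall K\in\mathcal T\}$; $\bar Q_h=\{\bar q_h\in L^2(\mathcal F):\bar q_h|_F\in P_k(F)\ \forall F\in\mathcal F\}$. Functions in $\bar V_h,\bar Q_h$ live only on facets and are single-valued there; functions in $V_h,Q_h$ may be discontinuous across facets, and in integrals over $\partial K$ their traces from inside $K$ are used. Time discretization. $0=t^0<t^1<\dots<t^N$ are time levels, $\Delta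 t^n=t^{n+1}-t^n$, and for the parameter $\theta$ of the $\theta$-method, $y^{n+\theta}=(1-\theta)y^n+\theta y^{n+1}$. Fluxes. $(a\otimes b)_{ij}=a_ib_j$, $(\nabla u)_{ij}=\partial u_i/\partial x_j$, $\mathbb I$ is the identity tensor. $\sigma_h^{n+\theta}=\sigma_{a,h}^{n+\theta}+\sigma_{d,h}^{n+\theta}$ with $\sigma_{a,h}^{n+\theta}=u_h^{n+\theta}\otimes u_h^n$ and $\sigma_{d,h}^{n+\theta}=p_h^{n+\theta}\mathbb I-\nu\nabla u_h^{n+\theta}$. $\hat\sigma_h^{n+\theta}=\hat\sigma_{a,h}^{n+\theta}+\hat\sigma_{d,h}^{n+\theta}$ with $\hat\sigma_{a,h}^{n+\theta}=\sigma_{a,h}^{n+\theta}+(\bar u_h^{n+\theta}-u_h^{n+\theta})\otimes\lambda u_h^n$ and $\hat\sigma_{d,h}^{n+\theta}=\bar p_h^{n+\theta}\mathbb I-\nu\nabla u_h^{n+\theta}-\frac{\nu\alpha}{h_K}(\bar u_h^{n+\theta}-u_h^{n+\theta})\otimes n$, where $\lambda=1$ on parts of cell boundaries with $u_h^n\cdot n<0$, $\lambda=0$ where $u_h^n\cdot n\ge0$, and $\alpha>0$ is a penalty parameter. Fully-discrete problem: given $(u_h^n,\bar u_h^n,p_h^n,\bar p_h^n)\in V_h\times\bar V_h\times Q_h\times\bar Q_h$ at time $t^n$, $f^{n+\theta}\in[L^2(\Omega)]^d$ and $h^{n+\theta}\in[L^2(\Gamma_N)]^d$, find $(u_h^{n+1},\bar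 u_h^{n+1},p_h^{n+1},\bar p_h^{n+1})\in V_h\times\bar V_h\times Q_h\times\bar Q_h$ such that for all $(v_h,\bar v_h,q_h,\bar q_h)\in V_h\times\bar V_h\times Q_h\times\bar Q_h$: (D1) $0=\sum_K\int_Ku_h^{n+1}\cdot\nabla q_h\,dx-\sum_K\int_{\partial K}u_h^{n+1}\cdot n\,q_h\,ds$; (D2) $0=\sum_K\int_{\partial K}u_h^{n+1}\cdot n\,\bar q_h\,ds-\int_{\partial\Omega}\bar u_h^{n+1}\cdot n\,\bar q_h\,ds$; (D3) $\int_\Omega f^{n+\theta}\cdot v_h\,dx=\int_\Omega\frac{u_h^{n+1}-u_h^n}{\Delta t^n}\cdot v_h\,dx-\sum_K\int_K\sigma_h^{n+\theta}:\nabla v_h\,dx+\sum_K\int_{\partial K}\hat\sigma_h^{n+\theta}:(v_h\otimes n)\,ds+\sum_K\int_{\partial K}\nu\,((\bar u_h^{n+\theta}-u_h^{n+\theta})\otimes n):\nabla v_h\,ds$; (D4) $\int_{\Gamma_N}h^{n+\theta}\cdot\bar v_h\,ds=\sum_K\int_{\partial K}\hat\sigma_h^{n+\theta}:(\bar v_h\otimes n)\,ds-\int_{\Gamma_N}(1-\lambda)(\bar u_h^n\cdot n)\,\bar u_h^{n+\theta}\cdot\bar v_h\,ds$. *)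

(* Defs.v *)
From HB Require Import structures.
From mathcomp Require Import all_boot all_order all_algebra.
(* The notations of mpoly clash with those of MathComp-Analysis. *)
From mathcomp Require Import -(notations) mpoly.
From mathcomp Require Import all_classical all_reals all_analysis.
Import Order.TTheory GRing.Theory Num.Theory.
Import numFieldNormedType.Exports.

Set Implicit Arguments.
Unset Strict Implicit.
Unset Printing Implicit Defensive.

Local Open Scope classical_set_scope.
Local Open Scope ring_scope.

Section LinearAlgebra.
Context {R : realType} {d : nat}.
Implicit Types (a b : 'rV[R]_d) (A B : 'M[R]_d).

Definition dot a b : R := \sum_(i < d) a 0 i * b 0 i.

(* The norm [`| a |] that the library puts on ['rV_d] is the maximum norm. *)
Definition enorm a : R := Num.sqrt (dot a a).

(* (a (x) b)_ij = a_i b_j *)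
Definition otimes a b : 'M[R]_d := a^T *m b.

Definition ddot A B : R := \sum_(i < d) \sum_(j < d) A i j * B i j.

Definition grad (q : 'rV[R]_d -> R) (x : 'rV[R]_d) : 'rV[R]_d :=
  \row_(j < d) 'D_(delta_mx 0 j) q x.

(* (grad u)_ij = d u_i / d x_j *)
Definition vgrad (u : 'rV[R]_d -> 'rV[R]_d) (x : 'rV[R]_d) : 'M[R]_d :=
  \matrix_(i < d, j < d) 'D_(delta_mx 0 j) (fun y => u y 0 i) x.

(* P_l(D): the functions that agree on D with a polynomial in d variables of
   total degree at most l ([msize] is the degree plus one, and 0 for 0). *)
Definition is_P (l : nat) (D : set 'rV[R]_d) (f : 'rV[R]_d -> R) : Prop :=
  exists2 p : mpoly d R, (msize p <= l.+1)%N &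
    forall x, D x -> f x = meval (x 0) p.

Definition is_vP (l : nat) (D : set 'rV[R]_d) (u : 'rV[R]_d -> 'rV[R]_d) :=
  forall i, is_P l D (fun x => u x 0 i).

End LinearAlgebra.

Section Lebesgue.
Context {R : realType}.

Definition tcons m (z : R * m.-tuple R) : m.+1.-tuple R := [tuple of z.1 :: z.2].

Lemma measurable_tcons m : measurable_fun setT (@tcons m).
Proof. exact: measurable_cons. Qed.

Definition lebesgue_tupleS m (mu : {measure set (m.-tuple R) -> \bar R}) :
  {measure set (m.+1.-tuple R) -> \bar R}.
Proof.
refine [the measure _ _ of
  pushforward (@lebesgue_measure R \x^ mu)%E (@tcons m)].
exact: measurable_tcons.
Defined.

(* Lebesgue measure on R^m, represented by [m.-tuple R] with its product
   sigma-algebra: the m-fold product of the Lebesgue measure of R. *)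
Fixpoint lebesgue_tuple (m : nat) : {measure set (m.-tuple R) -> \bar R} :=
  if m is m'.+1 then lebesgue_tupleS (lebesgue_tuple m')
  else @dirac _ _ ([tuple] : 0.-tuple R) R.

(* The reference simplex, without its faces (a null set). *)
Definition ref_simplex (m : nat) : set (m.-tuple R) :=
  [set t | (forall i, 0 < tnth t i) /\ \sum_(i < m) tnth t i < 1].

End Lebesgue.

Section Domain.
Context {R : realType} {d : nat}.
Implicit Type Omega : set 'rV[R]_d.

Definition boundary Omega : set 'rV[R]_d := closure Omega `\` interior Omega.

(* That the domain is polygonal or polyhedral is expressed by its having a
   [triangulation] below; the last condition says that it lies on one side of
   its boundary (no slits). *)
Definition domain Omega : Prop :=
  [/\ Omega !=set0, open Omega, connected Omega &
      interior (closure Omega) = Omega].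

Definition hull (V : finType) (X : V -> 'rV[R]_d) (S : {set V}) :
    set 'rV[R]_d :=
  [set x | exists c : V -> R,
     [/\ forall v, 0 <= c v, \sum_(v in S) c v = 1 &
         x = \sum_(v in S) c v *: X v]].

(* Position of the i-th vertex of S, in the order of [enum]. *)
Definition vertex_at (V : finType) (X : V -> 'rV[R]_d) (S : {set V}) (i : nat) :
    'rV[R]_d :=
  nth 0 [seq X v | v in S] i.

Definition edges (V : finType) (X : V -> 'rV[R]_d) (m : nat) (S : {set V}) :
    'M[R]_(m, d) :=
  \matrix_(i < m) (vertex_at X S i.+1 - vertex_at X S 0).

(* A simplex is the set of its vertices. Conformity, [tri_conform], makes the
   cells non-overlapping and makes cells meet along common faces. *)
Record triangulation (Omega : set 'rV[R]_d) := Triangulation {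
  vertex : finType;
  coord : vertex -> 'rV[R]_d;
  cells : {set {set vertex}};
  tri_card : forall K, K \in cells -> #|K| = d.+1;
  tri_free : forall K, K \in cells -> row_free (edges coord d K);
  tri_conform : forall K K', K \in cells -> K' \in cells ->
    hull coord K `&` hull coord K' = hull coord (K :&: K');
  tri_cover : closure Omega = \bigcup_(K in [set` cells]) hull coord K
}.

End Domain.

Arguments cells {R d Omega} t.
Arguments vertex {R d Omega} t.
Arguments coord {R d Omega} t v.

Section Mesh.
Context {R : realType} {d : nat} {Omega : set 'rV[R]_d}.
Variable T : triangulation Omega.
Local Notation simplex := {set vertex T}.
Local Notation point := ('rV[R]_d).
Implicit Types (K F S : simplex) (x : point).

Definition geo S : set point := hull (coord T) S.

(* Affine parametrization of an m-simplex by the reference simplex. *)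
Definition param (m : nat) S (t : m.-tuple R) : point :=
  vertex_at (coord T) S 0 + (\row_(i < m) tnth t i) *m edges (coord T) m S.

Definition relint (m : nat) S : set point := [set param S t | t in @ref_simplex R m].

(* Integral over an m-simplex of R^d with respect to its m-dimensional surface
   measure. The Gram determinant gives the area element of [param]; for m = d
   its square root is the absolute value of the Jacobian determinant, and this
   is the integral with respect to dx. *)
Definition integral_simplex (m : nat) S (g : point -> R) : R :=
  Num.sqrt (\det (edges (coord T) m S *m (edges (coord T) m S)^T)) *
  (\int[lebesgue_tuple m]_(t in @ref_simplex R m) g (param S t))%R.

Definition facets_of K : {set simplex} :=
  [set F : simplex | (F \subset K) && (#|F| == d)]%SET.

Definition facets : {set simplex} :=
  [set F : simplex | [exists K in cells T, F \in facets_of K]]%SET.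

Definition boundary_facet F : bool := `[< geo F `<=` boundary Omega >].

Definition outward_unit_normal K F (nu : point) : Prop :=
  [/\ enorm nu = 1,
      forall v w, v \in F -> w \in F -> dot nu (coord T v - coord T w) = 0 &
      forall v w, v \in K -> v \notin F -> w \in F ->
        dot nu (coord T v - coord T w) < 0].

Definition unit_normal K F : point := xget 0 [set nu | outward_unit_normal K F nu].

Definition diam K : R := sup [set enorm (x - y) | x in geo K & y in geo K].

Definition int_cells (g : simplex -> point -> R) : R :=
  \sum_(K in cells T) integral_simplex d K (g K).

(* Sum over the cells K of the integrals over the boundary of K; the integrand
   depends on the cell K, on its facet F and on the point. *)
Definition int_cell_boundaries (g : simplex -> simplex -> point -> R) : R :=
  \sum_(K in cells T) \sum_(F in facets_of K) integral_simplex d.-1 F (g K F).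

(* Integral over a part A of the boundary of Omega, where K is the cell that
   has F as a facet. *)
Definition int_boundary (A : set point) (g : simplex -> simplex -> point -> R) : R :=
  \sum_(K in cells T) \sum_(F in facets_of K | boundary_facet F)
    integral_simplex d.-1 F (fun x => \1_A x * g K F x).

(* Functions on cells and on facets are families of functions indexed by the
   simplices. A polynomial on a cell K is given by its (unique) extension to
   R^d, so that its values and derivatives on the boundary of K are the traces
   from inside K. A function on a facet F is only used on F. *)
Definition is_V (k : nat) (u : simplex -> point -> point) : Prop :=
  forall K, K \in cells T -> is_vP k setT (u K).

(* The relative interior of F is used because the boundary of F may meet the
   Dirichlet part when F does not lie on it. *)
Definition is_Vbar (k : nat) (GammaD : set point)
    (ub : simplex -> point -> point) : Prop :=
  forall F, F \in facets ->
    is_vP k (geo F) (ub F) /\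
    (forall x, relint d.-1 F x -> GammaD x -> ub F x = 0).

Definition is_Q (k : nat) (p : simplex -> point -> R) : Prop :=
  forall K, K \in cells T -> is_P k.-1 setT (p K).

Definition is_Qbar (k : nat) (pb : simplex -> point -> R) : Prop :=
  forall F, F \in facets -> is_P k (geo F) (pb F).

Record state := State {
  vel : simplex -> point -> point;
  fvel : simplex -> point -> point;
  prs : simplex -> point -> R;
  fprs : simplex -> point -> R
}.

Definition is_state (k : nat) (GammaD : set point) (s : state) : Prop :=
  [/\ is_V k (vel s), is_Vbar k GammaD (fvel s), is_Q k (prs s) &
      is_Qbar k (fprs s)].

(* y^(n+theta) from y^n and y^(n+1) *)
Definition theta_state (theta : R) (s0 s1 : state) : state := {|
  vel K x := (1 - theta) *: vel s0 K x + theta *: vel s1 K x;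
  fvel F x := (1 - theta) *: fvel s0 F x + theta *: fvel s1 F x;
  prs K x := (1 - theta) * prs s0 K x + theta * prs s1 K x;
  fprs F x := (1 - theta) * fprs s0 F x + theta * fprs s1 F x
|}.

Definition local_mass (k : nat) (s : state) : Prop :=
  forall q, is_Q k q ->
    0 = int_cells (fun K x => dot (vel s K x) (grad (q K) x))
        - int_cell_boundaries (fun K F x =>
            dot (vel s K x) (unit_normal K F) * q K x).

Definition facet_mass (k : nat) (s : state) : Prop :=
  forall qb, is_Qbar k qb ->
    0 = int_cell_boundaries (fun K F x =>
          dot (vel s K x) (unit_normal K F) * qb F x)
        - int_boundary (boundary Omega) (fun K F x =>
            dot (fvel s F x) (unit_normal K F) * qb F x).

(* Upwind switch, as a function of u . n *)
Definition lam (un : R) : R := if un < 0 then 1 else 0.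

Section Fluxes.
Variables (nu alpha : R).
(* [s0] is the state at time level n, [sm] the one at level n + theta. *)
Variables (s0 sm : state).

Definition sigma_a K x : 'M[R]_d := otimes (vel sm K x) (vel s0 K x).

Definition sigma_d K x : 'M[R]_d :=
  prs sm K x *: 1%:M - nu *: vgrad (vel sm K) x.

Definition sigma K x : 'M[R]_d := sigma_a K x + sigma_d K x.

Definition hsigma_a K F x : 'M[R]_d :=
  sigma_a K x
  + otimes (fvel sm F x - vel sm K x)
           (lam (dot (vel s0 K x) (unit_normal K F)) *: vel s0 K x).

Definition hsigma_d K F x : 'M[R]_d :=
  fprs sm F x *: 1%:M - nu *: vgrad (vel sm K) x
  - (nu * alpha / diam K) *: otimes (fvel sm F x - vel sm K x) (unit_normal K F).

Definition hsigma K F x : 'M[R]_d := hsigma_a K F x + hsigma_d K F x.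

End Fluxes.

Section Problem.
Variables (k : nat) (GammaD GammaN : set point) (nu alpha theta dt : R).
Variables (f h : point -> point) (s0 s1 : state).

Definition local_momentum : Prop :=
  let sm := theta_state theta s0 s1 in
  forall v, is_V k v ->
    int_cells (fun K x => dot (f x) (v K x))
    = int_cells (fun K x =>
        dot (dt^-1 *: (vel s1 K x - vel s0 K x)) (v K x))
      - int_cells (fun K x => ddot (sigma nu s0 sm K x) (vgrad (v K) x))
      + int_cell_boundaries (fun K F x =>
          ddot (hsigma nu alpha s0 sm K F x) (otimes (v K x) (unit_normal K F)))
      + int_cell_boundaries (fun K F x =>
          nu * ddot (otimes (fvel sm F x - vel sm K x) (unit_normal K F))
                    (vgrad (v K) x)).

Definition facet_momentum : Prop :=
  let sm := theta_state theta s0 s1 in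
  forall vb, is_Vbar k GammaD vb ->
    int_boundary GammaN (fun K F x => dot (h x) (vb F x))
    = int_cell_boundaries (fun K F x =>
        ddot (hsigma nu alpha s0 sm K F x) (otimes (vb F x) (unit_normal K F)))
      - int_boundary GammaN (fun K F x =>
          (1 - lam (dot (vel s0 K x) (unit_normal K F))) *
          dot (fvel s0 F x) (unit_normal K F) * dot (fvel sm F x) (vb F x)).

Definition discrete_problem : Prop :=
  [/\ local_mass k s1, facet_mass k s1, local_momentum & facet_momentum].

End Problem.

(* The sum over the cells K of the integral of |u|^2 over K. *)
Definition energy (s : state) : R :=
  int_cells (fun K x => enorm (vel s K x) ^+ 2).

End Mesh.

(* Main.v *)
(* Test the momentum equations with the velocities at the level n + theta. As
   k >= 2, the divergence of the velocity is an admissible pressure and its normal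
   jump an admissible facet pressure, so the local mass equation makes the
   velocities divergence free in the cells and the facet mass equation makes their
   normal components continuous: the pressures drop out. Integrating the
   convective term by parts leaves, with u, ub the velocities in the cells and on
   the facets and w, wb the ones at level n, the boundary terms
   (1/2 - lambda)(w.n)|u - ub|^2 >= 0 and, up to (w.n)|ub|^2/2 whose sum over the
   two sides of an interior facet vanishes, the outflow term on Gamma_N, also
   >= 0. The viscous boundary term 2 nu ((ub - u) (x) n) : grad u is absorbed by
   Young's inequality and a discrete trace inequality into the penalty and the
   dissipation. What remains is (u1 - u0) . u <= 0, where
   (u1 - u0) . u = (|u1|^2 - |u0|^2)/2 + (theta - 1/2)|u1 - u0|^2.

   The divergence theorem on a simplex is reduced to the reference simplex, where
   for monomials in the barycentric coordinates it follows from Dirichlet's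
   formula. The trace inequality is an inequality between quadratic forms on a
   finite-dimensional space: it holds for some constant as soon as the form on
   the cell has a kernel contained in that of the form on the facet. *)
From HB Require Import structures.
Require Import Defs.
From mathcomp Require Import all_boot all_order all_algebra.
From mathcomp Require Import -(notations) mpoly.
From mathcomp Require Import all_classical all_reals all_analysis.
From mathcomp Require Import perm measurable_realfun lebesgue_Rintegral ring lra zify.
Import Order.TTheory GRing.Theory Num.Theory.
Import numFieldNormedType.Exports.

Set Implicit Arguments.
Unset Strict Implicit.
Unset Printing Implicit Defensive.

Local Open Scope classical_set_scope.
Local Open Scope ring_scope.

(** * Integrals over the reference simplex *)

(** The mass equations hold against polynomial test functions only, whereas the upwind switch brings
    in discontinuous factors. Hence [divergence_free] and [normal_jump] are stated for all bounded
    measurable [phi]: the test function is the divergence or the jump itself, so that its square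
    integrates to 0, and Cauchy-Schwarz does the rest. That a polynomial with vanishing square
    integral is zero never has to be shown. The same device gives the kernel condition behind the
    trace inequality. The penalty bound may depend on the mesh and on k, so the trace constants call
    for neither scaling nor shape regularity. All viscous terms carry the factor nu, so the bound
    does not depend on nu. Geometry enters at the facets: exactly two cells, with opposite normals,
    meet at an interior facet, and a boundary facet has a single cell. Both facts come from
    conformity and from the domain lying on one side of its boundary. *)

Section ReferenceSimplex.
Context {R : realType}.
Local Notation leb := (@lebesgue_measure R).

(** Slicing the simplex one coordinate at a time uses Tonelli's theorem, which asks for sigma-finite
    factors. The cover is made of products of two increasing covers, so that two indices can be
    replaced by their maximum. *)
Lemma lebesgue_tupleS_sigma_finite m (mu : {measure set (m.-tuple R) -> \bar R}) :
  sigma_finite setT mu -> sigma_finite setT (lebesgue_tupleS mu).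
Proof.
move=> sfm.
have /sigma_finiteP[F [TF ndF Foo]] := sigma_finiteT leb.
have [G' [TG' ndG' G'oo]] := (sigma_finiteP _ _).1 sfm.
pose A n := [set t : m.+1.-tuple R | F n (thead t) /\ G' n [tuple of behead t]].
have AE n : @tcons R m @^-1` (A n) = F n `*` G' n.
  apply/seteqP; split => -[x s] /=; rewrite /A /=.
    have -> : [tuple of behead (tcons (x, s))] = s by apply: val_inj.
    by rewrite theadE.
  have -> : [tuple of behead (tcons (x, s))] = s by apply: val_inj.
  by rewrite theadE.
exists A.
  apply/seteqP; split => // t _.
  have : setT (thead t) by []. rewrite TF => -[n _ Fn].
  have : setT ([tuple of behead t] : m.-tuple R) by []. rewrite TG' => -[k _ Gk].
  exists (maxn n k) => //; split.
    by move: (thead t) Fn; exact/subsetPset/ndF/leq_maxl.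
  by move: ([tuple of behead t]) Gk; exact/subsetPset/ndG'/leq_maxr.
move=> n; have [? ?] := Foo n; have [? ?] := G'oo n.
have mA : measurable (A n).
  rewrite (_ : A n = (@thead _ _) @^-1` F n `&`
     (fun t : m.+1.-tuple R => [tuple of behead t]) @^-1` G' n)//.
  apply: measurableI; rewrite -[X in measurable X]setTI.
    exact: (@measurable_tnth _ _ m.+1 ord0).
  exact: measurable_behead.
split => //.
rewrite /lebesgue_tupleS /= /pushforward AE product_measure2E//.
by rewrite lte_mul_pinfty// ge0_fin_numE.
Qed.

Lemma lebesgue_tuple_sigma_finite m :
  sigma_finite setT (lebesgue_tuple m : {measure set (m.-tuple R) -> \bar R}).
Proof.
elim: m => [|m IH]; last exact: lebesgue_tupleS_sigma_finite.
apply: fin_num_fun_sigma_finite => /= [|A mA]; first by rewrite measure0.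
by rewrite diracE.
Qed.

(* Structures are attached to the head constant of a function, whence this alias. *)
Let lebesgue_tuple_fun m : set (m.-tuple R) -> \bar R := lebesgue_tuple m.
HB.instance Definition _ m := Measure.copy (@lebesgue_tuple_fun m) (lebesgue_tuple m).
HB.instance Definition _ m := Measure_isSigmaFinite.Build _ _ _
  (@lebesgue_tuple_fun m) (lebesgue_tuple_sigma_finite m).

Lemma measurable_sum_tnth m : measurable_fun setT (fun t : m.-tuple R => \sum_(i < m) tnth t i).
Proof. by apply: measurable_sum => i; exact: measurable_tnth. Qed.

Lemma measurable_ref_simplex m : measurable (@ref_simplex R m).
Proof.
rewrite (_ : @ref_simplex R m = (\big[setI/setT]_(i < m)
     ((fun t : m.-tuple R => tnth t i) @^-1` [set x | 0 < x]))
   `&` ((fun t : m.-tuple R => \sum_(i < m) tnth t i) @^-1` [set x | x < 1])).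
  apply: measurableI.
    apply: bigsetI_measurable => i _; rewrite -[X in measurable X]setTI.
    apply: measurable_tnth => //.
    rewrite -[X in measurable X](_ : `]0, +oo[%classic = _)//.
    by apply/seteqP; split => x /=; rewrite in_itv/= andbT.
  rewrite -[X in measurable X]setTI; apply: measurable_sum_tnth => //.
  rewrite -[X in measurable X](_ : `]-oo, 1[%classic = _)//.
apply/seteqP; split => t /= [].
  move=> t0 t1; split => //.
  by elim/big_ind : _ => //= i _; exact: t0.
move=> t0 t1; split => // i.
by move: t0; rewrite (bigD1 i)//= => -[].
Qed.
#[local] Hint Resolve measurable_ref_simplex : core.

Lemma tcons_ref m (x : R) (s : m.-tuple R) :
  ref_simplex (tcons (x, s)) <-> ref_simplex s /\ 0 < x < 1 - \sum_i tnth s i.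
Proof.
rewrite /ref_simplex /= big_ord_recl/= (tnth0 x s).
under eq_bigr do rewrite tnthS.
split.
  move=> [t0 t1].
  have s0 i : 0 < tnth s i by have := t0 (lift ord0 i); rewrite tnthS.
  have x0 : 0 < x by have := t0 ord0; rewrite tnth0.
  split; first by split => //; lra.
  by apply/andP; split=> //; lra.
move=> [[s0 s1] /andP[x0 x1]]; split; last lra.
move=> i; case: (unliftP ord0 i) => [j ->|->]; first by rewrite tnthS.
by rewrite tnth0.
Qed.

(** The head is integrated first: by [tcons_ref] it ranges over an interval whose length is the
    slack [1 - \sum_i tnth s i] of the tail, the form needed for an induction on the dimension. *)
Lemma integral_ref_simplexS m (f : m.+1.-tuple R -> \bar R) :
  measurable_fun setT f -> (forall t, @ref_simplex R _ t -> (0 <= f t)%E) ->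
  (\int[lebesgue_tuple m.+1]_(t in @ref_simplex R m.+1) f t =
   \int[lebesgue_tuple m]_(s in @ref_simplex R m)
     \int[leb]_(x in `]0%R, (1 - \sum_i tnth s i)%R[) f (tcons (x, s)))%E.
Proof.
move=> mf f0.
pose mu := (@lebesgue_tuple_fun m : {sigma_finite_measure set (m.-tuple R) -> \bar R}).
pose g := f \_ (@ref_simplex R m.+1).
have mg : measurable_fun setT g.
  exact: (measurable_restrictT _ (@measurable_ref_simplex m.+1)).1 (measurable_funTS mf).
have g0 t : (0 <= g t)%E.
  by rewrite /g patchE; case: ifPn => // /set_mem; exact: f0.
rewrite integral_mkcond -/g.
have -> : (\int[lebesgue_tuple m.+1]_t g t =
   \int[pushforward (leb \x^ mu) (@tcons R m)]_t g t)%E by [].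
rewrite ge0_integral_pushforward//; last exact: measurable_tcons.
rewrite preimage_setT.
(* [lebesgue_tuple] is built with the product [\x^], while Tonelli's theorem is applied to [\x]; the
   two agree by uniqueness of the product measure. *)
transitivity (\int[leb \x mu]_z (g \o @tcons R m) z)%E.
  apply: eq_measure_integral => /= A mA _; apply/esym.
  apply: (@product_measure_unique _ _ _ _ _ leb mu (leb \x^ mu)%E) => // B C mB mC.
  exact: product_measure2E.
rewrite (@fubini_tonelli2 _ _ _ _ _ leb mu (g \o @tcons R m)); last 2 first.
- by apply: measurableT_comp => //; exact: measurable_tcons.
- by move=> z; exact: g0.
rewrite [RHS]integral_mkcond; apply: eq_integral => s _.
rewrite /fubini_G patchE; case: ifPn => [|sn].
  move/set_mem => rs; rewrite [RHS]integral_mkcond; apply: eq_integral => x _.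
  rewrite /= /g !patchE.
  have -> // : (tcons (x, s) \in @ref_simplex R m.+1) = (x \in `]0, (1 - \sum_i tnth s i)%R[%classic).
  apply/idP/idP; rewrite !inE /=; first by move=> /tcons_ref[_]; rewrite in_itv.
  by rewrite in_itv /= => xs; apply/tcons_ref.
apply: integral0_eq => x _ /=; rewrite /g patchE ifF//.
apply: contraNF sn => /set_mem/tcons_ref[rs _]; exact/mem_set.
Qed.

End ReferenceSimplex.

(** * Dirichlet's formula for monomials on the reference simplex *)

Section Dirichlet.
Context {R : realType}.
Local Notation leb := (@lebesgue_measure R).
Local Notation refs m := (@ref_simplex R m).

Lemma integrable_horner (q : {poly R}) (c : R) :
  leb.-integrable `[0, c] (EFin \o horner q).
Proof.
apply: continuous_compact_integrable; first exact: segment_compact.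
by apply: continuous_subspaceT; exact: continuous_horner.
Qed.

Lemma integral_deriv_horner (q : {poly R}) (c : R) : 0 < c ->
  (\int[leb]_(x in `[0%R, c]) (q^`()%R.[x])%:E = (q.[c] - q.[0])%:E)%E.
Proof.
move=> c0; rewrite (@continuous_FTC2 _ _ (horner q))//.
- by apply: continuous_subspaceT; exact: continuous_horner.
- split.
  + by move=> x _; exact: derivable_horner.
  + exact/cvg_at_right_filter/continuous_horner.
  + exact/cvg_at_left_filter/continuous_horner.
- by move=> x _; rewrite derivE.
Qed.

(** Integration by parts, as an induction on b: the derivative of [x ^+ a.+1 * (c - x) ^+ b.+1]
    integrates to 0 over [0, c], which trades one power of c - x for one power of x. *)
Lemma integral_beta (a b : nat) (c : R) : 0 < c ->
  (\int[leb]_(x in `]0%R, c[) (x ^+ a * (c - x) ^+ b)%:E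
   = (c ^+ (a + b).+1 * (a`! * b`!)%:R / (a + b).+1`!%:R)%:E)%E.
Proof.
move=> c0; pose P a b : {poly R} := 'X^a * (c%:P - 'X) ^+ b.
have PE a' b' x : (P a' b').[x] = x ^+ a' * (c - x) ^+ b'.
  by rewrite /P !hornerE.
(* The fundamental theorem of calculus is applied on the closed interval; the end points are
   null. *)
rewrite -(@integral_itv_bndoo _ _ _ _ true false); last first.
  apply/measurable_EFinP; apply: (eq_measurable_fun (horner (P a b))) => [x _|]//.
  by apply: measurable_funTS; apply: continuous_measurable_fun; exact: continuous_horner.
under eq_integral do rewrite -PE.
have fin q : (\int[leb]_(x in `[0%R, c]) (q.[x])%:E \is a fin_num)%E.
  by apply: integrable_fin_num => //; exact: integrable_horner.
have intZ k (q : {poly R}) : (\int[leb]_(x in `[0%R, c]) ((k%:P * q)%R.[x])%:E =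
    k%:E * \int[leb]_(x in `[0%R, c]) (q.[x])%:E)%E.
  under eq_integral do rewrite hornerCM EFinM.
  by rewrite integralZl//; exact: integrable_horner.
have intB (p q : {poly R}) : (\int[leb]_(x in `[0%R, c]) ((p - q)%R.[x])%:E =
    \int[leb]_(x in `[0%R, c]) (p.[x])%:E - \int[leb]_(x in `[0%R, c]) (q.[x])%:E)%E.
  under eq_integral do rewrite hornerD hornerN EFinB.
  by rewrite integralB//; exact: integrable_horner.
have fact_neq0 n : n`!%:R != 0 :> R by rewrite pnatr_eq0 -lt0n fact_gt0.
elim: b a => [|b IH] a.
  have := integral_deriv_horner 'X^(a.+1) c0.
  have -> : P a 0%N = 'X^a by rewrite /P expr0 mulr1.
  rewrite derivXn -[_ *+ _]mulr_natl -polyC_natr intZ !hornerE expr0n subr0 /=.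
  rewrite -(fineK (fin 'X^a)) -EFinM => -[E]; congr EFin.
  apply: (@mulfI _ a.+1%:R); first by rewrite pnatr_eq0.
  rewrite E factS natrM.
  have := fact_neq0 a; have : a.+1%:R != 0 :> R by rewrite pnatr_eq0.
  move: a.+1%:R a`!%:R => u v u0 v0; field.
  by rewrite u0 v0.
have := integral_deriv_horner (P a.+1 b.+1) c0.
rewrite !PE subrr expr0n/= mulr0 expr0n/= mul0r subr0.
have -> : (P a.+1 b.+1)^`() = a.+1%:R%:P * P a b.+1 - b.+1%:R%:P * P a.+1 b.
  rewrite /P derivM derivXn deriv_exp derivB derivC derivX sub0r !polyC_natr.
  by rewrite /= !mulr_natl mulN1r mulNrn mulrN mulrnAl mulrnAr.
rewrite intB !intZ IH -(fineK (fin (P a b.+1))) -!EFinM -EFinB => -[E]; congr EFin.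
apply: (@mulfI _ a.+1%:R); first by rewrite pnatr_eq0.
move/eqP: E; rewrite subr_eq0 => /eqP ->.
rewrite addSnnS !factS !natrM; field.
by rewrite fact_neq0 /=.
Qed.

(** Integrating out the first coordinate is a beta integral with c the slack of the remaining ones;
    it raises the exponent of the slack from b to [(a ord0 + b).+1] and leaves an integral of the
    same kind in one dimension less. *)
Lemma integral_dirichlet m (b : nat) (a : 'I_m -> nat) :
  (\int[lebesgue_tuple m]_(t in refs m)
     ((1 - \sum_i tnth t i) ^+ b * \prod_i tnth t i ^+ a i)%:E
   = ((b`! * \prod_i (a i)`!)%:R / (m + b + \sum_i a i)`!%:R)%:E)%E.
Proof.
have mf k (e : nat) (f : 'I_k -> nat) : measurable_fun setT (fun t : k.-tuple R =>
    ((1 - \sum_i tnth t i) ^+ e * \prod_i tnth t i ^+ f i)%:E).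
  apply/measurable_EFinP; apply: measurable_funM.
    apply: measurable_funX; apply: measurable_funB => //.
    exact: measurable_sum_tnth.
  by apply: measurable_prod => i _; apply: measurable_funX; exact: measurable_tnth.
elim: m b a => [|m IH] b a.
  rewrite (_ : refs 0 = setT); last first.
    by apply/seteqP; split => // t _; split => [[]//|]; rewrite big_ord0 ltr01.
    rewrite [LHS](integral_dirac ([tuple] : 0.-tuple R) measurableT); last first.
    apply/measurable_EFinP; rewrite (_ : (fun _ => _) = cst 1)//.
    by apply/funext => t; rewrite !big_ord0 subr0 expr1n mulr1.
  rewrite diracE mem_set// mul1e.
  rewrite !big_ord0 subr0 expr1n addn0 add0n muln1 mulr1 divff// pnatr_eq0 -lt0n fact_gt0.
rewrite integral_ref_simplexS; last 2 first.
- exact: mf.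
- move=> t [t0 t1]; rewrite lee_fin mulr_ge0//.
    by rewrite exprn_ge0// subr_ge0 ltW.
  by rewrite prodr_ge0// => i _; rewrite exprn_ge0// ltW.
transitivity (\int[lebesgue_tuple m]_(t in refs m) (
  ((a ord0)`! * b`!)%:R / (a ord0 + b).+1`!%:R *
  ((1 - \sum_i tnth t i) ^+ (a ord0 + b).+1 *
  \prod_(i < m) tnth t i ^+ a (lift ord0 i)))%:E)%E.
  apply: eq_integral => s /set_mem[s0 s1].
  set c := 1 - \sum_i tnth s i.
  have c0 : 0 < c by rewrite subr_gt0.
  set p := \prod_(i < m) _.
  transitivity (\int[leb]_(x in `]0%R, c[) (p%:E * (x ^+ a ord0 * (c - x) ^+ b)%:E))%E.
    apply: eq_integral => x _.
    rewrite !big_ord_recl/= (tnth0 x s).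
    under eq_bigr do rewrite tnthS.
    under [X in _ * (_ * X)]eq_bigr do rewrite tnthS.
    rewrite opprD addrA -addrAC -/c -/p -EFinM; congr EFin; ring.
  rewrite integralZl//; last first.
    have -> : (fun x => (x ^+ a ord0 * (c - x) ^+ b)%:E) =
        EFin \o horner ('X ^+ a ord0 * (c%:P - 'X) ^+ b).
      by apply/funext => x; rewrite /= !hornerE.
    apply: integrableS (integrable_horner _ c) => //; exact: subset_itv_oo_cc.
  by rewrite integral_beta// -EFinM; congr EFin; ring.
under eq_integral do rewrite EFinM.
rewrite ge0_integralZl; last 4 first.
- exact: measurable_ref_simplex.
- by apply: measurable_funTS; exact: mf.
- move=> t [t0 t1]; rewrite lee_fin mulr_ge0//.
    by rewrite exprn_ge0// subr_ge0 ltW.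
  by rewrite prodr_ge0// => i _; rewrite exprn_ge0// ltW.
- by rewrite lee_fin divr_ge0.
rewrite IH -EFinM; congr EFin.
rewrite [in RHS]big_ord_recl [in RHS](big_ord_recl _ a)/=.
have -> : (m + (a ord0 + b).+1 + \sum_(i < m) a (lift ord0 i) =
  m.+1 + b + (a ord0 + \sum_(i < m) a (lift ord0 i)))%N by lia.
have := fact_gt0 (a ord0 + b).+1.
have := fact_gt0 (m.+1 + b + (a ord0 + \sum_(i < m) a (lift ord0 i))).
move: (_ .+1)`! (_ + (_ + _))%N`! => v u u0 v0.
rewrite !natrM; field.
by rewrite !pnatr_eq0 -!lt0n u0 v0.
Qed.

End Dirichlet.

(** * Bounded measurable functions on the reference simplex *)

Section RegularFunctions.
Context {R : realType}.
Local Notation refs m := (@ref_simplex R m).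

(** Weaker than continuity, because the upwind switch [lam] is discontinuous. Boundedness makes the
    class stable under products, and integrable since the simplex has finite measure. *)
Definition regular m (g : m.-tuple R -> R) : Prop :=
  measurable_fun (refs m) g /\ exists M, forall t, refs m t -> `|g t| <= M.

Definition Iref m (g : m.-tuple R -> R) : R :=
  (\int[lebesgue_tuple m]_(t in refs m) g t)%R.

(** The measure is Dirichlet's formula with all exponents 0, that is 1/m!. *)
Lemma lebesgue_ref_simplex m : (lebesgue_tuple m (refs m) < +oo)%E.
Proof.
rewrite -[ltLHS]mul1e -integral_cst; last exact: measurable_ref_simplex.
rewrite (_ : (\int[_]_(t in _) _)%E = \int[lebesgue_tuple m]_(t in refs m)
   ((1 - \sum_i tnth t i) ^+ 0 * \prod_i tnth t i ^+ 0)%:E)%E; last first.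
  by apply: eq_integral => t _; rewrite expr0 mul1r big1// => i _; rewrite expr0.
by rewrite (integral_dirichlet 0 (fun=> 0%N)) ltry.
Qed.

Lemma regular_integrable m (g : m.-tuple R -> R) : regular g ->
  (lebesgue_tuple m).-integrable (refs m) (EFin \o g).
Proof.
move=> [mg [M gM]]; apply: measurable_bounded_integrable => //.
- exact: measurable_ref_simplex.
- exact: lebesgue_ref_simplex.
- exists M; split; first by rewrite num_real.
  by move=> N MN t /gM /le_trans; apply; exact: ltW.
Qed.

Lemma regular_cst m c : regular (fun _ : m.-tuple R => c).
Proof. by split; [exact: measurable_cst | exists `|c|]. Qed.

Lemma regular_tnth m i : regular (fun t : m.-tuple R => tnth t i).
Proof.
split; first by apply: measurable_funTS; exact: measurable_tnth.
exists 1 => t [t0 t1]; rewrite ger0_norm; last exact/ltW.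
apply: le_trans (ltW t1); rewrite (bigD1 i)//= lerDl.
by apply: sumr_ge0 => j _; exact/ltW.
Qed.

Lemma regularD m (f g : m.-tuple R -> R) :
  regular f -> regular g -> regular (fun t => f t + g t).
Proof.
move=> [mf [M fM]] [mg [N gN]]; split; first exact: measurable_funD.
by exists (M + N) => t rt; rewrite (le_trans (ler_normD _ _))// lerD ?fM ?gN.
Qed.

Lemma regularM m (f g : m.-tuple R -> R) :
  regular f -> regular g -> regular (fun t => f t * g t).
Proof.
move=> [mf [M fM]] [mg [N gN]]; split; first exact: measurable_funM.
by exists (M * N) => t rt; rewrite normrM ler_pM ?fM ?gN.
Qed.

Lemma regular_sum m (I : Type) (r : seq I) (P : pred I) (f : I -> m.-tuple R -> R) :
  (forall i, P i -> regular (f i)) -> regular (fun t => \sum_(i <- r | P i) f i t).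
Proof.
move=> rf; elim: r => [|i r IH].
  by under eq_fun do rewrite big_nil; exact: regular_cst.
under eq_fun do rewrite big_cons.
case Pi : (P i) => //; by apply: regularD => //; exact: rf.
Qed.

Lemma regular_prod m (I : Type) (r : seq I) (f : I -> m.-tuple R -> R) :
  (forall i, regular (f i)) -> regular (fun t => \prod_(i <- r) f i t).
Proof.
move=> rf; elim: r => [|i r IH].
  by under eq_fun do rewrite big_nil; exact: regular_cst.
by under eq_fun do rewrite big_cons; exact: regularM.
Qed.

Lemma regularX m (f : m.-tuple R -> R) n : regular f -> regular (fun t => f t ^+ n).
Proof.
move=> rf; elim: n => [|n IH]; first exact: regular_cst.
by under eq_fun do rewrite exprS; exact: regularM.
Qed.

Lemma eq_regular m (f g : m.-tuple R -> R) :
  (forall t, refs m t -> f t = g t) -> regular f -> regular g.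
Proof.
move=> fg [mf [M fM]]; split.
  by apply: eq_measurable_fun mf => t /set_mem/fg.
by exists M => t rt; rewrite -fg//; exact: fM.
Qed.

Lemma regular_lam m (f : m.-tuple R -> R) : regular f -> regular (fun t => lam (f t)).
Proof.
move=> [mf _]; split; last first.
  by exists 1 => t _; rewrite /lam; case: ifP; rewrite ?normr1 ?normr0.
have ml : measurable_fun setT (@lam R).
  have -> : @lam R = \1_(`]-oo, 0[%classic).
    apply/funext => x; rewrite /lam indicE.
    have -> : (x \in `]-oo, 0[%classic) = (x < 0) by rewrite mem_setE in_itv.
    by case: ifP.
  exact: measurable_indic.
exact: measurableT_comp ml mf.
Qed.

Lemma eq_Iref m (f g : m.-tuple R -> R) :
  (forall t, refs m t -> f t = g t) -> Iref f = Iref g.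
Proof. by move=> fg; apply: eq_Rintegral => t /set_mem/fg. Qed.

Lemma IrefD m (f g : m.-tuple R -> R) : regular f -> regular g ->
  Iref (fun t => f t + g t) = Iref f + Iref g.
Proof.
move=> rf rg; rewrite /Iref RintegralD//; first exact: measurable_ref_simplex.
  exact: regular_integrable.
exact: regular_integrable.
Qed.

Lemma IrefZ m c (f : m.-tuple R -> R) : regular f -> Iref (fun t => c * f t) = c * Iref f.
Proof.
move=> rf; rewrite /Iref RintegralZl//; first exact: measurable_ref_simplex.
exact: regular_integrable.
Qed.

Lemma Iref0 m : Iref (fun _ : m.-tuple R => 0) = 0.
Proof.
transitivity (0 * Iref (fun _ : m.-tuple R => 1)); last by rewrite mul0r.
rewrite -IrefZ; last exact: regular_cst.
by apply: eq_Iref => t _; rewrite mul0r.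
Qed.

Lemma Iref_sum m (I : Type) (r : seq I) (P : pred I) (f : I -> m.-tuple R -> R) :
  (forall i, P i -> regular (f i)) ->
  Iref (fun t => \sum_(i <- r | P i) f i t) = \sum_(i <- r | P i) Iref (f i).
Proof.
move=> rf; elim: r => [|i r IH].
  rewrite big_nil -[RHS](@Iref0 m); apply: eq_Iref => t _; exact: big_nil.
rewrite big_cons.
rewrite (_ : Iref _ = Iref (fun t => if P i then f i t + \sum_(j <- r | P j) f j t
    else \sum_(j <- r | P j) f j t)); last first.
  by apply: eq_Iref => t _; rewrite big_cons.
case Pi : (P i) => //; rewrite -IH -IrefD//; first exact: rf.
exact: regular_sum.
Qed.

Lemma Iref_ge0 m (f : m.-tuple R -> R) :
  (forall t, refs m t -> 0 <= f t) -> 0 <= Iref f.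
Proof. exact: Rintegral_ge0. Qed.

End RegularFunctions.

(** * The divergence theorem in barycentric coordinates *)

Section ReferenceDivergence.
Context {R : realType}.

(** Unlike induction on monomials, this scheme follows the ring operations, which evaluation,
    substitution and differentiation respect. *)
Lemma mpoly_ring_ind n (P : mpoly n R -> Prop) :
  (forall c, P (mpolyC n c)) -> (forall i, P (mpolyX R (mnm1 i))) ->
  (forall p q, P p -> P q -> P (p + q)) -> (forall p q, P p -> P q -> P (p * q)) ->
  forall p, P p.
Proof.
move=> PC PX PD PM p; rewrite (mpolyE p); elim/big_ind : _ => //.
  by rewrite -mpolyC0.
move=> m _; rewrite -mul_mpolyC; apply: (PM) => //; rewrite mpolyXE_id.
elim/big_ind : _ => [|x y|]; [by rewrite -mpolyC1|exact: PM|].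
by move=> i _; elim: (m i) => [|k IH]; rewrite ?expr0 -?mpolyC1// exprS; exact: PM.
Qed.

(** The barycentric coordinates of [t], with index 0 for the origin; they make [param] a barycentric
    combination of vertices. *)
Definition bary m (t : m.-tuple R) (i : 'I_m.+1) : R :=
  if unlift ord0 i is Some j then tnth t j else 1 - \sum_j tnth t j.

Lemma bary_prod m (t : m.-tuple R) (a : 'I_m.+1 -> nat) :
  \prod_i bary t i ^+ a i =
  (1 - \sum_j tnth t j) ^+ a ord0 * \prod_j tnth t j ^+ a (lift ord0 j).
Proof.
rewrite big_ord_recl /bary unlift_none; congr (_ * _).
by apply: eq_bigr => j _; rewrite liftK.
Qed.

Lemma sum_bary m (t : m.-tuple R) : \sum_i bary t i = 1.
Proof.
rewrite big_ord_recl /bary unlift_none.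
by apply/eqP; rewrite addrAC subr_eq; apply/eqP; congr (_ + _); apply: eq_bigr => j _; rewrite liftK.
Qed.

Lemma bary_gt0 m (t : m.-tuple R) i : @ref_simplex R m t -> 0 < bary t i.
Proof.
by move=> [t0 t1]; rewrite /bary; case: unlift => // ; rewrite subr_gt0.
Qed.

Lemma regular_bary m i : regular (fun t : m.-tuple R => bary t i).
Proof.
rewrite /bary; case: unliftP => [j _|_]; first exact: regular_tnth.
apply: regularD; first exact: regular_cst.
under eq_fun do rewrite -mulN1r.
apply: regularM; first exact: regular_cst.
by apply: regular_sum => j _; exact: regular_tnth.
Qed.

Lemma regular_meval m n (v : m.-tuple R -> 'I_n -> R) (p : mpoly n R) :
  (forall i, regular (fun t => v t i)) -> regular (fun t => meval (v t) p).
Proof.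
move=> rv; elim/mpoly_ring_ind : p => [c|i|p q rp rq|p q rp rq].
- by under eq_fun do rewrite mevalC; exact: regular_cst.
- by under eq_fun do rewrite mevalXU.
- by under eq_fun do rewrite mevalD; exact: regularD.
- by under eq_fun do rewrite mevalM; exact: regularM.
Qed.

Lemma Iref_bary m (a : 'I_m.+1 -> nat) :
  Iref (fun t : m.-tuple R => \prod_i bary t i ^+ a i) =
  (\prod_i (a i)`!)%:R / (m + \sum_i a i)`!%:R.
Proof.
rewrite /Iref /Rintegral; under eq_integral do rewrite bary_prod.
by rewrite integral_dirichlet/= !(big_ord_recl _ a) !big_ord_recl/= addnA.
Qed.

(* Extension by 0 at v: the barycentric coordinates in a simplex of a point of
   its facet opposite to the vertex v. *)
Definition extend0 m (v : 'I_m.+1) (c : 'I_m -> R) (i : 'I_m.+1) : R :=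
  if unlift v i is Some j then c j else 0.

(** On the face opposite to v a monomial in which v occurs vanishes; the boolean factor is
    [0 ^+ a v]. *)
Lemma Iref_face m (a : 'I_m.+2 -> nat) v :
  Iref (fun s : m.-tuple R => \prod_i extend0 v (bary s) i ^+ a i) =
  (a v == 0%N)%:R * ((\prod_i (a i)`!)%:R / (m + \sum_i a i)`!%:R).
Proof.
transitivity (Iref (fun s : m.-tuple R => (a v == 0%N)%:R * \prod_i bary s i ^+ a (lift v i))).
  apply: eq_Iref => s _; rewrite (bigD1_ord v)//= /extend0 unlift_none expr0n.
  by congr (_ * _); apply: eq_bigr => j _; rewrite liftK.
rewrite IrefZ; last first.
  by apply: regular_prod => i; apply: regularX; exact: regular_bary.
rewrite Iref_bary; have [av|] := eqVneq (a v) 0%N; last by rewrite !mul0r.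
by rewrite !mul1r (bigD1_ord v)//= av mul1n [in RHS](bigD1_ord v)//= av add0n.
Qed.

(** The operator on the left is the derivative along the edge from vertex j to vertex i. This edge
    is parallel to all faces except those opposite to i and j, so only these two contribute. By
    linearity it suffices to compare monomials. *)
Lemma ref_divergence m (P : mpoly m.+2 R) i j :
  Iref (fun t : m.+1.-tuple R => meval (bary t) (mderiv i P - mderiv j P)) =
  Iref (fun s : m.-tuple R => meval (extend0 j (bary s)) P) -
  Iref (fun s : m.-tuple R => meval (extend0 i (bary s)) P).
Proof.
have rI (Q : mpoly m.+2 R) : regular (fun t : m.+1.-tuple R => meval (bary t) Q).
  by apply: regular_meval => k; exact: regular_bary.
have rF v (Q : mpoly m.+2 R) : regular (fun t : m.-tuple R => meval (extend0 v (bary t)) Q).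
  apply: regular_meval => k; rewrite /extend0.
  by case: unlift => [l|]; [exact: regular_bary|exact: regular_cst].
have IB k l (Q : mpoly k R) (v : l.-tuple R -> 'I_k -> R) c (Q' : mpoly k R) :
    (forall Q, regular (fun t => meval (v t) Q)) ->
    Iref (fun t => meval (v t) (c *: Q + Q')) =
    c * Iref (fun t => meval (v t) Q) + Iref (fun t => meval (v t) Q').
  move=> rv; rewrite -IrefZ// -IrefD//; last first.
    by apply: regularM => //; exact: regular_cst.
  by apply: eq_Iref => t _; rewrite mevalD mevalZ.
elim/mpolyind : P => [|c a P _ _ IH].
  have I0 k l (v : l.-tuple R -> 'I_k -> R) : Iref (fun t => meval (v t) 0) = 0.
    by rewrite -[RHS](@Iref0 _ l); apply: eq_Iref => t _; rewrite meval0.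
  by rewrite !mderiv0 subr0 !I0 subr0.
rewrite !mderivD !mderivZ opprD addrACA -scalerBr !IB// IH.
rewrite opprD addrACA -mulrBr; congr (c * _ + _).
(* Differentiation lowers the degree by one while the simplex has one dimension more than its faces,
   so the denominator is the one of [face] below; the two boolean factors are complementary. *)
have mono k : Iref (fun t : m.+1.-tuple R => meval (bary t) (mderiv k (mpolyX R a))) =
   (a k != 0%N)%:R * ((\prod_i (a i)`!)%:R / (m + \sum_i a i)`!%:R).
  rewrite mderivX.
  rewrite (_ : (fun _ => _) = fun t => (a k)%:R * \prod_i bary t i ^+ (a i - (k == i))); last first.
    apply/funext => t; rewrite mevalZ mevalX; congr (_ * _); apply: eq_bigr => l _.
    by rewrite mnmBE mnm1E.
  rewrite IrefZ; last first.
    by apply: regular_prod => l; apply: regularX; exact: regular_bary.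
  rewrite Iref_bary; case: (posnP (a k)) => [->|ak]; first by rewrite !mul0r.
  rewrite mul1r mulrA -natrM; congr (_%:R / _`!%:R).
    rewrite (bigD1 k)//= [in RHS](bigD1 k)//= eqxx subn1 mulnA.
    rewrite -{1}(prednK ak) -factS prednK//; congr (_ * _)%N.
    by apply: eq_bigr => l /negPf; rewrite eq_sym => ->; rewrite subn0.
  rewrite (bigD1 k)//= [in RHS](bigD1 k)//= eqxx.
  rewrite (eq_bigr a) => [|l /negPf]; last by rewrite eq_sym => ->; rewrite subn0.
  by move: ak; set S := (\sum_(_ | _) _)%N; lia.
have face v : Iref (fun s : m.-tuple R => meval (extend0 v (bary s)) (mpolyX R a)) =
    (a v == 0%N)%:R * ((\prod_i (a i)`!)%:R / (m + \sum_i a i)`!%:R).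
  by rewrite -Iref_face; apply: eq_Iref => s _; rewrite mevalX.
rewrite (_ : (fun _ => _) = fun t => meval (bary t) ((-1) *: mderiv j (mpolyX R a) + mderiv i (mpolyX R a))); last first.
  by apply/funext => t; rewrite scaleN1r addrC.
rewrite IB// !mono !face mulN1r -mulNr -!mulrBl -mulrDl; congr (_ * _).
by case: (a i) => [|?]; case: (a j) => [|?] //=; ring.
Qed.

End ReferenceDivergence.

(** * The divergence theorem on a simplex *)

Section Dot.
Context {R : realType} {d : nat}.
Implicit Types a b c : 'rV[R]_d.

Lemma dotE a b : dot a b = (a *m b^T) 0 0.
Proof. by rewrite mxE; apply: eq_bigr => i _; rewrite mxE. Qed.

Lemma dotC a b : dot a b = dot b a.
Proof. by apply: eq_bigr => i _; rewrite mulrC. Qed.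

Lemma dotDl a b c : dot (a + b) c = dot a c + dot b c.
Proof. by rewrite !dotE mulmxDl mxE. Qed.

Lemma dotDr a b c : dot c (a + b) = dot c a + dot c b.
Proof. by rewrite dotC dotDl !(dotC c). Qed.

Lemma dotZl k a b : dot (k *: a) b = k * dot a b.
Proof. by rewrite !dotE -scalemxAl mxE. Qed.

Lemma dotZr k a b : dot a (k *: b) = k * dot a b.
Proof. by rewrite dotC dotZl dotC. Qed.

Lemma dotNl a b : dot (- a) b = - dot a b.
Proof. by rewrite -scaleN1r dotZl mulN1r. Qed.

Lemma dotNr a b : dot a (- b) = - dot a b.
Proof. by rewrite dotC dotNl dotC. Qed.

Lemma dotBl a b c : dot (a - b) c = dot a c - dot b c.
Proof. by rewrite dotDl dotNl. Qed.

Lemma dotBr a b c : dot c (a - b) = dot c a - dot c b.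
Proof. by rewrite dotDr dotNr. Qed.

Lemma dot0l a : dot 0 a = 0.
Proof. by rewrite dotE mul0mx mxE. Qed.

Lemma dot0r a : dot a 0 = 0.
Proof. by rewrite dotC dot0l. Qed.

Lemma dot_suml (I : Type) (r : seq I) (P : pred I) (f : I -> 'rV[R]_d) b :
  dot (\sum_(i <- r | P i) f i) b = \sum_(i <- r | P i) dot (f i) b.
Proof.
elim: r => [|i r IH]; first by rewrite !big_nil dot0l.
by rewrite !big_cons; case: ifP => // _; rewrite dotDl IH.
Qed.

Lemma dot_ge0 a : 0 <= dot a a.
Proof. by apply: sumr_ge0 => i _; rewrite -expr2 sqr_ge0. Qed.

Lemma dot_eq0 a : dot a a = 0 -> a = 0.
Proof.
move=> /eqP; rewrite psumr_eq0 => [/allP a0|i _]; last by rewrite -expr2 sqr_ge0.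
apply/rowP => i; rewrite mxE; apply/eqP.
by have := a0 i (mem_index_enum _); rewrite -expr2 sqrf_eq0.
Qed.

Lemma enorm_sqr a : enorm a ^+ 2 = dot a a.
Proof. by rewrite sqr_sqrtr// dot_ge0. Qed.

Lemma dot_row_eq m (A : 'M[R]_(m, d)) a :
  (forall i, dot a (row i A) = 0) -> A *m a^T = 0.
Proof.
move=> aA; apply/colP => i; rewrite [RHS]mxE -(aA i) dotC dotE -row_mul [RHS]mxE.
by [].
Qed.

End Dot.

(** * Volumes, heights and permutations of vertices *)

Section Volume.
Context {R : realType}.

Definition vol m n (A : 'M[R]_(m, n)) : R := Num.sqrt (\det (A *m A^T)).

Definition edges_from m n (x : 'I_m.+1 -> 'rV[R]_n) : 'M[R]_(m, n) :=
  \matrix_(i < m) (x (lift ord0 i) - x ord0).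

Lemma vol_square m (A : 'M[R]_m) : vol A = `|\det A|.
Proof. by rewrite /vol det_mulmx det_tr -expr2 sqrtr_sqr. Qed.

(** This matrix treats all vertices alike, whereas [edges_from] singles out the first one: a
    permutation of the vertices becomes a permutation of its rows. *)
Definition homogenize m (x : 'I_m.+1 -> 'rV[R]_m) : 'M[R]_(m.+1, 1 + m) :=
  row_mx (const_mx 1) (\matrix_(i < m.+1) x i).

Lemma det_homogenize m (x : 'I_m.+1 -> 'rV[R]_m) :
  \det (homogenize x : 'M[R]_(1 + m)) = \det (edges_from x).
Proof.
have -> : homogenize x =
   block_mx 1%:M 0 (const_mx 1) 1%:M *m block_mx 1%:M (x ord0) 0 (edges_from x).
  rewrite mulmx_block !mul1mx !mul0mx !mulmx1 !addr0.
  apply/matrixP => i j; rewrite !mxE.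
  change 'I_(1 + m) in i.
  case: (splitP i) => i' ii'; rewrite !mxE; case: (splitP j) => j' jj'; rewrite !mxE ?ord1//.
  - by rewrite (_ : i = ord0)//; apply: val_inj; rewrite /= ii' ord1.
  - rewrite big_ord1 mxE mul1r addrC subrK; congr (x _ 0 _).
    exact: val_inj.
rewrite det_mulmx det_lblock !det1 det_ublock !det1; ring.
Qed.

Lemma det_edges_from_perm m (x : 'I_m.+1 -> 'rV[R]_m) (s : 'S_m.+1) :
  `|\det (edges_from (x \o s))| = `|\det (edges_from x)|.
Proof.
rewrite -!det_homogenize.
have -> : homogenize (x \o s) = row_perm s (homogenize x).
  apply/matrixP => i j; rewrite !mxE.
  by case: fintype.split => k; rewrite !mxE.
by rewrite row_permE det_mulmx det_perm normrM normr_sign mul1r.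
Qed.

Lemma row_free_mulmx_tr m n (A : 'M[R]_(m, n)) : row_free A -> \det (A *m A^T) != 0.
Proof.
move=> fA; rewrite -unitfE -[_ \is a _]/(A *m A^T \in unitmx) -row_free_unit.
apply: inj_row_free => v; rewrite mulmxA => vAA.
have : dot (v *m A) (v *m A) = 0.
  by rewrite dotE trmx_mul mulmxA vAA mul0mx mxE.
by move/dot_eq0 => vA; apply/eqP; rewrite -(mulmx_free_eq0 v fA) vA.
Qed.

Lemma row_free_col_mx m n (w : 'rV[R]_n) (A : 'M[R]_(m, n)) :
  row_free (col_mx w A) -> row_free A.
Proof.
move=> fwA; apply: inj_row_free => v vA0.
have : row_mx (0 : 'rV_1) v *m col_mx w A = 0.
  by rewrite mul_row_col mul0mx add0r.
move/eqP; rewrite mulmx_free_eq0// => /eqP.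
by rewrite -row_mx0 => /eq_row_mx[].
Qed.

(* [h] is the height of the simplex over the facet with edges [A]. *)
Lemma det_col_mx_height m (n w : 'rV[R]_(1 + m)) (A : 'M[R]_(m, 1 + m)) h :
  A *m n^T = 0 -> dot n n = 1 -> dot w n = - h -> 0 <= h -> row_free A ->
  `|\det (col_mx w A)| = h * vol A.
Proof.
move=> An nn wn h0 fA.
have nA : n *m A^T = 0 by rewrite -[LHS]trmxK trmx_mul trmxK An trmx0.
have nnE : n *m n^T = 1%:M by rewrite [LHS]mx11_scalar -dotE nn.
have wnE : w *m n^T = (- h)%:M by rewrite [LHS]mx11_scalar -dotE wn.
(* As n is a unit vector orthogonal to the rows of A, multiplying by the transpose of [col_mx n A]
   gives block triangular matrices. *)
have sqr_det : \det (col_mx n A) ^+ 2 = \det (A *m A^T).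
  rewrite expr2 -{2}[col_mx n A]trmxK det_tr -det_mulmx tr_col_mx mul_col_row.
  by rewrite nnE nA An det_lblock det1 mul1r.
have det_w : \det (col_mx w A) * \det (col_mx n A) = - h * \det (A *m A^T).
  rewrite -[col_mx n A]trmxK det_tr -det_mulmx tr_col_mx mul_col_row.
  by rewrite wnE An det_ublock det_scalar1.
have g0 := row_free_mulmx_tr fA; rewrite /vol -sqr_det sqrtr_sqr.
have d0 : \det (col_mx n A) != 0 by rewrite -sqrf_eq0 sqr_det.
apply: (@mulIf _ `|\det (col_mx n A)|); first by rewrite normr_eq0.
rewrite -normrM det_w -sqr_det normrM normrN (ger0_norm h0) -mulrA.
by rewrite -normrM expr2.
Qed.

End Volume.

Section ChainRule.
Context {R : realType}.

Lemma mderivXU n (i k : 'I_n) : mderiv i (mpolyX R (mnm1 k)) = (k == i)%:R.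
Proof.
rewrite mderivX mnm1E; have [->|_] := eqVneq k i; last by rewrite scale0r.
by rewrite scale1r -[RHS]mpolyX0; congr (mpolyX R _); apply/mnmP => j; rewrite mnmBE subnn mnm0E.
Qed.

Lemma mderiv_comp_mpoly n k (lq : n.-tuple (mpoly k R)) (q : mpoly n R) i :
  mderiv i (comp_mpoly lq q) = \sum_l mderiv i (tnth lq l) * comp_mpoly lq (mderiv l q).
Proof.
elim/(@mpoly_ring_ind R n) : q => [c|l|q q' IH IH'|q q' IH IH'].
- by rewrite comp_mpolyC mderivC big1// => l _; rewrite mderivC raddf0 mulr0.
- rewrite comp_mpolyXU (bigD1 l)//= big1 ?addr0 => [|j jl].
    by rewrite mderivXU eqxx rmorph1 mulr1 (tnth_nth 0).
  by rewrite mderivXU eq_sym (negPf jl) rmorph0 mulr0.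
- rewrite raddfD/= mderivD IH IH' -big_split/=; apply: eq_bigr => l _.
  by rewrite mderivD raddfD/= mulrDr.
- rewrite rmorphM/= mderivM IH IH' mulr_suml mulr_sumr -big_split/=; apply: eq_bigr => l _.
  by rewrite mderivM raddfD/= !rmorphM/= mulrDr [in RHS]mulrA [in LHS]mulrCA.
Qed.

End ChainRule.

(** * Normals and heights of a nondegenerate simplex *)

Section Simplex.
Context {R : realType} {m : nat}.
Local Notation d := m.+2.
Variable x : 'I_d.+1 -> 'rV[R]_d.
Implicit Types i j k : 'I_d.+1.

Definition facet_pts i : 'I_d -> 'rV[R]_d := x \o lift i.

(** The order lift i 0, i, lift i 1, lift i 2, and so on. Based at the first vertex of the facet,
    the edge matrix then consists of the edge to i on top of the edge matrix of the facet. *)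
Definition facet_perm i : 'S_d.+1 := (tperm ord0 (lift ord0 ord0) * lift_perm ord0 i 1)%g.

Lemma facet_perm0 i : facet_perm i ord0 = lift i ord0.
Proof. by rewrite permM tpermL lift_perm_lift perm1. Qed.

Lemma facet_perm1 i : facet_perm i (lift ord0 ord0) = i.
Proof. by rewrite permM tpermR lift_perm_id. Qed.

Lemma facet_permS i (l : 'I_m.+1) :
  facet_perm i (lift ord0 (lift ord0 l)) = lift i (lift ord0 l).
Proof.
by rewrite permM tpermD ?lift_perm_lift ?perm1.
Qed.

Lemma edges_from_facet_perm i : edges_from (x \o facet_perm i) =
  col_mx (x i - x (lift i ord0)) (edges_from (facet_pts i)) :> 'M[R]_(1 + m.+1, d).
Proof.
apply/matrixP => a b; change 'I_(1 + m.+1) in a; rewrite !mxE /= facet_perm0.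
case: (splitP a) => a' aa'; rewrite !mxE.
  rewrite (_ : a = ord0); last by apply: val_inj; rewrite /= aa' ord1.
  by rewrite facet_perm1 !ord1.
by rewrite (_ : a = lift ord0 a') ?facet_permS//; exact: val_inj.
Qed.

Hypothesis free_x : row_free (edges_from x).

Lemma row_free_facet_perm i :
  row_free (col_mx (x i - x (lift i ord0)) (edges_from (facet_pts i)) : 'M[R]_(1 + m.+1)).
Proof.
have := free_x; rewrite row_free_unit unitmxE unitfE -normr_eq0.
rewrite -(det_edges_from_perm x (facet_perm i)) edges_from_facet_perm normr_eq0.
by rewrite -unitfE -unitmxE -row_free_unit.
Qed.

Lemma row_free_facet i : row_free (edges_from (facet_pts i)).
Proof. exact: row_free_col_mx (row_free_facet_perm i). Qed.

Definition normal_at i (n : 'rV[R]_d) := [/\ dot n n = 1,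
  forall j k, j != i -> k != i -> dot n (x j - x k) = 0 &
  forall j, j != i -> dot n (x i - x j) < 0].

Lemma facet_perp i (n : 'rV[R]_d) :
  (forall j k, j != i -> k != i -> dot n (x j - x k) = 0) ->
  edges_from (facet_pts i) *m n^T = 0.
Proof.
move=> nx; apply: dot_row_eq => l; rewrite rowK; apply: nx; by rewrite eq_sym neq_lift.
Qed.

(** There is no factor 1/d, because [vol] is the area element of the parametrization, that is, the
    measure of the simplex times the factorial of its dimension. *)
Lemma vol_height i n : normal_at i n ->
  vol (edges_from x) = - dot n (x i - x (lift i ord0)) * vol (edges_from (facet_pts i)).
Proof.
move=> [nn nx ni]; rewrite vol_square -(det_edges_from_perm x (facet_perm i)).
rewrite edges_from_facet_perm; apply: (det_col_mx_height (n := n)) => //.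
- exact: facet_perp.
- by rewrite dotC opprK.
- by rewrite oppr_ge0 ltW// ni// eq_sym neq_lift.
- exact: row_free_facet.
Qed.

(** The gradient of the barycentric coordinate at i is orthogonal to the opposite facet and points
    towards i; the normal is this vector, normalized and reversed. It solves a linear system with
    the invertible edge matrix. *)
Lemma normal_exists i : exists n, normal_at i n.
Proof.
set A := edges_from (x \o facet_perm i).
have uA : A \in unitmx by rewrite -row_free_unit /A edges_from_facet_perm row_free_facet_perm.
pose y := invmx A *m delta_mx ord0 ord0 : 'cV_d.
have Ay a : dot (x (facet_perm i (lift ord0 a)) - x (lift i ord0)) y^T = (a == ord0)%:R.
  transitivity ((A *m y) a ord0); last by rewrite mulmxA mulmxV// mul1mx mxE eqxx andbT.
  rewrite dotE trmxK [RHS]mxE [LHS]mxE; apply: eq_bigr => b _.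
  by rewrite !mxE /= facet_perm0.
have wy : dot (x i - x (lift i ord0)) y^T = 1 by have := Ay ord0; rewrite facet_perm1.
have ly l : dot (x (lift i l)) y^T = dot (x (lift i ord0)) y^T.
  case: (unliftP ord0 l) => [l'|] -> //; apply/eqP; rewrite -subr_eq0 -dotBl.
  by have := Ay (lift ord0 l'); rewrite facet_permS => ->.
have y0 : 0 < dot y^T y^T.
  rewrite lt_neqAle dot_ge0 andbT eq_sym; apply/eqP => /dot_eq0 yT0.
  by have := wy; rewrite yT0 dot0r => /eqP; rewrite eq_sym oner_eq0.
have xl j : j != i -> dot (x j) y^T = dot (x (lift i ord0)) y^T.
  by rewrite eq_sym => /unlift_some[l -> _]; exact: ly.
exists (- (enorm y^T)^-1 *: y^T); split.
- by rewrite dotZl dotZr mulrA mulrNN -expr2 exprVn -enorm_sqr mulVf// enorm_sqr gt_eqF.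
- by move=> j k ji ki; rewrite dotZl dotC dotBl !xl// subrr mulr0.
- move=> j ji; rewrite dotZl dotC dotBl (xl _ ji) -dotBl wy mulr1 oppr_lt0 invr_gt0.
  by rewrite sqrtr_gt0.
Qed.

Lemma edges_perp (y : 'rV[R]_d) :
  (forall j k, dot y (x j - x k) = 0) -> y = 0.
Proof.
move=> yx; apply/eqP; rewrite -(trmx_eq0 y); apply/eqP.
have uE : edges_from x \in unitmx by rewrite -row_free_unit.
by rewrite -(mulKmx uE y^T) dot_row_eq ?mulmx0// => i; rewrite rowK.
Qed.

(** The edges span the space, so the identity, read as one between vectors indexed by j, may be
    tested against the edges x a - x b. On the left this gives the derivative of [ref_divergence];
    on the right only the normals opposite to a and b are not orthogonal to the edge, and
    [vol_height] turns their facet areas into the volume of the simplex. *)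
Lemma simplex_divergence (n : 'I_d.+1 -> 'rV[R]_d) (p : mpoly d R) (j : 'I_d) :
  (forall i, normal_at i (n i)) ->
  vol (edges_from x) *
    Iref (fun t : d.-tuple R => meval ((\sum_i bary t i *: x i) 0) (mderiv j p)) =
  \sum_i n i 0 j * (vol (edges_from (facet_pts i)) *
    Iref (fun s : m.+1.-tuple R => meval ((\sum_k bary s k *: facet_pts i k) 0) p)).
Proof.
move=> nx.
pose D (i : 'I_d) := Iref (fun t : d.-tuple R => meval ((\sum_i bary t i *: x i) 0) (mderiv i p)).
pose J i := Iref (fun s : m.+1.-tuple R => meval ((\sum_k bary s k *: facet_pts i k) 0) p).
pose y := \row_j (vol (edges_from x) * D j) -
  \sum_i (vol (edges_from (facet_pts i)) * J i) *: n i.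
suff /rowP/(_ j) : y = 0.
  rewrite /y !mxE summxE => /eqP; rewrite subr_eq0 => /eqP ->.
  by apply: eq_bigr => i _; rewrite mxE mulrC.
apply: edges_perp => a b; rewrite dotBl.
(* The affine map from barycentric to Cartesian coordinates, as a tuple of polynomials to be
   substituted into p. *)
pose lq : d.-tuple (mpoly d.+1 R) := [tuple \sum_i x i 0 j *: mpolyX R (mnm1 i) | j < d].
have lqE (c : 'I_d.+1 -> R) q : meval c (comp_mpoly lq q) = meval ((\sum_i c i *: x i) 0) q.
  rewrite comp_mpoly_meval; apply: meval_eq => l; rewrite tnth_mktuple summxE raddf_sum/=.
  by apply: eq_bigr => i _; rewrite mevalZ mevalXU mxE mulrC.
have chain i q : mderiv i (comp_mpoly lq q) = \sum_l x i 0 l *: comp_mpoly lq (mderiv l q).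
  rewrite mderiv_comp_mpoly; apply: eq_bigr => l _.
  rewrite tnth_mktuple raddf_sum/= (bigD1 i)//= big1 ?addr0.
    by rewrite mderivZ mderivXU eqxx -scalerAl mul1r.
  by move=> k ki; rewrite mderivZ mderivXU (negPf ki) scaler0.
pose P := comp_mpoly lq p.
have JE v : J v = Iref (fun s : m.+1.-tuple R => meval (extend0 v (bary s)) P).
  apply: eq_Iref => s _; rewrite lqE; congr (meval (_ 0) p).
  apply/esym; rewrite (bigD1_ord v)//= /extend0 unlift_none scale0r add0r.
  by rewrite (eq_bigr (fun k : 'I_d => bary s k *: x (lift v k)))// => k _; rewrite liftK.
have rx q : regular (fun t : d.-tuple R => meval ((\sum_i bary t i *: x i) 0) q).
  apply: regular_meval => l; under eq_fun do rewrite summxE; apply: regular_sum => i _.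
  under eq_fun do rewrite mxE; apply: regularM; first exact: regular_bary.
  exact: regular_cst.
have -> : dot (\row_j (vol (edges_from x) * D j)) (x a - x b) = vol (edges_from x) * (J b - J a).
  rewrite !JE -ref_divergence.
  transitivity (vol (edges_from x) * \sum_j (x a 0 j - x b 0 j) * D j).
    rewrite /dot mulr_sumr; apply: eq_bigr => l _; rewrite !mxE; ring.
  congr (_ * _).
  transitivity (Iref (fun t : d.-tuple R => \sum_l (x a 0 l - x b 0 l) *
    meval ((\sum_i bary t i *: x i) 0) (mderiv l p))).
    rewrite Iref_sum => [|l _]; last by apply: regularM => //; exact: regular_cst.
    by apply: eq_bigr => l _; rewrite IrefZ.
  apply: eq_Iref => t _; rewrite !chain -sumrB raddf_sum/=; apply: eq_bigr => l _.
  by rewrite -scalerBl mevalZ lqE.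
rewrite dot_suml; apply/eqP; rewrite subr_eq0; apply/eqP.
have [<-|ab] := eqVneq a b.
  by rewrite subrr mulr0 big1// => i _; rewrite subrr dot0r.
rewrite (bigD1 a)//= (bigD1 b) 1?eq_sym//= big1 ?addr0; last first.
  move=> i /andP[ia ib]; have [_ nx0 _] := nx i.
  by rewrite dotZl nx0 ?mulr0// eq_sym.
(* The height can be measured from any vertex of the facet. *)
have hE i k : k != i -> vol (edges_from x) = - dot (n i) (x i - x k) * vol (edges_from (facet_pts i)).
  move=> ki; rewrite (vol_height (nx i)); have [_ nx0 _] := nx i.
  congr (- _ * _); apply/eqP; rewrite -subr_eq0 -dotBr opprB addrC addrA subrK nx0//.
  by rewrite eq_sym neq_lift.
rewrite mulrBr {1}(hE b a)// (hE a b) 1?eq_sym// !dotZl.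
have -> : dot (n b) (x a - x b) = - dot (n b) (x b - x a) by rewrite -dotNr opprB.
ring.
Qed.

End Simplex.

(** * Integrals over the simplices of a mesh *)

Section Enumeration.
Context {R : realType} {n : nat} {V : finType} (X : V -> 'rV[R]_n).
Implicit Types S : {set V}.

Lemma vertex_atE S m (v : V) : (m < #|S|)%N -> vertex_at X S m = X (nth v (enum S) m).
Proof. by move=> mS; rewrite /vertex_at (nth_map v)// -cardE. Qed.

(** Subsets inherit the order of [enum], so deleting the i-th vertex shifts the later positions by
    one, which is [lift i]. This ties together the parametrizations of a cell and of its facets. *)
Lemma simplex_enum S m : #|S| = m.+1 -> exists e : 'I_m.+1 -> V,
  [/\ injective e, S = [set e i | i in 'I_m.+1]%SET,
      forall i : 'I_m.+1, vertex_at X S i = X (e i) &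
      forall i (j : 'I_m), vertex_at X (S :\ e i) j = X (e (lift i j))].
Proof.
move=> cS; have [v0 v0S] : exists v, v \in S.
  by apply/set0Pn; rewrite -cards_eq0 cS.
pose e (i : 'I_m.+1) := nth v0 (enum S) i.
have szS : size (enum S) = m.+1 by rewrite -cardE.
have e_inj : injective e.
  by move=> i j /eqP; rewrite nth_uniq ?szS ?enum_uniq// => /eqP/val_inj.
have eS i : e i \in S by rewrite -mem_enum mem_nth// szS.
exists e; split => //.
- apply/setP => v; apply/idP/imsetP => [vS|[i _ ->]//].
  have iv : (index v (enum S) < m.+1)%N by rewrite -szS index_mem mem_enum.
  by exists (Ordinal iv) => //; rewrite /e /= nth_index// mem_enum.
- by move=> i; rewrite (vertex_atE v0) ?cS.
move=> i j.
have cSi : #|S :\ e i| = m by have := cardsD1 (e i) S; rewrite eS cS add1n => -[].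
rewrite (vertex_atE v0) ?cSi//; congr X.
have -> : enum (S :\ e i) = rem (e i) (enum S).
  rewrite rem_filter ?enum_uniq// /enum_mem -filter_predI.
  by apply: eq_filter => v; rewrite /= !inE.
rewrite remE /e index_uniq ?szS ?enum_uniq// nth_cat size_take szS ltn_ord.
rewrite /lift /= /bump; case: ltnP => ij.
  by rewrite nth_take// leqNgt ij.
by rewrite nth_drop; congr nth; rewrite /= addSn subnKC.
Qed.

Lemma hull_enum S m (e : 'I_m.+1 -> V) (c : 'I_m.+1 -> R) :
  injective e -> S = [set e i | i in 'I_m.+1]%SET ->
  (forall i, 0 <= c i) -> \sum_i c i = 1 -> hull X S (\sum_i c i *: X (e i)).
Proof.
move=> e_inj -> c0 c1.
(* Transports [c] along [e] without an inverse of [e], with value 0 off the image. *)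
pose c' v := \sum_(i | e i == v) c i.
have c'E i : c' (e i) = c i.
  by rewrite /c' (big_pred1 i)// => j; rewrite (inj_eq e_inj).
exists c'; split => [v||]; first exact: sumr_ge0.
  by rewrite big_imset/= => [|i j _ _ /e_inj//]; rewrite -c1; apply: eq_bigr.
by rewrite big_imset/= => [|i j _ _ /e_inj//]; apply: eq_bigr => i _; rewrite c'E.
Qed.

End Enumeration.

Section MeshIntegrals.
Context {R : realType} {n : nat} {Omega : set 'rV[R]_n}.
Variable T : triangulation Omega.
Local Notation simplex := {set vertex T}.
Local Notation point := ('rV[R]_n).
Implicit Types (S : simplex) (g : point -> R).

Lemma edgesE m S (x : 'I_m.+1 -> point) :
  (forall i : 'I_m.+1, vertex_at (Defs.coord T) S i = x i) ->
  edges (Defs.coord T) m S = edges_from x.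
Proof.
move=> Sx; apply/matrixP => i j; rewrite !mxE.
by rewrite -(Sx (lift ord0 i)) -(Sx ord0).
Qed.

Lemma paramE m S (x : 'I_m.+1 -> point) (t : m.-tuple R) :
  (forall i : 'I_m.+1, vertex_at (Defs.coord T) S i = x i) ->
  param S t = \sum_i bary t i *: x i.
Proof.
move=> Sx; rewrite /param (edgesE Sx) (Sx ord0 : vertex_at _ _ 0 = _).
rewrite mulmx_sum_row big_ord_recl /bary unlift_none.
rewrite scalerBl scale1r -addrA; congr (_ + _).
rewrite scaler_suml addrC -sumrB; apply: eq_bigr => i _.
by rewrite rowK mxE liftK scalerBr.
Qed.

Definition sregular m S g : Prop := regular (fun t : m.-tuple R => g (param S t)).

Lemma integral_simplexE m S g : integral_simplex m S g =
  vol (edges (Defs.coord T) m S) * Iref (fun t : m.-tuple R => g (param S t)).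
Proof. by []. Qed.

Lemma eq_integral_simplex m S g g' :
  (forall x, relint m S x -> g x = g' x) -> integral_simplex m S g = integral_simplex m S g'.
Proof.
move=> gg'; rewrite !integral_simplexE; congr (_ * _); apply: eq_Iref => t rt.
by apply: gg'; exists t.
Qed.

Lemma eq_sregular m S g g' :
  (forall x, relint m S x -> g x = g' x) -> sregular m S g -> sregular m S g'.
Proof. by move=> gg'; apply: eq_regular => t rt; apply: gg'; exists t. Qed.

Lemma integral_simplexD m S g g' : sregular m S g -> sregular m S g' ->
  integral_simplex m S (fun x => g x + g' x) = integral_simplex m S g + integral_simplex m S g'.
Proof. by move=> rg rg'; rewrite !integral_simplexE IrefD// mulrDr. Qed.

Lemma integral_simplexZ m S c g : sregular m S g ->
  integral_simplex m S (fun x => c * g x) = c * integral_simplex m S g.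
Proof. by move=> rg; rewrite !integral_simplexE IrefZ// mulrCA. Qed.

Lemma integral_simplex_ge0 m S g :
  (forall x, relint m S x -> 0 <= g x) -> 0 <= integral_simplex m S g.
Proof.
move=> g0; rewrite mulr_ge0 ?sqrtr_ge0//; apply: Iref_ge0 => t rt.
by apply: g0; exists t.
Qed.

Lemma sregular_cst m S c : sregular m S (fun=> c).
Proof. exact: regular_cst. Qed.

Lemma sregularD m S g g' :
  sregular m S g -> sregular m S g' -> sregular m S (fun x => g x + g' x).
Proof. exact: regularD. Qed.

Lemma sregularM m S g g' :
  sregular m S g -> sregular m S g' -> sregular m S (fun x => g x * g' x).
Proof. exact: regularM. Qed.

Lemma sregularN m S g : sregular m S g -> sregular m S (fun x => - g x).
Proof.
move=> rg; apply: (@eq_sregular _ _ (fun x => -1 * g x)) => [x _|]; first by rewrite mulN1r.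
by apply: sregularM => //; exact: sregular_cst.
Qed.

Lemma sregularB m S g g' :
  sregular m S g -> sregular m S g' -> sregular m S (fun x => g x - g' x).
Proof. by move=> rg rg'; apply: sregularD => //; exact: sregularN. Qed.

Lemma sregular_lam m S g : sregular m S g -> sregular m S (fun x => lam (g x)).
Proof. exact: regular_lam. Qed.

Lemma sregular_sum m S (I : Type) (r : seq I) (P : pred I) (g : I -> point -> R) :
  (forall i, P i -> sregular m S (g i)) -> sregular m S (fun x => \sum_(i <- r | P i) g i x).
Proof. by move=> rg; exact: (@regular_sum _ _ _ _ _ (fun i t => g i (param S t))). Qed.

Lemma sregular_coord m S j : sregular m S (fun x => x 0 j).
Proof.
rewrite /sregular /param; under eq_fun do rewrite mxE.
apply: regularD; first exact: regular_cst.
under eq_fun do rewrite mxE; apply: regular_sum => i _; apply: regularM; last exact: regular_cst.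
by under eq_fun do rewrite mxE; exact: regular_tnth.
Qed.

Lemma sregular_meval m S (p : mpoly n R) : sregular m S (fun x => meval (x 0) p).
Proof. by apply: regular_meval => j; exact: sregular_coord. Qed.

Lemma integral_simplexN m S g : sregular m S g ->
  integral_simplex m S (fun x => - g x) = - integral_simplex m S g.
Proof.
move=> rg; rewrite -mulN1r -integral_simplexZ//.
by apply: eq_integral_simplex => x _; rewrite mulN1r.
Qed.

Lemma integral_simplexB m S g g' : sregular m S g -> sregular m S g' ->
  integral_simplex m S (fun x => g x - g' x) = integral_simplex m S g - integral_simplex m S g'.
Proof.
by move=> rg rg'; rewrite integral_simplexD ?integral_simplexN//; exact: sregularN.
Qed.

Lemma integral_simplex0 m S : integral_simplex m S (fun=> 0) = 0.
Proof. by rewrite integral_simplexE Iref0 mulr0. Qed.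

Lemma integral_simplex_sum m S (I : Type) (r : seq I) (P : pred I) (g : I -> point -> R) :
  (forall i, P i -> sregular m S (g i)) ->
  integral_simplex m S (fun x => \sum_(i <- r | P i) g i x) =
  \sum_(i <- r | P i) integral_simplex m S (g i).
Proof.
move=> rg; rewrite integral_simplexE.
rewrite (@Iref_sum _ _ _ _ _ (fun i t => g i (param S t)))//.
by rewrite mulr_sumr.
Qed.

(* The form of Cauchy-Schwarz by which functions vanishing almost everywhere are handled. *)
Lemma integral_simplex_sqr0 m S g phi : sregular m S g -> sregular m S phi ->
  integral_simplex m S (fun x => g x ^+ 2) = 0 ->
  integral_simplex m S (fun x => g x * phi x) = 0.
Proof.
move=> rg rphi g0.
have rgg : sregular m S (fun x => g x ^+ 2) by exact: sregularM.
have rpp : sregular m S (fun x => phi x ^+ 2) by exact: sregularM.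
have rgp : sregular m S (fun x => g x * phi x) by exact: sregularM.
set b := integral_simplex m S (fun x => g x * phi x).
set c := integral_simplex m S (fun x => phi x ^+ 2).
(* The integral of a square, in which the coefficient of s^2 vanishes by [g0]: an affine function of
   s that is bounded below, so its slope b must be 0. *)
have quad s : 0 <= (2 * s) * b + c.
  have -> : (2 * s) * b + c = integral_simplex m S (fun x => (s * g x + phi x) ^+ 2).
    transitivity (integral_simplex m S (fun x => s ^+ 2 * g x ^+ 2 + ((2 * s) * (g x * phi x) + phi x ^+ 2))).
      rewrite !integral_simplexD ?integral_simplexZ//; try exact: sregularM (sregular_cst _ _ _) _.
        by rewrite g0 mulr0 add0r.
      by apply: sregularD => //; exact: sregularM (sregular_cst _ _ _) _.
    by apply: eq_integral_simplex => x _; ring.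
  by apply: integral_simplex_ge0 => x _; exact: sqr_ge0.
have [//|b0] := eqVneq b 0.
have := quad (- (c + 1) / (2 * b)).
suff -> : 2 * (- (c + 1) / (2 * b)) * b + c = -1 by rewrite oppr_ge0 ler10.
by field.
Qed.

End MeshIntegrals.

(** * Cells of the mesh, their facets and normals *)

Section Cells.
Context {R : realType} {m : nat}.
Local Notation d := m.+2.
Context {Omega : set 'rV[R]_d} (T : triangulation Omega).
Local Notation simplex := {set vertex T}.
Local Notation X := (Defs.coord T).
Implicit Types (K F : simplex).

(** A labelling of the vertices of a cell compatible with [vertex_at] on the cell and on all its
    facets, through which the results on indexed simplices apply to the mesh. *)
Definition frame K (e : 'I_d.+1 -> vertex T) : Prop :=
  [/\ injective e, K = [set e i | i in 'I_d.+1]%SET,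
      forall i : 'I_d.+1, vertex_at X K i = X (e i),
      forall i (j : 'I_d), vertex_at X (K :\ e i) j = X (e (lift i j)) &
      row_free (edges_from (X \o e))].

Lemma cell_frame K : K \in cells T -> exists e, frame K e.
Proof.
move=> cK; have [e [e_inj eK Ke Fe]] := simplex_enum X (tri_card cK).
exists e; split => //; rewrite -(edgesE (S := K)) //.
exact: tri_free.
Qed.

Section Frame.
Variables (K : simplex) (e : 'I_d.+1 -> vertex T).
Hypothesis Ke : frame K e.

Lemma frame_mem i : e i \in K.
Proof. by case: Ke => _ -> _ _ _; rewrite imset_f. Qed.

Lemma frameP v : v \in K -> exists i, v = e i.
Proof. by case: Ke => _ -> _ _ _ => /imsetP[i _ ->]; exists i. Qed.

Lemma frame_inj : injective e. Proof. by case: Ke. Qed.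

Lemma frame_card : #|K| = d.+1.
Proof. by case: Ke => ei -> _ _ _; rewrite card_imset// card_ord. Qed.

Lemma frame_facetP F : F \in facets_of K <-> exists i, F = K :\ e i.
Proof.
rewrite inE; split => [/andP[FK /eqP cF]|[i ->]].
  have /eqP/cards1P[v vE] : #|K :\: F| = 1%N.
    by rewrite cardsD (finset.setIidPr FK) frame_card cF subSnn.
  have /setDP[/frameP[i vi] vF] : v \in K :\: F by rewrite vE set11.
  exists i; rewrite -vi -vE finset.setDDr finset.setDv finset.set0U; exact/esym/finset.setIidPr.
rewrite subD1set /=; have := cardsD1 (e i) K.
by rewrite frame_mem frame_card add1n => -[<-].
Qed.

Lemma sum_facets_of (g : simplex -> R) :
  \sum_(F in facets_of K) g F = \sum_i g (K :\ e i).
Proof.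
rewrite (_ : facets_of K = [set K :\ e i | i in 'I_d.+1]%SET).
  rewrite big_imset//= => i j _ _ /setP/(_ (e i)).
  rewrite !inE eqxx /= frame_mem andbT => /esym/negbFE/eqP; exact: frame_inj.
apply/setP => F; apply/idP/imsetP => [/frame_facetP[i ->]|[i _ ->]]; first by exists i.
by apply/frame_facetP; exists i.
Qed.

Lemma frame_outward i n : outward_unit_normal K (K :\ e i) n <-> normal_at (X \o e) i n.
Proof.
split=> -[nn nF nK]; split => //.
- by rewrite -enorm_sqr nn expr1n.
- by move=> j k ji ki; apply: nF; rewrite !inE frame_mem (inj_eq frame_inj) ?ji ?ki.
- by move=> j ji; apply: nK; rewrite ?inE ?frame_mem ?eqxx// (inj_eq frame_inj) ji.
- by rewrite /enorm nn sqrtr1.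
- move=> v w /setD1P[vi /frameP[j ej]] /setD1P[wi /frameP[k ek]]; subst v w.
  by apply: nF; [apply: contraNneq vi|apply: contraNneq wi] => ->.
- move=> v w vK; rewrite !inE vK andbT negbK => /eqP -> /andP[wi /frameP[k ek]]; subst w.
  by apply: nK; apply: contraNneq wi => ->.
Qed.

(** Existence of an outward normal ensures that [xget] does not return its default value 0 in
    [unit_normal]. *)
Lemma frame_normal i : normal_at (X \o e) i (unit_normal K (K :\ e i)).
Proof.
have [_ _ _ _ free] := Ke; apply/frame_outward.
have [n /frame_outward Kn] := normal_exists free i.
exact: (@xgetPex _ 0 [set n | outward_unit_normal K (K :\ e i) n]) (ex_intro _ n Kn).
Qed.

Lemma frame_edges : edges X d K = edges_from (X \o e).
Proof. by case: Ke => _ _ Kx _ _; exact: edgesE. Qed.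

Lemma frame_param (t : d.-tuple R) : param K t = \sum_i bary t i *: X (e i).
Proof. by case: Ke => _ _ Kx _ _; exact: paramE. Qed.

Lemma frame_facet_edges i : edges X d.-1 (K :\ e i) = edges_from (facet_pts (X \o e) i).
Proof. by case: Ke => _ _ _ Fx _; exact: edgesE. Qed.

Lemma frame_facet_param i (t : d.-1.-tuple R) :
  param (K :\ e i) t = \sum_k bary t k *: X (e (lift i k)).
Proof. by case: Ke => _ _ _ Fx _; exact: paramE. Qed.

Lemma frame_divergence (p : mpoly d R) j :
  integral_simplex d K (fun x => meval (x 0) (mderiv j p)) =
  \sum_(F in facets_of K)
    integral_simplex d.-1 F (fun x => unit_normal K F 0 j * meval (x 0) p).
Proof.
rewrite sum_facets_of integral_simplexE frame_edges; have [_ _ _ _ free] := Ke.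
under [Iref _]eq_Iref do rewrite frame_param.
rewrite [LHS](simplex_divergence free p j frame_normal).
apply: eq_bigr => i _; rewrite integral_simplexZ; last exact: sregular_meval.
rewrite integral_simplexE frame_facet_edges; congr (_ * (_ * _)).
by apply: eq_Iref => t _; rewrite frame_facet_param.
Qed.

End Frame.

Lemma cell_divergence K (p : mpoly d R) j : K \in cells T ->
  integral_simplex d K (fun x => meval (x 0) (mderiv j p)) =
  \sum_(F in facets_of K)
    integral_simplex d.-1 F (fun x => unit_normal K F 0 j * meval (x 0) p).
Proof. by case/cell_frame => e Ke; exact: frame_divergence Ke _ _. Qed.

Lemma unit_normal_sqr K F : K \in cells T -> F \in facets_of K ->
  dot (unit_normal K F) (unit_normal K F) = 1.
Proof.
by case/cell_frame => e Ke /(frame_facetP Ke)[i ->]; case: (frame_normal Ke i).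
Qed.

Lemma relint_geo k (S : simplex) x : #|S| = k.+1 -> relint (T := T) k S x -> geo S x.
Proof.
move=> cS [t rt <-]; have [e [e_inj eS Se _]] := simplex_enum X cS.
rewrite (paramE t Se); apply: hull_enum => //; last exact: sum_bary.
by move=> i; apply/ltW/bary_gt0.
Qed.

Lemma card_facet K F : F \in facets_of K -> #|F| = d.
Proof. by rewrite inE => /andP[_ /eqP]. Qed.

End Cells.

(** * The discrete trace inequality *)

Section DominatedForms.
Context {R : realType} {n : nat}.
Implicit Types (A B : 'M[R]_n) (x y : 'rV[R]_n).

Definition form A x y : R := (x *m A *m y^T) 0 0.

Definition psd A : Prop := A^T = A /\ forall x, 0 <= form A x x.

Lemma formDl A x x' y : form A (x + x') y = form A x y + form A x' y.
Proof. by rewrite /form !mulmxDl mxE. Qed.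

Lemma formZl A c x y : form A (c *: x) y = c * form A x y.
Proof. by rewrite /form -!scalemxAl mxE. Qed.

Lemma formC A x y : A^T = A -> form A x y = form A y x.
Proof.
move=> sA; transitivity ((x *m A *m y^T)^T 0 0); first by rewrite [RHS]mxE.
by rewrite !trmx_mul trmxK sA mulmxA.
Qed.

Lemma formDr A x y y' : form A x (y + y') = form A x y + form A x y'.
Proof. by rewrite /form linearD mulmxDr mxE. Qed.

Lemma formZr A c x y : form A x (c *: y) = c * form A x y.
Proof. by rewrite /form linearZ -scalemxAr mxE. Qed.

Lemma form_cauchy_schwarz A x y : psd A -> form A x y ^+ 2 <= form A x x * form A y y.
Proof.
move=> [sA A0].
have quad s : 0 <= form A x x + 2 * s * form A x y + s ^+ 2 * form A y y.
  have := A0 (x + s *: y).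
  rewrite formDl !formDr !formZl !formZr (formC y x sA).
  by congr (0 <= _); ring.
have := A0 y; rewrite le_eqVlt => /predU1P[yy|yy].
  suff -> : form A x y = 0 by rewrite expr0n -yy mulr0.
  have [//|xy] := eqVneq (form A x y) 0.
  have := quad (- (form A x x + 1) / (2 * form A x y)); rewrite -yy mulr0 addr0.
  have -> : form A x x + 2 * (- (form A x x + 1) / (2 * form A x y)) * form A x y = - 1 by field.
  by rewrite oppr_ge0 ler10.
have := quad (- form A x y / form A y y).
have -> : form A x x + 2 * (- form A x y / form A y y) * form A x y +
   (- form A x y / form A y y) ^+ 2 * form A y y =
   (form A x x * form A y y - form A x y ^+ 2) / form A y y by field; rewrite gt_eqF.
by rewrite pmulr_lge0 ?invr_gt0// subr_ge0.
Qed.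

Lemma form_kernel A x : psd A -> form A x x = 0 -> x *m A = 0.
Proof.
move=> pA xx; apply/rowP => i; rewrite [RHS]mxE; apply/eqP.
have <- : form A x (delta_mx 0 i) = (x *m A) 0 i.
  by rewrite /form trmx_delta -colE mxE.
rewrite -sqrf_eq0 eq_le sqr_ge0 andbT.
by have := form_cauchy_schwarz x (delta_mx 0 i) pA; rewrite xx mul0r.
Qed.

(** The inclusion of kernels is turned into a factorization B = A E A, so that x enters only through
    x A, whose entries the form of A controls by Cauchy-Schwarz. The constant is explicit and comes
    without eigenvalues or compactness. *)
Lemma psd_dominated A B : psd A -> psd B ->
  (forall x, form A x x = 0 -> form B x x = 0) ->
  exists2 C, 0 <= C & forall x, form B x x <= C * form A x x.
Proof.
move=> pA pB AB; have [sA A0] := pA; have [sB B0] := pB.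
(* As A is symmetric, the transposed columns of [cokermx A] are isotropic for A, hence for B, hence
   killed by B. *)
have BA : (B <= A)%MS.
  rewrite submxE; apply/eqP/matrixP => i j; rewrite [RHS]mxE.
  pose z := (col j (cokermx A))^T.
  have zA : z *m A = 0.
    by rewrite -[LHS]trmxK trmx_mul trmxK sA colE mulmxA mulmx_coker mul0mx trmx0.
  have zB : z *m B = 0.
    by apply: form_kernel => //; apply: AB; rewrite /form zA mul0mx mxE.
  have : (B *m z^T) i 0 = 0 by rewrite -[B]sB -trmx_mul zB trmx0 mxE.
  by rewrite trmxK colE mulmxA -colE mxE.
pose D := B *m pinvmx A; pose E := (pinvmx A)^T *m D.
have BDA : D *m A = B by exact: mulmxKpV.
(* So [form B] is a quadratic form in the entries of [x *m A]. *)
have BE : B = A *m E *m A.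
  rewrite -(mulmxA A) -(mulmxA _ D) BDA mulmxA -{1}sB -BDA trmx_mul sA.
  by rewrite {1}/D trmx_mul sB BDA mulmxA.
have row_bound x i : ((x *m A) 0 i) ^+ 2 <= form A x x * A i i.
  have -> : (x *m A) 0 i = form A x (delta_mx 0 i) by rewrite /form trmx_delta -colE [RHS]mxE.
  have -> : A i i = form A (delta_mx 0 i) (delta_mx 0 i).
    by rewrite /form trmx_delta -colE -rowE !mxE.
  exact: form_cauchy_schwarz.
have Aii i : 0 <= A i i.
  by have := A0 (delta_mx 0 i); rewrite /form trmx_delta -colE -rowE !mxE.
(* From |u v| <= (u^2 + v^2) / 2, with both squares bounded by [row_bound]. *)
exists (\sum_i \sum_j `|E i j| * ((A i i + A j j) / 2)).
  by apply: sumr_ge0 => i _; apply: sumr_ge0 => j _; rewrite mulr_ge0// divr_ge0// addr_ge0.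
move=> x; have -> : form B x x = \sum_i \sum_j (x *m A) 0 i * E i j * (x *m A) 0 j.
  have -> : form B x x = ((x *m A) *m E *m (x *m A)^T) 0 0.
    by rewrite /form BE trmx_mul sA !mulmxA.
  rewrite [LHS]mxE [RHS]exchange_big/=; apply: eq_bigr => j _.
  by rewrite [X in X * _]mxE [X in _ * X]mxE mulr_suml.
rewrite mulr_suml; apply: ler_sum => i _; rewrite mulr_suml; apply: ler_sum => j _.
set u := (x *m A) 0 i; set v := (x *m A) 0 j.
apply: le_trans (ler_norm _) _; rewrite !normrM (mulrC `|u|) -!mulrA ler_wpM2l// mulrA.
have := row_bound x i; have := row_bound x j; rewrite -/u -/v.
rewrite -(real_normK (num_real u)) -(real_normK (num_real v)).
have := sqr_ge0 (`|u| - `|v|); rewrite sqrrB; nra.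
Qed.

End DominatedForms.

(** * The trace inequality for polynomials of bounded degree *)

Section Trace.
Context {R : realType} {m : nat}.
Local Notation d := m.+2.
Context {Omega : set 'rV[R]_d} (T : triangulation Omega).
Local Notation simplex := {set vertex T}.
Local Notation X := (Defs.coord T).
Implicit Types (K F : simplex).

(* The field (x - v) p^2, with v the vertex opposite to F, is tangent to the
   other facets, and its normal component on F is the height of K times p^2. *)
Lemma trace_kernel K F (p : mpoly d R) : K \in cells T -> F \in facets_of K ->
  integral_simplex d K (fun x => meval (x 0) p ^+ 2) = 0 ->
  integral_simplex d.-1 F (fun x => meval (x 0) p ^+ 2) = 0.
Proof.
move=> cK FK p0; have [e Ke] := cell_frame cK.
have [i Fi] := (frame_facetP Ke F).1 FK; subst F.
pose v := X (e i).
pose q j : mpoly d R := (mpolyX R (mnm1 j) - mpolyC d (v 0 j)) * p ^+ 2.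
(* Each term of the divergence of the field has a factor p, so [integral_simplex_sqr0] makes its
   integral over K vanish. *)
have dq j : mderiv j (q j) = p * (p + 2 * (mpolyX R (mnm1 j) - mpolyC d (v 0 j)) * mderiv j p).
  rewrite /q mderivM mderivB mderivC subr0 mderivXU eqxx expr2 mderivM.
  rewrite /=. ring.
have : \sum_j integral_simplex d K (fun x => meval (x 0) (mderiv j (q j))) = 0.
  rewrite big1// => j _; rewrite dq.
  under eq_integral_simplex do rewrite mevalM.
  by apply: integral_simplex_sqr0 => //; exact: sregular_meval.
under eq_bigr do rewrite (frame_divergence Ke).
rewrite exchange_big /= (sum_facets_of Ke).
have rp F : sregular d.-1 F (fun x => meval (x 0) p ^+ 2).
  by apply: sregularM; exact: sregular_meval.
have face l : \sum_j integral_simplex d.-1 (K :\ e l)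
      (fun x => unit_normal K (K :\ e l) 0 j * meval (x 0) (q j)) =
    (l == i)%:R * - dot (unit_normal K (K :\ e i)) (X (e i) - X (e (lift i ord0))) *
      integral_simplex d.-1 (K :\ e i) (fun x => meval (x 0) p ^+ 2).
  have rj j : sregular d.-1 (K :\ e l) (fun x => unit_normal K (K :\ e l) 0 j * meval (x 0) (q j)).
    by apply: sregularM; [exact: sregular_cst|exact: sregular_meval].
  rewrite -integral_simplex_sum//.
  set n := unit_normal K (K :\ e l).
  transitivity (integral_simplex d.-1 (K :\ e l)
      (fun x => (l == i)%:R * - dot n (X (e i) - X (e (lift i ord0))) * meval (x 0) p ^+ 2)); last first.
    rewrite integral_simplexZ; last exact: rp.
    rewrite /n; have [->|_] := eqVneq l i; first by [].
    by rewrite !mul0r.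
  apply: eq_integral_simplex => x [t _ <-]; set y := param _ _.
  transitivity (dot n (y - v) * meval (y 0) p ^+ 2).
    rewrite /dot mulr_suml; apply: eq_bigr => j _.
    by rewrite /q mevalM mevalB mevalXU mevalC rmorphXn !mxE mulrA.
  congr (_ * _).
  have -> : y - v = \sum_k bary t k *: (X (e (lift l k)) - v).
    rewrite /y (frame_facet_param Ke); under [RHS]eq_bigr do rewrite scalerBr.
    by rewrite sumrB -scaler_suml sum_bary scale1r.
  rewrite dotC dot_suml; have [_ n0 _] := frame_normal Ke l.
  have [li|li] := eqVneq l i.
    subst l; rewrite -dotNr opprB mul1r -[RHS]mul1r -(sum_bary t) mulr_suml.
    apply: eq_bigr => k _; rewrite dotZl; congr (_ * _).
    apply/eqP; rewrite dotC -subr_eq0 -dotBr opprB addrA subrK; apply/eqP; apply: n0.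
      by rewrite eq_sym neq_lift.
    by rewrite eq_sym neq_lift.
  rewrite !mul0r big1// => k _; rewrite dotZl dotC n0 ?mulr0//; first by rewrite eq_sym neq_lift.
  by rewrite eq_sym.
under eq_bigr do rewrite face.
rewrite (bigD1 i)//= big1 ?addr0 => [|l /negPf ->]; last by rewrite !mul0r.
rewrite eqxx mul1r => /eqP; rewrite mulf_eq0 => /orP[|/eqP//].
have [_ _ ni] := frame_normal Ke i.
by rewrite oppr_eq0 lt_eqF// ni// eq_sym neq_lift.
Qed.

(** [bmultinom d k] consists of the exponents of total degree less than k, so these are a finite
    basis of the polynomials with [msize] at most k. *)
Definition monomial k (i : 'I_#|{: bmultinom d k}|) : mpoly d R :=
  mpolyX R (bmnm (enum_val i)).

Lemma mpoly_monomials k (p : mpoly d R) : (msize p <= k)%N ->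
  p = \sum_i mcoeff (bmnm (enum_val i)) p *: monomial (k := k) i.
Proof.
move=> pk; rewrite [LHS](mpolywE pk); rewrite big_enum_val.
by [].
Qed.

Definition gram k j (S : simplex) : 'M[R]_#|{: bmultinom d k}| :=
  \matrix_(a, b) integral_simplex j S
    (fun x => meval (x 0) (monomial a) * meval (x 0) (monomial b)).

Lemma form_gram k j S (c : 'rV[R]_#|{: bmultinom d k}|) :
  form (gram k j S) c c =
  integral_simplex j S (fun x => meval (x 0) (\sum_i c 0 i *: monomial i) ^+ 2).
Proof.
have rm a : sregular j S (fun x => meval (x 0) (monomial (k := k) a)) by exact: sregular_meval.
transitivity (\sum_b \sum_a integral_simplex j S
  (fun x => c 0 a * c 0 b * (meval (x 0) (monomial a) * meval (x 0) (monomial b)))).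
  rewrite /form mxE; apply: eq_bigr => b _; rewrite !mxE mulr_suml.
  apply: eq_bigr => a _; rewrite !mxE integral_simplexZ; last exact: sregularM.
  by rewrite mulrAC.
have rcm a b : sregular j S (fun x => c 0 a * c 0 b *
    (meval (x 0) (monomial a) * meval (x 0) (monomial b))).
  by apply: sregularM; [exact: sregular_cst|exact: sregularM].
under eq_bigr => b _ do rewrite -(integral_simplex_sum _ (fun a _ => rcm a b)).
rewrite -integral_simplex_sum => [|b _]; last by apply: sregular_sum => a _; exact: rcm.
apply: eq_integral_simplex => x _; rewrite raddf_sum/= expr2 mulr_sumr.
apply: eq_bigr => b _; rewrite mulr_suml; apply: eq_bigr => a _.
by rewrite !mevalZ; ring.
Qed.

Lemma psd_gram k j S : psd (gram k j S).
Proof.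
split=> [|c]; last by rewrite form_gram; apply: integral_simplex_ge0 => x _; exact: sqr_ge0.
apply/matrixP => a b; rewrite !mxE; apply: eq_integral_simplex => x _; exact: mulrC.
Qed.

(** In the basis of monomials both sides are Gram forms, and [trace_kernel] is the inclusion of
    kernels that [psd_dominated] asks for. *)
Lemma trace_inequality k K F : K \in cells T -> F \in facets_of K ->
  exists2 C, 0 <= C & forall p : mpoly d R, (msize p <= k)%N ->
    integral_simplex d.-1 F (fun x => meval (x 0) p ^+ 2) <=
    C * integral_simplex d K (fun x => meval (x 0) p ^+ 2).
Proof.
move=> cK FK.
have ker c : form (gram k d K) c c = 0 -> form (gram k d.-1 F) c c = 0.
  by rewrite !form_gram; exact: trace_kernel.
have [C C0 AB] := psd_dominated (psd_gram k d K) (psd_gram k d.-1 F) ker.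
exists C => // p pk.
have := AB (\row_i mcoeff (bmnm (enum_val i)) p).
rewrite !form_gram.
have <- : p = \sum_i (\row_i mcoeff (bmnm (enum_val i)) p) 0 i *: monomial (k := k) i.
  by rewrite {1}(mpoly_monomials pk); apply: eq_bigr => i _; rewrite mxE.
by [].
Qed.

End Trace.

(** * Cells sharing a facet *)

Section NearPoints.
Context {R : realType} {n : nat}.
Implicit Types (a z w : 'rV[R]_n.+1) (P : set 'rV[R]_n.+1).

Lemma dot_continuous a : continuous (fun x : 'rV[R]_n.+1 => dot a x).
Proof.
apply: continuous_big => [|i _ x]; first exact: add_continuous.
apply: (@continuous_comp _ _ _ (fun y : 'rV[R]_n.+1 => y 0 i) ( *%R (a 0 i))).
  exact: coord_continuous.
exact: mulrl_continuous.
Qed.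

(** Used to leave a point in a prescribed direction while staying in a given neighbourhood. *)
Lemma near_ray z w P : (\forall y \near z, P y) ->
  exists2 s : R, 0 < s <= 1 & P (z + s *: w).
Proof.
move=> Pz.
have cv : (fun s : R => z + s *: w) @ 0^'+ --> z.
  apply: cvg_at_right_filter.
  have : (fun s : R => z + s *: w) @ (0 : R) --> z + 0 *: w.
    by apply: (@cvgD _ _ _ _ _ (cst z)); [exact: cvg_cst|exact: scalel_continuous].
  by rewrite scale0r addr0.
have [s [s0 s1 Ps]] : exists s : R, [/\ 0 < s, s <= 1 & P (z + s *: w)].
  near (0:R)^'+ => s; exists s; split.
  - by near: s; exact: nbhs_right_gt.
  - by near: s; exact: nbhs_right_le.
  - by near: s; exact: cv.
by exists s; rewrite ?s0.
Unshelve. all: by end_near. Qed.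

End NearPoints.

(** * Barycentric coordinates and the sides of a facet *)

Section Barycentric.
Context {R : realType} {m : nat}.
Local Notation d := m.+2.
Context {Omega : set 'rV[R]_d} {T : triangulation Omega}.
Local Notation simplex := {set vertex T}.
Local Notation X := (Defs.coord T).
Implicit Types (K F S : simplex) (x y z : 'rV[R]_d).

Section Cell.
Variables (K : simplex) (e : 'I_d.+1 -> vertex T).
Hypothesis Ke : frame K e.

(** The barycentric coordinate at vertex i: the signed distance to the opposite facet divided by the
    height. In this form it is defined and continuous on the whole space. *)
Definition bcoord i x : R :=
  let n := unit_normal K (K :\ e i) in
  dot n (x - X (e (lift i ord0))) / dot n (X (e i) - X (e (lift i ord0))).

Lemma normal_height i : dot (unit_normal K (K :\ e i)) (X (e i) - X (e (lift i ord0))) < 0.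
Proof.
by have [_ _ n0] := frame_normal Ke i; apply: n0; rewrite eq_sym neq_lift.
Qed.

Lemma bcoord_sum i (c : 'I_d.+1 -> R) : \sum_k c k = 1 ->
  bcoord i (\sum_k c k *: X (e k)) = c i.
Proof.
move=> c1; rewrite /bcoord; set n := unit_normal _ _.
have -> : \sum_k c k *: X (e k) - X (e (lift i ord0)) =
    \sum_k c k *: (X (e k) - X (e (lift i ord0))).
  under [RHS]eq_bigr do rewrite scalerBr.
  by rewrite sumrB -scaler_suml c1 scale1r.
rewrite dotC dot_suml (bigD1 i)//= big1 ?addr0 => [|k ki].
  by rewrite dotZl dotC mulfK// lt_eqF// normal_height.
have [_ n0 _] := frame_normal Ke i.
by rewrite dotZl dotC n0 ?mulr0// eq_sym neq_lift.
Qed.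

Lemma affine_span x : exists2 c : 'I_d.+1 -> R, \sum_k c k = 1 & x = \sum_k c k *: X (e k).
Proof.
have [_ _ _ _ free] := Ke.
have uE : edges_from (X \o e) \in unitmx by rewrite -row_free_unit.
pose u := (x - X (e ord0)) *m invmx (edges_from (X \o e)).
exists (fun k => if unlift ord0 k is Some j then u 0 j else 1 - \sum_j u 0 j).
  rewrite big_ord_recl unlift_none; apply/eqP; rewrite addrAC subr_eq; apply/eqP.
  by congr (_ + _); apply: eq_bigr => j _; rewrite liftK.
have -> : x = u *m edges_from (X \o e) + X (e ord0) by rewrite mulmxKV// subrK.
rewrite mulmx_sum_row [RHS]big_ord_recl unlift_none scalerBl scale1r addrC -addrA; congr (_ + _).
rewrite scaler_suml addrC -sumrB; apply: eq_bigr => j _.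
by rewrite rowK liftK scalerBr.
Qed.

Lemma sum_bcoord x : \sum_i bcoord i x = 1.
Proof.
by have [c c1 ->] := affine_span x; rewrite -[RHS]c1; apply: eq_bigr => i _; exact: bcoord_sum.
Qed.

Lemma bcoordK x : x = \sum_i bcoord i x *: X (e i).
Proof.
have [c c1 xE] := affine_span x; rewrite {1}xE; apply: eq_bigr => i _.
by rewrite xE bcoord_sum.
Qed.

Lemma geo_bcoord S x : S \subset K -> geo S x ->
  (forall i, 0 <= bcoord i x) /\ (forall i, e i \notin S -> bcoord i x = 0).
Proof.
move=> SK [c [c0 c1 ->]].
pose c' i := if e i \in S then c (e i) else 0.
have [ei eK _ _ _] := Ke.
have sumE (U : nmodType) (f : vertex T -> U) :
    \sum_(v in S) f v = \sum_i (if e i \in S then f (e i) else 0).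
  have SE : S = [set e i | i in [set i | e i \in S]]%SET.
    apply/setP => v; apply/idP/imsetP => [vS|[i]]; last by rewrite inE => iS ->.
    have [i vi] := frameP Ke (fintype.subsetP SK v vS); exists i => //.
    by rewrite inE -vi.
  rewrite {1}SE big_imset/=; last by move=> i j _ _ /ei.
  by rewrite big_mkcond; apply: eq_bigr => i _; rewrite inE.
have c'1 : \sum_i c' i = 1 by rewrite -sumE.
have -> : \sum_(v in S) c v *: X v = \sum_i c' i *: X (e i).
  by rewrite sumE; apply: eq_bigr => i _; rewrite /c'; case: ifP => //; rewrite scale0r.
split=> i; rewrite bcoord_sum// /c'; first by case: ifP.
by move/negPf => ->.
Qed.

Lemma bcoord_geo x : (forall i, 0 <= bcoord i x) -> geo K x.
Proof.
move=> x0; rewrite (bcoordK x); have [ei eK _ _ _] := Ke.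
by apply: hull_enum => //; exact: sum_bcoord.
Qed.

Lemma bcoord_facet i x : geo (K :\ e i) x -> bcoord i x = 0.
Proof.
move=> Fx; have [_ ->//] := geo_bcoord (subD1set K (e i)) Fx.
by rewrite !inE eqxx.
Qed.

Lemma bcoord_continuous i : continuous (bcoord i).
Proof.
move=> x; set n := unit_normal K (K :\ e i); set a := X (e (lift i ord0)).
have -> : bcoord i = (fun y => (dot n y - dot n a) * (dot n (X (e i) - a))^-1).
  by apply/funext => y; rewrite /bcoord dotBr.
apply: (@continuousM R _ (fun y => dot n y - dot n a) (cst _)); last exact: cst_continuous.
apply: (@continuousB R R _ (dot n) (cst (dot n a))); last exact: cst_continuous.
exact: dot_continuous.
Qed.

Lemma bcoord_near i z : 0 < bcoord i z -> \forall y \near z, 0 < bcoord i y.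
Proof. by move=> z0; exact: (cvgr_gt _ (bcoord_continuous (x := z))). Qed.

Lemma bcoord_near_lt i z : bcoord i z < 0 -> \forall y \near z, bcoord i y < 0.
Proof. by move=> z0; exact: (cvgr_lt _ (bcoord_continuous (x := z))). Qed.

(* The sign of the coordinate at the vertex opposite to F tells the side of F. *)
Lemma bcoord_side i f x : f \in K :\ e i ->
  dot (unit_normal K (K :\ e i)) (x - X f) =
  bcoord i x * dot (unit_normal K (K :\ e i)) (X (e i) - X (e (lift i ord0))).
Proof.
move=> fF; rewrite /bcoord divfK ?lt_eqF ?normal_height//; apply/eqP.
have [nn n0 _] := (frame_outward Ke i _).2 (frame_normal Ke i).
rewrite -subr_eq0 -dotBr opprB addrC addrA subrK; apply/eqP; apply: n0 => //.
by rewrite !inE (frame_mem Ke) (inj_eq (frame_inj Ke)) eq_sym neq_lift.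
Qed.

Lemma bcoordD i x y s : bcoord i (x + s *: (y - x)) = (1 - s) * bcoord i x + s * bcoord i y.
Proof.
rewrite /bcoord mulrA mulrA -mulrDl; congr (_ / _).
rewrite -!dotZr -dotDr; congr dot.
by rewrite scalerBr scalerBl scale1r !scalerBr; apply/rowP => j; rewrite !mxE; ring.
Qed.

Lemma near_bcoord_gt0 i z : (forall j, j != i -> 0 < bcoord j z) ->
  \forall y \near z, forall j, j != i -> 0 < bcoord j y.
Proof.
move=> z0; apply: (@filter_forall _ _ (fun j y => j != i -> 0 < bcoord j y) (nbhs z) _) => j.
have [_|ji] := eqVneq j i; first exact: nearW.
by apply: filterS (bcoord_near (z0 j ji)) => y.
Qed.

End Cell.

Lemma sum_facet_weights : \sum_(k < d) (d%:R^-1 : R) = 1.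
Proof. by rewrite sumr_const card_ord -[LHS]mulr_natr mulVf// pnatr_eq0. Qed.

(** The barycentre of F, a point of F that lies on no other facet of the cell. *)
Definition facet_center F := \sum_(k < d) (d%:R^-1 : R) *: vertex_at X F k.

Lemma facet_center_geo F : #|F| = d -> geo F (facet_center F).
Proof.
move=> cF; have [e' [ei' eF eF' _]] := simplex_enum X cF.
have -> : facet_center F = \sum_(k < d) (d%:R^-1 : R) *: X (e' k).
  by apply: eq_bigr => k _; rewrite eF'.
by apply: hull_enum => //; exact: sum_facet_weights.
Qed.

Lemma facet_center_gt0 K e i j : frame K e -> j != i ->
  0 < bcoord K e j (facet_center (K :\ e i)).
Proof.
move=> Ke; rewrite eq_sym => /unlift_some[k -> _].
pose c l := if unlift i l is Some _ then (d%:R^-1 : R) else 0.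
have -> : facet_center (K :\ e i) = \sum_l c l *: X (e l).
  rewrite (bigD1_ord i)//= {1}/c unlift_none scale0r add0r.
  have [_ _ _ Fe _] := Ke.
  by apply: eq_bigr => l _; rewrite /c liftK Fe.
rewrite (bcoord_sum Ke); first by rewrite /c liftK invr_gt0.
rewrite (bigD1_ord i)//= {1}/c unlift_none add0r.
rewrite -[RHS]sum_facet_weights; apply: eq_bigr => l _; by rewrite /c liftK.
Qed.

(** Subtracting from one normal the multiple of the other that agrees with it on the edge to the
    opposite vertex leaves a vector orthogonal to all edges of K, hence 0. Unit length restricts the
    factor to 1 or -1. *)
Lemma normal_parallel K K' e e' i i' : frame K e -> frame K' e' ->
  K :\ e i = K' :\ e' i' ->
  unit_normal K' (K' :\ e' i') = unit_normal K (K :\ e i) \/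
  unit_normal K' (K' :\ e' i') = - unit_normal K (K :\ e i).
Proof.
move=> Ke Ke' FF'; have [_ _ _ _ free] := Ke.
have [nn n0 _] := (frame_outward Ke i _).2 (frame_normal Ke i).
have [nn' n0' _] := (frame_outward Ke' i' _).2 (frame_normal Ke' i').
have h0 := normal_height Ke i; set F := K :\ e i in FF' *; rewrite -FF' in nn' n0' *.
set n := unit_normal K F in nn n0 h0 *; set n' := unit_normal K' F in nn' n0' *.
set f := e (lift i ord0) in h0 *.
have eF k : k != i -> e k \in F by move=> ki; rewrite !inE (frame_mem Ke) (inj_eq (frame_inj Ke)) ki.
have fF : f \in F by rewrite eF// eq_sym neq_lift.
pose c := dot n' (X (e i) - X f) / dot n (X (e i) - X f).
have n'n : n' = c *: n.
  apply/eqP; rewrite -subr_eq0; apply/eqP; apply: (edges_perp free).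
  have yf k : dot (n' - c *: n) (X (e k) - X f) = 0.
    have [->|/eF ki] := eqVneq k i.
      by rewrite dotBl dotZl /c divfK ?subrr// lt_eqF.
    by rewrite dotBl dotZl n0// n0'// mulr0 subrr.
  move=> j k; have -> : (X \o e) j - (X \o e) k = (X (e j) - X f) - (X (e k) - X f).
    by rewrite opprB addrA subrK.
  by rewrite dotBr !yf subrr.
have : c ^+ 2 = 1.
  have : dot n' n' = c ^+ 2 * dot n n by rewrite n'n dotZl dotZr mulrA.
  by rewrite -!enorm_sqr nn nn' expr1n mulr1.
rewrite n'n => /eqP; rewrite sqrf_eq1 => /orP[]/eqP ->; [left|right].
  by rewrite scale1r.
by rewrite scaleN1r.
Qed.

(** Equal normals would put both cells on the same side of F. A point slightly off the centre of F,
    towards the vertex of K' opposite to F, would then lie in both cells, hence by conformity in the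
    hull of their common vertices. There the coordinate at [e i] is 0, but at this point it is
    positive. *)
Lemma opposite_normals K K' F : K \in cells T -> K' \in cells T -> K != K' ->
  F \in facets_of K -> F \in facets_of K' -> unit_normal K' F = - unit_normal K F.
Proof.
move=> cK cK' KK' FK FK'.
have [e Ke] := cell_frame cK; have [e' Ke'] := cell_frame cK'.
have [i Fi] := (frame_facetP Ke F).1 FK; have [i' Fi'] := (frame_facetP Ke' F).1 FK'.
have FF' : K :\ e i = K' :\ e' i' by rewrite -Fi -Fi'.
have := normal_parallel Ke Ke' FF'; rewrite -Fi -Fi' => -[nn'|//]; exfalso.
have eiK' : e i \notin K'.
  apply: contra KK' => eiK'; rewrite eqEcard (tri_card cK) (tri_card cK') leqnn andbT.
  apply/fintype.subsetP => v vK; have [->//|vi] := eqVneq v (e i).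
  have : v \in F by rewrite Fi !inE vi.
  by rewrite Fi' => /setD1P[].
have f0 : e (lift i ord0) \in F.
  by rewrite Fi !inE (frame_mem Ke) (inj_eq (frame_inj Ke)) eq_sym neq_lift.
(* the coordinate at e i of the vertex of K' opposite to F *)
have b0 : 0 < bcoord K e i (X (e' i')).
  have := bcoord_side Ke (i := i) (X (e' i')) (f := e (lift i ord0)).
  rewrite -Fi => /(_ f0) side.
  have : dot (unit_normal K' F) (X (e' i') - X (e (lift i ord0))) < 0.
    have [_ _ n0] := (frame_outward Ke' i' _).2 (frame_normal Ke' i').
    by rewrite Fi'; apply: n0; rewrite ?(frame_mem Ke')// -?Fi' ?f0// Fi' !inE eqxx.
  rewrite nn' side; have := normal_height Ke i; rewrite -Fi => h0.
  by rewrite nmulr_llt0.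
pose z : 'rV[R]_d := facet_center F.
have zF : geo F z by apply: facet_center_geo; exact: card_facet FK.
have zK j : j != i -> 0 < bcoord K e j z.
  by move=> ji; rewrite /z Fi; exact: facet_center_gt0.
have := near_bcoord_gt0 zK.
case/(near_ray (X (e' i') - z)) => s /andP[s0 s1] ys.
set y := z + s *: (X (e' i') - z) in ys.
have yi : 0 < bcoord K e i y.
  rewrite /y bcoordD// (bcoord_facet Ke (i := i)) -?Fi//.
  by rewrite mulr0 add0r mulr_gt0.
have yK : geo K y.
  apply: (bcoord_geo Ke) => j; have [->|ji] := eqVneq j i; first exact: ltW.
  exact/ltW/ys.
have yK' : geo K' y.
  apply: (bcoord_geo Ke') => j; rewrite /y (bcoordD K' e').
  have zF' : geo (K' :\ e' i') z by rewrite -Fi'.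
  have [zK' _] := geo_bcoord Ke' (subD1set _ _) zF'.
  have vK' : 0 <= bcoord K' e' j (X (e' i')).
    rewrite (_ : X (e' i') = \sum_k (k == i')%:R *: X (e' k)).
      by rewrite (bcoord_sum Ke') ?ler0n// (bigD1 i')//= eqxx big1 ?addr0// => k /negPf ->.
    by rewrite (bigD1 i')//= eqxx scale1r big1 ?addr0// => k /negPf ->; rewrite scale0r.
  by apply: addr_ge0; apply: mulr_ge0; rewrite ?subr_ge0 ?(ltW s0).
have : geo (K :&: K') y by rewrite -[geo _](tri_conform cK cK').
case/(geo_bcoord Ke (subsetIl _ _)) => _ /(_ i).
by rewrite inE (negPf eiK') andbF => /(_ isT) yi0; rewrite yi0 ltxx in yi.
Qed.

Lemma geo_closure K x : K \in cells T -> geo K x -> closure Omega x.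
Proof. by move=> cK Kx; rewrite (tri_cover T); exists K. Qed.

(** Two cells on opposite sides of F cover a neighbourhood of its centre, which is thus interior to
    the closure of Omega. As Omega has no slits, the centre lies in Omega and not on its
    boundary. *)
Lemma boundary_facet_unique K K' F : domain Omega -> boundary_facet F ->
  K \in cells T -> K' \in cells T -> F \in facets_of K -> F \in facets_of K' -> K = K'.
Proof.
move=> [_ oO _ iO] /asboolP bF cK cK' FK FK'; apply/eqP; apply/negPn/negP => KK'.
have opp := opposite_normals cK cK' KK' FK FK'.
have [e Ke] := cell_frame cK; have [e' Ke'] := cell_frame cK'.
have [i Fi] := (frame_facetP Ke F).1 FK; have [i' Fi'] := (frame_facetP Ke' F).1 FK'.
pose z : 'rV[R]_d := facet_center F.
have zF : geo F z by apply: facet_center_geo; exact: card_facet FK.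
have [_] := bF z zF; apply.
have -> : interior Omega = Omega by exact/interior_id.
have zK j : j != i -> 0 < bcoord K e j z.
  by move=> ji; rewrite /z Fi; exact: facet_center_gt0.
have zK' j : j != i' -> 0 < bcoord K' e' j z.
  by move=> ji; rewrite /z Fi'; exact: facet_center_gt0.
rewrite -iO; apply: filterS2 (near_bcoord_gt0 zK) (near_bcoord_gt0 zK') => y yK yK'.
have f0 : e (lift i ord0) \in F.
  by rewrite Fi !inE (frame_mem Ke) (inj_eq (frame_inj Ke)) eq_sym neq_lift.
have := bcoord_side Ke (i := i) y (f := e (lift i ord0)); rewrite -Fi => /(_ f0).
have := bcoord_side Ke' (i := i') y (f := e (lift i ord0)); rewrite -Fi' => /(_ f0).
rewrite opp dotNl.
have := normal_height Ke i; have := normal_height Ke' i'; rewrite -Fi -Fi' opp.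
set h' := dot _ _; set h := dot _ _; set u := dot _ _ => h'0 h0 uK' uK.
have [u0|/ltW u0] := leP u 0.
  apply: (geo_closure cK); apply: (bcoord_geo Ke) => j.
  have [->|ji] := eqVneq j i; last exact/ltW/yK.
  by rewrite -(nmulr_lle0 _ h0) -uK.
apply: (geo_closure cK'); apply: (bcoord_geo Ke') => j.
have [->|ji] := eqVneq j i'; last exact/ltW/yK'.
by rewrite -(nmulr_lle0 _ h'0) -uK' oppr_le0.
Qed.

(** From a point z of F inside Omega a small step along the outward normal leaves K but not Omega,
    so it ends in another cell. That cell contains z if the step is small, and conformity makes it
    contain F. *)
Lemma interior_facet_neighbour K F : domain Omega -> ~~ boundary_facet F ->
  K \in cells T -> F \in facets_of K ->
  exists K', [/\ K' \in cells T, F \in facets_of K' & K' != K].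
Proof.
move=> [_ oO _ _] nbF cK FK; have [e Ke] := cell_frame cK.
have [i Fi] := (frame_facetP Ke F).1 FK.
have iO : interior Omega = Omega by exact/interior_id.
have [y Fy Oy] : exists2 y, geo F y & Omega y.
  apply: contrapT => noy; move/asboolP : nbF; apply => y Fy; split.
    rewrite (tri_cover T); exists K => //.
    apply: (bcoord_geo Ke); rewrite Fi in Fy.
    by case: (geo_bcoord Ke (subD1set K (e i)) Fy).
  by rewrite iO => Oy; apply: noy; exists y.
(* [y] may lie on a lower-dimensional face of F; moving it towards the centre makes all coordinates
   but the i-th positive. *)
have /(near_ray (facet_center F - y)) [s /andP[s0 s1] Oz] : \forall x \near y, Omega x.
  exact: open_nbhs_nbhs.
set z := y + _ in Oz.
have Fy' : geo (K :\ e i) y by rewrite -Fi.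
have [y0 yi] := geo_bcoord Ke (subD1set K (e i)) Fy'.
have z0 j : j != i -> 0 < bcoord K e j z.
  move=> ji; rewrite /z bcoordD// ltr_wpDl//; first by rewrite mulr_ge0// subr_ge0.
  by rewrite mulr_gt0// Fi facet_center_gt0.
have zi : bcoord K e i z = 0.
  rewrite /z bcoordD// yi ?inE ?eqxx// mulr0 add0r.
  rewrite (bcoord_facet Ke (i := i)) ?mulr0// -Fi.
  by apply: facet_center_geo; exact: card_facet FK.
(* Each of the finitely many cells is closed, so a cell that misses z also misses a neighbourhood of
   z. *)
have near_other : \forall x \near z, forall K' : simplex, K' \in cells T -> geo K' x -> geo K' z.
  apply: (@filter_forall _ _ (fun (K' : simplex) x => K' \in cells T -> geo K' x -> geo K' z) (nbhs z) _) => K'.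
  have [cK'|ncK'] := boolP (K' \in cells T); last exact: nearW.
  have [e' Ke'] := cell_frame cK'.
  have [zK'|nzK'] := pselect (geo K' z); first exact: nearW.
  have [j zj] : exists j, bcoord K' e' j z < 0.
    apply: contrapT => noj; apply: nzK'; apply: (bcoord_geo Ke') => j.
    by rewrite leNgt; apply/negP => zj; apply: noj; exists j.
  apply: filterS (bcoord_near_lt zj) => x xj _ K'x.
  have [x0 _] := geo_bcoord Ke' (subxx K') K'x.
  by have := x0 j; rewrite leNgt xj.
have nearO : \forall x \near z, Omega x by exact: open_nbhs_nbhs.
have [r /andP[r0 _] [Ox other]] := near_ray (unit_normal K F) (filterI nearO near_other).
set x := z + _ in Ox other.
have [K' cK' K'x] : exists2 K', K' \in cells T & geo K' x.
  have : closure Omega x by exact: subset_closure.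
  by rewrite (tri_cover T) => -[K' cK' K'x]; exists K'.
have K'z := other _ cK' K'x.
have f0 : e (lift i ord0) \in F.
  by rewrite Fi !inE (frame_mem Ke) (inj_eq (frame_inj Ke)) eq_sym neq_lift.
have xi : bcoord K e i x < 0.
  have h0 := normal_height Ke i.
  have sz := bcoord_side Ke (i := i) z (f := e (lift i ord0)).
  have sx := bcoord_side Ke (i := i) x (f := e (lift i ord0)).
  rewrite -Fi in h0 sz sx; have {}sz := sz f0; have {}sx := sx f0.
  rewrite -(nmulr_lgt0 _ h0) -sx /x addrAC dotDr sz zi mul0r add0r.
  by rewrite dotZr unit_normal_sqr// mulr1.
have K'K : K' != K.
  apply/eqP => K'E; subst K'; have [x0 _] := geo_bcoord Ke (subxx K) K'x.
  by have := x0 i; rewrite leNgt xi.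
have Kz : geo K z.
  by apply: (bcoord_geo Ke) => j; have [->|/z0/ltW//] := eqVneq j i; rewrite zi.
exists K'; split => //; rewrite inE (card_facet FK) eqxx andbT.
have : geo (K :&: K') z by rewrite -[geo _](tri_conform cK cK').
case/(geo_bcoord Ke (subsetIl _ _)) => _ zKK'.
apply/fintype.subsetP => v; rewrite Fi => /setD1P[vi /(frameP Ke)[j vj]]; subst v.
have ji : j != i by apply: contraNneq vi => ->.
(* Every vertex of F has a positive weight in z, whereas points common to both cells give weight 0
   to vertices outside K'. *)
apply: contraTT (z0 j ji) => ejK'; rewrite zKK' ?ltxx//.
by rewrite inE (negPf ejK') andbF.
Qed.

(** No third cell can share F, since three unit vectors cannot be pairwise opposite. *)
Lemma interior_facet_normals F : domain Omega -> F \in facets T -> ~~ boundary_facet F ->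
  \sum_(K in cells T | F \in facets_of K) unit_normal K F = 0.
Proof.
move=> dO; rewrite inE => /existsP[K /andP[cK FK]] nbF.
have [K' [cK' FK' K'K]] := interior_facet_neighbour dO nbF cK FK.
rewrite (bigD1 K)/= ?cK// (bigD1 K')/= ?cK' ?FK'//.
rewrite (opposite_normals cK cK') 1?eq_sym//.
rewrite big1 ?addr0 ?subrr// => K'' /andP[/andP[/andP[cK'' FK''] K''K] K''K'].
have E1 : unit_normal K'' F = - unit_normal K F by apply: opposite_normals; rewrite // eq_sym.
have E2 : unit_normal K'' F = - unit_normal K' F by apply: opposite_normals; rewrite // eq_sym.
have E3 : unit_normal K' F = - unit_normal K F by apply: opposite_normals; rewrite // eq_sym.
have EE : unit_normal K F = unit_normal K' F by apply: oppr_inj; rewrite -E1.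
have := unit_normal_sqr cK FK; rewrite {2}EE E3 dotNr unit_normal_sqr// => E.
by have := @ltr01 R; rewrite -{1}E ltr0N1.
Qed.

End Barycentric.

(** * Polynomial fields and tensors *)

Section Polynomials.
Context {R : realType} {n : nat}.
Implicit Types (p q : mpoly n R) (D : set 'rV[R]_n) (f g : 'rV[R]_n -> R).

Lemma msize_mderiv_le i p k : (msize p <= k.+1)%N -> (msize (mderiv i p) <= k)%N.
Proof.
move=> pk; rewrite msizeE; apply/bigmax_leqP_seq => a; rewrite mcoeff_msupp mcoeff_deriv => pa _.
have : mnm_add a (mnm1 i) \in msupp p.
  by rewrite mcoeff_msupp; apply: contraNneq pa => ->; rewrite mul0rn.
move/msize_mdeg_lt; rewrite mdegD mdeg1 addn1 => /leq_trans/(_ pk).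
by rewrite ltnS.
Qed.

Lemma is_derive_meval p (x v : 'rV[R]_n) :
  is_derive x v (fun y : 'rV[R]_n => meval (y 0) p)
    (\sum_i v 0 i * meval (x 0) (mderiv i p)).
Proof.
elim/(@mpoly_ring_ind R n) : p => [c|j|p q IHp IHq|p q IHp IHq].
- under eq_fun do rewrite mevalC.
  rewrite big1; first exact: is_derive_cst.
  by move=> i _; rewrite mderivC meval0 mulr0.
- under eq_fun do rewrite mevalXU.
  rewrite (bigD1 j)//= mderivXU eqxx meval1 mulr1 big1 ?addr0; last first.
    by move=> i ij; rewrite mderivXU eq_sym (negPf ij) meval0 mulr0.
  have [dx] := (is_derive_id x v : is_derive x v (fun y => y) v).
  have dc := (derivable_mxP _ _ _).1 dx 0 j.
  move=> /matrixP/(_ 0 j); rewrite derive_mx// mxE => E.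
  exact: DeriveDef.
- under eq_fun do rewrite mevalD.
  under eq_bigr do rewrite mderivD mevalD mulrDr.
  by rewrite big_split; exact: is_deriveD.
- under eq_fun do rewrite mevalM.
  rewrite (_ : \sum_i _ = meval (x 0) p *: (\sum_i v 0 i * meval (x 0) (mderiv i q)) +
      meval (x 0) q *: (\sum_i v 0 i * meval (x 0) (mderiv i p))); last first.
    rewrite /GRing.scale/= !mulr_sumr -big_split/=; apply: eq_bigr => i _.
    by rewrite mderivM mevalD !mevalM; ring.
  exact: is_deriveM.
Qed.

Lemma derive_meval p (x : 'rV[R]_n) j :
  'D_(delta_mx 0 j) (fun y : 'rV[R]_n => meval (y 0) p) x = meval (x 0) (mderiv j p).
Proof.
have [_ ->] := is_derive_meval p x (delta_mx 0 j).
rewrite (bigD1 j)//= mxE !eqxx mul1r big1 ?addr0// => i ij.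
by rewrite mxE (negPf ij) andbF mul0r.
Qed.

Lemma is_PD l D f g : is_P l D f -> is_P l D g -> is_P l D (fun x => f x + g x).
Proof.
move=> [p sp fp] [q sq gq]; exists (p + q) => [|x Dx]; last by rewrite mevalD fp// gq.
by rewrite (leq_trans (mmeasureD_le _ _ _))// geq_max sp.
Qed.

Lemma is_PZ l D c f : is_P l D f -> is_P l D (fun x => c * f x).
Proof.
move=> [p sp fp]; exists (c *: p) => [|x Dx]; last by rewrite mevalZ fp.
exact: leq_trans (msizeZ_le _ _) sp.
Qed.

Lemma is_P0 l D : is_P l D (fun=> 0).
Proof. by exists 0 => [|x _]; rewrite ?mmeasure0// meval0. Qed.

Lemma is_P_sum l D (I : Type) (r : seq I) (P : pred I) (F : I -> 'rV[R]_n -> R) :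
  (forall i, P i -> is_P l D (F i)) -> is_P l D (fun x => \sum_(i <- r | P i) F i x).
Proof.
move=> PF; elim: r => [|i r IH].
  by under eq_fun do rewrite big_nil; exact: is_P0.
under eq_fun do rewrite big_cons; case Pi : (P i) => //.
by apply: is_PD => //; exact: PF.
Qed.

Lemma is_P_sub l D D' f : D' `<=` D -> is_P l D f -> is_P l D' f.
Proof. by move=> DD' [p sp fp]; exists p => // x /DD'/fp. Qed.

Lemma is_vPD l D (u v : 'rV[R]_n -> 'rV[R]_n) :
  is_vP l D u -> is_vP l D v -> is_vP l D (fun x => u x + v x).
Proof. by move=> hu hv i; under eq_fun do rewrite mxE; exact: is_PD. Qed.

Lemma is_vPZ l D c (u : 'rV[R]_n -> 'rV[R]_n) :
  is_vP l D u -> is_vP l D (fun x => c *: u x).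
Proof. by move=> hu i; under eq_fun do rewrite mxE; exact: is_PZ. Qed.

Lemma is_vP_dot l D (u : 'rV[R]_n -> 'rV[R]_n) a :
  is_vP l D u -> is_P l D (fun x => dot (u x) a).
Proof.
move=> hu; apply: is_P_sum => i _; under eq_fun do rewrite mulrC; exact: is_PZ.
Qed.

End Polynomials.

Section TensorAlgebra.
Context {R : realType} {d : nat}.
Implicit Types (a b c e : 'rV[R]_d) (A B : 'M[R]_d).

Lemma ddotC A B : ddot A B = ddot B A.
Proof. by apply: eq_bigr => i _; apply: eq_bigr => j _; rewrite mulrC. Qed.

Lemma ddotDl A B C : ddot (A + B) C = ddot A C + ddot B C.
Proof.
rewrite /ddot -big_split/=; apply: eq_bigr => i _.
by rewrite -big_split/=; apply: eq_bigr => j _; rewrite mxE mulrDl.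
Qed.

Lemma ddotZl k A B : ddot (k *: A) B = k * ddot A B.
Proof.
rewrite /ddot mulr_sumr; apply: eq_bigr => i _.
by rewrite mulr_sumr; apply: eq_bigr => j _; rewrite mxE mulrA.
Qed.

Lemma ddotDr A B C : ddot C (A + B) = ddot C A + ddot C B.
Proof. by rewrite ddotC ddotDl !(ddotC C). Qed.

Lemma ddotZr k A B : ddot A (k *: B) = k * ddot A B.
Proof. by rewrite ddotC ddotZl ddotC. Qed.

Lemma ddotBl A B C : ddot (A - B) C = ddot A C - ddot B C.
Proof. by rewrite -scaleN1r ddotDl ddotZl mulN1r. Qed.

Lemma otimesE a b i j : otimes a b i j = a 0 i * b 0 j.
Proof. by rewrite /otimes mxE big_ord1 mxE. Qed.

Lemma ddot_otimes a b c e : ddot (otimes a b) (otimes c e) = dot a c * dot b e.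
Proof.
rewrite /ddot /dot mulr_suml; apply: eq_bigr => i _.
by rewrite mulr_sumr; apply: eq_bigr => j _; rewrite !otimesE mulrACA.
Qed.

Lemma ddot_id A : ddot 1%:M A = \tr A.
Proof.
apply: eq_bigr => i _; rewrite (bigD1 i)//= mxE eqxx mul1r big1 ?addr0// => j ij.
by rewrite mxE eq_sym (negPf ij) mul0r.
Qed.

Lemma tr_otimes a b : \tr (otimes a b) = dot a b.
Proof. by apply: eq_bigr => i _; rewrite otimesE. Qed.

Lemma otimesBl a b c : otimes (a - b) c = otimes a c - otimes b c.
Proof. by rewrite /otimes linearB mulmxBl. Qed.

Lemma ddot_ge0 A : 0 <= ddot A A.
Proof. by apply: sumr_ge0 => i _; apply: sumr_ge0 => j _; rewrite -expr2 sqr_ge0. Qed.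

(** The square of A + b (a (x) n) is nonnegative; divide its expansion by b. *)
Lemma ddot_young a n A (b : R) : 0 < b -> dot n n = 1 ->
  - (b^-1 * ddot A A) - b * dot a a <= 2 * ddot (otimes a n) A.
Proof.
move=> b0 nn; have := ddot_ge0 (A + b *: otimes a n).
rewrite ddotDl !ddotDr !ddotZl !ddotZr ddot_otimes nn mulr1 (ddotC A).
move=> h; rewrite -subr_ge0.
have -> : 2 * ddot (otimes a n) A - (- (b^-1 * ddot A A) - b * dot a a) =
  b^-1 * (ddot A A + b * ddot (otimes a n) A + b * (ddot (otimes a n) A + b * dot a a)).
  by field; rewrite gt_eqF.
by apply: mulr_ge0; [rewrite invr_ge0 ltW|rewrite mulrDr].
Qed.

End TensorAlgebra.

(** * Regularity of discrete functions and Green's formula *)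

Section DiscreteFunctions.
Context {R : realType} {m : nat}.
Local Notation d := m.+2.
Context {Omega : set 'rV[R]_d} {T : triangulation Omega}.
Local Notation simplex := {set vertex T}.
Local Notation point := ('rV[R]_d).
Implicit Types (K F S : simplex).

Definition vregular j S (u : point -> point) := forall i, sregular j S (fun x => u x 0 i).

Definition mregular j S (A : point -> 'M[R]_d) := forall a b, sregular j S (fun x => A x a b).

Lemma vregular_cst j S a : vregular j S (fun=> a).
Proof. by move=> i; exact: sregular_cst. Qed.

Lemma vregularZ j S (c : point -> R) u :
  sregular j S c -> vregular j S u -> vregular j S (fun x => c x *: u x).
Proof. by move=> rc ru i; under eq_fun do rewrite mxE; exact: sregularM. Qed.

Lemma vregularB j S u v : vregular j S u -> vregular j S v -> vregular j S (fun x => u x - v x).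
Proof. by move=> ru rv i; under eq_fun do rewrite !mxE; exact: sregularB. Qed.

Lemma sregular_dot j S u v : vregular j S u -> vregular j S v -> sregular j S (fun x => dot (u x) (v x)).
Proof. by move=> ru rv; apply: sregular_sum => i _; exact: sregularM. Qed.

Lemma mregular_otimes j S u v : vregular j S u -> vregular j S v ->
  mregular j S (fun x => otimes (u x) (v x)).
Proof. by move=> ru rv a b; under eq_fun do rewrite otimesE; exact: sregularM. Qed.

Lemma mregularD j S A B : mregular j S A -> mregular j S B -> mregular j S (fun x => A x + B x).
Proof. by move=> rA rB a b; under eq_fun do rewrite mxE; exact: sregularD. Qed.

Lemma mregularZ j S (c : point -> R) A :
  sregular j S c -> mregular j S A -> mregular j S (fun x => c x *: A x).
Proof. by move=> rc rA a b; under eq_fun do rewrite mxE; exact: sregularM. Qed.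

Lemma mregularB j S A B : mregular j S A -> mregular j S B -> mregular j S (fun x => A x - B x).
Proof. by move=> rA rB a b; under eq_fun do rewrite !mxE; exact: sregularB. Qed.

Lemma mregular_cst j S A : mregular j S (fun=> A).
Proof. by move=> a b; exact: sregular_cst. Qed.

Lemma sregular_ddot j S A B : mregular j S A -> mregular j S B ->
  sregular j S (fun x => ddot (A x) (B x)).
Proof.
move=> rA rB; apply: sregular_sum => a _; apply: sregular_sum => b _; exact: sregularM.
Qed.

Lemma sregular_tr j S A : mregular j S A -> sregular j S (fun x => \tr (A x)).
Proof. by move=> rA; rewrite /mxtrace; apply: sregular_sum => i _; exact: rA. Qed.

Section CellFunction.
Variables (u : point -> point) (l : nat).
Hypothesis Pu : is_vP l setT u.

Lemma is_vP_setT : exists p : 'I_d -> mpoly d R, (forall i, (msize (p i) <= l.+1)%N) /\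
  forall x i, u x 0 i = meval (x 0) (p i).
Proof.
have Pu' i : exists p : mpoly d R, (msize p <= l.+1)%N /\ forall x, u x 0 i = meval (x 0) p.
  by have [p sp up] := Pu i; exists p; split => // x; exact: up.
have [p pP] := choice Pu'; exists p; split=> [i|x i]; first by have [] := pP i.
by have [_ ->] := pP i.
Qed.

Lemma vregular_vP j S : vregular j S u.
Proof.
move=> i; have [p [_ up]] := is_vP_setT; under eq_fun do rewrite up.
exact: sregular_meval.
Qed.

End CellFunction.

Lemma vgrad_meval (u : point -> point) (p : 'I_d -> mpoly d R) :
  (forall x i, u x 0 i = meval (x 0) (p i)) ->
  forall x i j, vgrad u x i j = meval (x 0) (mderiv j (p i)).
Proof.
move=> up x i j; rewrite mxE -derive_meval; congr ('D__ _ _).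
by apply/funext => y; rewrite up.
Qed.

Lemma mregular_vgrad j S l (u : point -> point) : is_vP l setT u -> mregular j S (vgrad u).
Proof.
move=> Pu a b; have [p [_ up]] := is_vP_setT Pu.
under eq_fun do rewrite (vgrad_meval up); exact: sregular_meval.
Qed.

Lemma sregular_P j S l q : is_P l setT q -> sregular j S q.
Proof.
move=> [p _ qp]; rewrite (_ : q = fun x => meval (x 0) p); first exact: sregular_meval.
by apply/funext => x; exact: qp.
Qed.

Lemma sregular_facet F l q : #|F| = d -> is_P l (geo F) q -> sregular d.-1 F q.
Proof.
move=> cF [p _ qp]; apply: (@eq_sregular _ _ _ _ _ _ (fun x => meval (x 0) p)).
  by move=> x Fx; rewrite qp//; apply: (relint_geo (k := m.+1)).
exact: sregular_meval.
Qed.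

Lemma vregular_facet F l ub : #|F| = d -> is_vP l (geo F) ub -> vregular d.-1 F ub.
Proof. by move=> cF Pub i; exact: sregular_facet cF (Pub i). Qed.

Lemma green K l (u : point -> point) (q : mpoly d R) : K \in cells T -> is_vP l setT u ->
  integral_simplex d K (fun x => \tr (vgrad u x) * meval (x 0) q) +
  integral_simplex d K (fun x => dot (u x) (grad (fun y => meval (y 0) q) x)) =
  \sum_(F in facets_of K)
    integral_simplex d.-1 F (fun x => dot (u x) (unit_normal K F) * meval (x 0) q).
Proof.
move=> cK Pu; have [p [_ up]] := is_vP_setT Pu.
rewrite -integral_simplexD; last 2 first.
- apply: sregularM; last exact: sregular_meval.
  apply: sregular_tr; exact: mregular_vgrad Pu.
- apply: sregular_dot; first exact: vregular_vP Pu _ _.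
  by move=> i; under eq_fun do rewrite mxE derive_meval; exact: sregular_meval.
transitivity (integral_simplex d K (fun x => \sum_i meval (x 0) (mderiv i (p i * q)))).
  apply: eq_integral_simplex => x _; rewrite /dot /mxtrace mulr_suml -big_split/=.
  apply: eq_bigr => i _; rewrite (vgrad_meval up) mderivM mevalD !mevalM up mxE derive_meval.
  by [].
rewrite integral_simplex_sum => [|i _]; last exact: sregular_meval.
under eq_bigr do rewrite cell_divergence//.
rewrite exchange_big/=; apply: eq_bigr => F FK.
rewrite -integral_simplex_sum => [|i _]; last first.
  by apply: sregularM; [exact: sregular_cst|exact: sregular_meval].
apply: eq_integral_simplex => x _; rewrite /dot mulr_suml; apply: eq_bigr => i _.
by rewrite mevalM up; ring.
Qed.

End DiscreteFunctions.

(** * Mass conservation *)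

Section MassConservation.
Context {R : realType} {m : nat}.
Local Notation d := m.+2.
Context {Omega : set 'rV[R]_d} {T : triangulation Omega}.
Local Notation simplex := {set vertex T}.
Local Notation point := ('rV[R]_d).
Implicit Types (K F S : simplex) (s : state T).

Lemma facetsP K F : K \in cells T -> F \in facets_of K -> F \in facets T.
Proof. by move=> cK FK; rewrite inE; apply/existsP; exists K; rewrite cK. Qed.

Lemma facetsE F : F \in facets T -> exists2 K, K \in cells T & F \in facets_of K.
Proof. by rewrite inE => /existsP[K /andP[cK FK]]; exists K. Qed.

Lemma card_facets F : F \in facets T -> #|F| = d.
Proof. by case/facetsE => K _; exact: card_facet. Qed.

Lemma int_cell_boundariesE (g : simplex -> simplex -> point -> R) :
  int_cell_boundaries g = \sum_(F in facets T)
    \sum_(K in cells T | F \in facets_of K) integral_simplex d.-1 F (g K F).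
Proof.
apply: (exchange_big_dep (fun F => F \in facets T)) => K F cK FK.
exact: facetsP FK.
Qed.

Lemma int_boundaryE (A : set point) (g : simplex -> simplex -> point -> R) :
  int_boundary A g = \sum_(F in facets T) \sum_(K in cells T | F \in facets_of K)
    (if boundary_facet F then integral_simplex d.-1 F (fun x => \1_A x * g K F x) else 0).
Proof.
rewrite /int_boundary (exchange_big_dep (fun F => F \in facets T)); last first.
  by move=> K F cK /andP[FK _]; exact: facetsP FK.
apply: eq_bigr => F _.
rewrite [RHS](eq_bigr (fun K => if boundary_facet F then
  integral_simplex d.-1 F (fun x => \1_A x * g K F x) else 0))//.
case bF : (boundary_facet F); last by rewrite big1_eq big_pred0// => K; rewrite !andbF.
by apply: eq_bigl => K; rewrite andbT.
Qed.

Lemma vel_regular k s j S K : is_V k (vel s) -> K \in cells T -> vregular j S (vel s K).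
Proof. by move=> Vs cK; exact: vregular_vP (Vs _ cK) _ _. Qed.

Lemma fvel_regular k GammaD s F : is_Vbar k GammaD (fvel s) -> F \in facets T ->
  vregular d.-1 F (fvel s F).
Proof. by move=> Vs cF; have [Ps _] := Vs _ cF; exact: vregular_facet (card_facets cF) Ps. Qed.

Lemma relint_facet F x : F \in facets T -> relint d.-1 F x -> geo F x.
Proof. by move=> cF; apply: relint_geo; exact: card_facets. Qed.

(** After integration by parts, the mass equation tested with the divergence says that its square
    integrates to 0 over K. In later uses [phi] is a pressure or half the squared velocity. *)
Lemma divergence_free k s K phi : (0 < k)%N -> local_mass k s -> is_V k (vel s) ->
  K \in cells T -> sregular d K phi ->
  integral_simplex d K (fun x => \tr (vgrad (vel s K) x) * phi x) = 0.
Proof.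
move=> k0 mass Vs cK rphi; have Pu := Vs _ cK.
have [p [sp up]] := is_vP_setT Pu.
pose P := \sum_i mderiv i (p i).
have trE x : \tr (vgrad (vel s K) x) = meval (x 0) P.
  by rewrite /P raddf_sum; apply: eq_bigr => i _; rewrite (vgrad_meval up).
(* Cutting off outside K reduces the sums over the mesh to K; this is allowed as functions of the
   pressure space may jump between cells. *)
pose q K' : point -> R := if K' == K then fun x => meval (x 0) P else fun=> 0.
have Qq : is_Q k q.
  move=> K' _; rewrite /q; case: ifP => _; last exact: is_P0.
  rewrite /P; under eq_fun do rewrite raddf_sum/=.
  apply: is_P_sum => i _; exists (mderiv i (p i)) => //.
  by rewrite prednK//; exact: msize_mderiv_le.
have grad0 x : grad (fun=> 0 : R) x = 0 :> point.
  by apply/rowP => j; rewrite !mxE; exact: derive_cst.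
apply: (integral_simplex_sqr0 (g := fun x => \tr (vgrad (vel s K) x))) => //.
  by apply: sregular_tr; exact: mregular_vgrad Pu.
have qK x : q K x = meval (x 0) P by rewrite /q eqxx.
have q0 K' : K' != K -> q K' = fun=> 0 by rewrite /q => /negPf ->.
have cellsE : int_cells (T := T) (fun K x => dot (vel s K x) (grad (q K) x)) =
    integral_simplex d K (fun x => dot (vel s K x) (grad (fun y => meval (y 0) P) x)).
  rewrite /int_cells (bigD1 K)//= [X in _ + X]big1 ?addr0.
    by congr integral_simplex; apply/funext => x; congr (dot _ (grad _ x)); apply/funext.
  move=> K' /andP[_ /q0 ->]; under eq_integral_simplex do rewrite grad0 dot0r.
  exact: integral_simplex0.
have boundE : int_cell_boundaries (T := T) (fun K F x => dot (vel s K x) (unit_normal K F) * q K x) =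
    \sum_(F in facets_of K)
      integral_simplex d.-1 F (fun x => dot (vel s K x) (unit_normal K F) * meval (x 0) P).
  rewrite /int_cell_boundaries (bigD1 K)//= [X in _ + X]big1 ?addr0.
    apply: eq_bigr => F _; apply: eq_integral_simplex => x _; by rewrite qK.
  move=> K' /andP[_ /q0 ->]; rewrite big1// => F _.
  by under eq_integral_simplex do rewrite mulr0; exact: integral_simplex0.
have := mass q Qq; rewrite cellsE boundE -(green P cK Pu) opprD addrCA subrr addr0.
move=> /eqP; rewrite eq_sym oppr_eq0 => /eqP E; rewrite -[RHS]E.
by apply: eq_integral_simplex => x _; rewrite trE expr2.
Qed.

(** What the facet mass equation tests on F. The normals are outward, so on an interior facet the
    sum is a difference of two traces; the facet velocity enters only on the boundary of Omega. *)
Definition jump s F x : R := \sum_(K in cells T | F \in facets_of K)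
  (dot (vel s K x) (unit_normal K F)
   - (boundary_facet F)%:R * dot (fvel s F x) (unit_normal K F)).

Lemma sregular_jump k GammaD s F : is_V k (vel s) -> is_Vbar k GammaD (fvel s) ->
  F \in facets T -> sregular d.-1 F (jump s F).
Proof.
move=> Vs Vbs cF; apply: sregular_sum => K /andP[cK FK]; apply: sregularB.
  by apply: sregular_dot; [exact: vel_regular Vs cK|exact: vregular_cst].
apply: sregularM; first exact: sregular_cst.
by apply: sregular_dot; [exact: fvel_regular Vbs cF|exact: vregular_cst].
Qed.

(** The normals are constant on F, so the jump has degree at most k there, and its extension by 0 to
    the other facets is a test function. Arbitrary [phi] are allowed because [outflow_ge0] needs one
    containing [lam]. *)
Lemma normal_jump k GammaD s F phi : facet_mass k s -> is_V k (vel s) ->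
  is_Vbar k GammaD (fvel s) -> F \in facets T -> sregular d.-1 F phi ->
  integral_simplex d.-1 F (fun x => jump s F x * phi x) = 0.
Proof.
move=> mass Vs Vbs cF rphi; have rJ := sregular_jump Vs Vbs cF.
apply: integral_simplex_sqr0 => //.
pose q F' : point -> R := if F' == F then jump s F else fun=> 0.
have Qq : is_Qbar k q.
  move=> F' _; rewrite /q; case: ifP => [/eqP ->|_]; last exact: is_P0.
  apply: is_P_sum => K /andP[cK FK]; apply: is_PD.
    by apply: is_P_sub (is_vP_dot _ (Vs _ cK)).
  under eq_fun do rewrite -mulNr; apply: is_PZ.
  by apply: is_vP_dot; have [] := Vbs _ cF.
have ru K : K \in cells T -> sregular d.-1 F (fun x => dot (vel s K x) (unit_normal K F)).
  by move=> cK; apply: sregular_dot; [exact: vel_regular Vs cK|exact: vregular_cst].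
have rub K : sregular d.-1 F (fun x => dot (fvel s F x) (unit_normal K F)).
  by apply: sregular_dot; [exact: fvel_regular Vbs cF|exact: vregular_cst].
have := mass q Qq; rewrite int_cell_boundariesE int_boundaryE -sumrB (bigD1 F)//= [X in _ + X]big1 ?addr0; last first.
  move=> F' /andP[_ /negPf F'F]; rewrite -sumrB big1// => K _; rewrite /q F'F.
  under eq_integral_simplex do rewrite mulr0; rewrite integral_simplex0.
  case: ifP => _; last by rewrite subrr.
  under eq_integral_simplex do rewrite !mulr0; rewrite integral_simplex0.
  by rewrite subrr.
move=> E; rewrite [RHS]E /q eqxx -sumrB.
transitivity (integral_simplex d.-1 F (fun x => \sum_(K in cells T | F \in facets_of K)
    (dot (vel s K x) (unit_normal K F)
     - (boundary_facet F)%:R * dot (fvel s F x) (unit_normal K F)) * jump s F x)).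
  by apply: eq_integral_simplex => x _; rewrite expr2 {1}/jump mulr_suml.
rewrite integral_simplex_sum; last first.
  move=> K /andP[cK FK]; apply: sregularM => //; apply: sregularB; first exact: ru.
  by apply: sregularM => //; exact: sregular_cst.
apply: eq_bigr => K /andP[cK FK].
case: ifP => bF; last first.
  by rewrite subr0; apply: eq_integral_simplex => x _; rewrite mul0r subr0.
rewrite (@eq_integral_simplex _ _ _ _ _ _ (fun x => \1_(boundary Omega) x * _)
   (fun x => dot (fvel s F x) (unit_normal K F) * jump s F x)); last first.
  move=> x /(relint_facet cF) Fx; rewrite indicE mem_set ?mul1r//.
  by move/asboolP : bF; exact.
rewrite -integral_simplexB; last 2 first.
- by apply: sregularM => //; exact: ru.
- by apply: sregularM => //; exact: rub.
by apply: eq_integral_simplex => x _; rewrite mul1r mulrBl.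
Qed.

End MassConservation.

(** * Energy balance *)

Section Diameter.
Context {R : realType} {m : nat}.
Local Notation d := m.+2.
Context {Omega : set 'rV[R]_d} {T : triangulation Omega}.
Local Notation simplex := {set vertex T}.
Local Notation X := (Defs.coord T).
Implicit Types (K F S : simplex).

Lemma enorm_le_sum n (a : 'rV[R]_n) : enorm a <= \sum_j `|a 0 j|.
Proof.
have s0 : 0 <= \sum_j `|a 0 j| by apply: sumr_ge0.
rewrite /enorm -[leRHS](ger0_norm s0) -sqrtr_sqr ler_wsqrtr//.
rewrite expr2 mulr_sumr; apply: ler_sum => j _; rewrite -expr2 -real_normK ?num_real//.
rewrite expr2 ler_wpM2r// (bigD1 j)//= lerDl; exact: sumr_ge0.
Qed.

Lemma vertex_geo S v : v \in S -> geo S (X v).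
Proof.
move=> vS; exists (fun w => (w == v)%:R); split => [w||]; first by rewrite ler0n.
  by rewrite (bigD1 v)//= eqxx big1 ?addr0// => w /andP[_ /negPf ->].
by rewrite (bigD1 v)//= eqxx scale1r big1 ?addr0// => w /andP[_ /negPf ->]; rewrite scale0r.
Qed.

Lemma geo_bounded S x j : geo S x -> `|x 0 j| <= \sum_v `|X v 0 j|.
Proof.
move=> [c [c0 c1 ->]]; rewrite summxE.
apply: le_trans (ler_norm_sum _ _ _) _; rewrite big_mkcond/=; apply: ler_sum => v _.
case: ifP => // vS; rewrite mxE normrM ler_piMl// ger0_norm//.
rewrite -c1 (bigD1 v)//= lerDl; exact: sumr_ge0.
Qed.

(** [sup] is meaningful only for a bounded set, whence the coordinatewise bound on distances; two
    distinct vertices then make it positive. *)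
Lemma diam_gt0 K : K \in cells T -> 0 < diam K.
Proof.
move=> cK; have [e Ke] := cell_frame cK.
pose i : 'I_d.+1 := ord0; set x := X (e i); set y := X (e (lift i ord0)).
have xy : 0 < enorm (x - y).
  rewrite sqrtr_gt0 lt_neqAle dot_ge0 andbT eq_sym; apply/eqP => /dot_eq0 xy0.
  by have := normal_height Ke i; rewrite -/x -/y xy0 dot0r ltxx.
apply: (lt_le_trans xy); apply: ub_le_sup.
  exists (\sum_j (\sum_v `|X v 0 j| + \sum_v `|X v 0 j|)) => _ [a Ka [b Kb <-]].
  apply: le_trans (enorm_le_sum _) _; apply: ler_sum => j _; rewrite !mxE.
  by apply: le_trans (ler_normB _ _) _; apply: lerD; [exact: geo_bounded Ka|exact: geo_bounded Kb].
exists x; first by apply: vertex_geo; exact: frame_mem Ke _.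
by exists y => //; apply: vertex_geo; exact: frame_mem Ke _.
Qed.

End Diameter.

Section Linearity.
Context {R : realType} {m : nat}.
Local Notation d := m.+2.
Context {Omega : set 'rV[R]_d} {T : triangulation Omega}.
Local Notation simplex := {set vertex T}.
Local Notation point := ('rV[R]_d).

Definition cregular (g : simplex -> point -> R) :=
  forall K, K \in cells T -> sregular d K (g K).

Definition bregular (g : simplex -> simplex -> point -> R) :=
  forall K F, K \in cells T -> F \in facets_of K -> sregular d.-1 F (g K F).

Lemma eq_int_cells (f g : simplex -> point -> R) :
  (forall K x, K \in cells T -> f K x = g K x) -> int_cells f = int_cells g.
Proof.
by move=> fg; apply: eq_bigr => K cK; apply: eq_integral_simplex => x _; exact: fg.
Qed.

Lemma int_cellsD f g : cregular f -> cregular g ->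
  int_cells (fun K x => f K x + g K x) = int_cells f + int_cells g.
Proof.
move=> rf rg; rewrite /int_cells -big_split/=; apply: eq_bigr => K cK.
by rewrite integral_simplexD//; [exact: rf|exact: rg].
Qed.

Lemma int_cellsZ c f : cregular f -> int_cells (fun K x => c * f K x) = c * int_cells f.
Proof.
move=> rf; rewrite /int_cells mulr_sumr; apply: eq_bigr => K cK.
by rewrite integral_simplexZ//; exact: rf.
Qed.

Lemma int_cells_ge0 (f : simplex -> point -> R) :
  (forall K x, K \in cells T -> 0 <= f K x) -> 0 <= int_cells f.
Proof.
by move=> f0; apply: sumr_ge0 => K cK; apply: integral_simplex_ge0 => x _; exact: f0.
Qed.

Lemma eq_int_cell_boundaries (f g : simplex -> simplex -> point -> R) :
  (forall K F x, K \in cells T -> F \in facets_of K -> f K F x = g K F x) ->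
  int_cell_boundaries f = int_cell_boundaries g.
Proof.
move=> fg; apply: eq_bigr => K cK; apply: eq_bigr => F FK.
by apply: eq_integral_simplex => x _; exact: fg.
Qed.

Lemma int_cell_boundariesD f g : bregular f -> bregular g ->
  int_cell_boundaries (fun K F x => f K F x + g K F x) =
  int_cell_boundaries f + int_cell_boundaries g.
Proof.
move=> rf rg; rewrite /int_cell_boundaries -big_split/=; apply: eq_bigr => K cK.
rewrite -big_split/=; apply: eq_bigr => F FK.
by rewrite integral_simplexD//; [exact: rf|exact: rg].
Qed.

Lemma int_cell_boundariesB f g : bregular f -> bregular g ->
  int_cell_boundaries (fun K F x => f K F x - g K F x) =
  int_cell_boundaries f - int_cell_boundaries g.
Proof.
move=> rf rg; rewrite /int_cell_boundaries -sumrB; apply: eq_bigr => K cK.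
rewrite -sumrB; apply: eq_bigr => F FK.
by rewrite integral_simplexB//; [exact: rf|exact: rg].
Qed.

Lemma bregularD f g : bregular f -> bregular g -> bregular (fun K F x => f K F x + g K F x).
Proof. by move=> rf rg K F cK FK; apply: sregularD; [exact: rf|exact: rg]. Qed.

Lemma bregularB f g : bregular f -> bregular g -> bregular (fun K F x => f K F x - g K F x).
Proof. by move=> rf rg K F cK FK; apply: sregularB; [exact: rf|exact: rg]. Qed.

End Linearity.

(** * Coercivity of the viscous terms *)

Section Coercivity.
Context {R : realType} {m : nat}.
Local Notation d := m.+2.
Context {Omega : set 'rV[R]_d} {T : triangulation Omega}.
Local Notation simplex := {set vertex T}.
Local Notation point := ('rV[R]_d).

Lemma gradient_trace k (K F : simplex) : K \in cells T -> F \in facets_of K ->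
  exists2 C, 0 <= C & forall u, is_vP k setT u ->
    integral_simplex d.-1 F (fun x => ddot (vgrad u x) (vgrad u x)) <=
    C * integral_simplex d K (fun x => ddot (vgrad u x) (vgrad u x)).
Proof.
move=> cK FK; have [C C0 CP] := trace_inequality k cK FK; exists C => // u Pu.
have [p [sp up]] := is_vP_setT Pu.
pose q i j := mderiv j (p i).
have GE (x : point) : ddot (vgrad u x) (vgrad u x) = \sum_i \sum_j meval (x 0) (q i j) ^+ 2.
  apply: eq_bigr => i _; apply: eq_bigr => j _.
  by have upx := vgrad_meval up x i j; rewrite upx expr2.
have rq n (S : simplex) i j : sregular n S (fun x => meval (x 0) (q i j) ^+ 2).
  by under eq_fun do rewrite expr2; apply: sregularM; exact: sregular_meval.
have IE n (S : simplex) : integral_simplex n S (fun x => ddot (vgrad u x) (vgrad u x)) =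
    \sum_i \sum_j integral_simplex n S (fun x => meval (x 0) (q i j) ^+ 2).
  transitivity (integral_simplex n S (fun x => \sum_i \sum_j meval (x 0) (q i j) ^+ 2)).
    by apply: eq_integral_simplex => x _; exact: GE.
  rewrite integral_simplex_sum; last by move=> i _; apply: sregular_sum.
  by apply: eq_bigr => i _; rewrite integral_simplex_sum.
rewrite !IE mulr_sumr; apply: ler_sum => i _; rewrite mulr_sumr; apply: ler_sum => j _.
by apply: CP; exact: msize_mderiv_le.
Qed.

Lemma penalty_coercive k : exists2 alpha0, 0 < alpha0 & forall alpha, alpha0 <= alpha ->
  forall (u : simplex -> point -> point) (ub : simplex -> point -> point),
  is_V k u -> (forall F, F \in facets T -> vregular d.-1 F (ub F)) ->
  0 <= int_cells (fun K x => ddot (vgrad (u K) x) (vgrad (u K) x))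
    + int_cell_boundaries (fun K F x =>
        2 * ddot (otimes (ub F x - u K x) (unit_normal K F)) (vgrad (u K) x)
        + alpha / diam K * dot (ub F x - u K x) (ub F x - u K x)).
Proof.
(* [choice] needs a constant for every pair of vertex sets; a pair that is not a cell with one of
   its facets gets 0. *)
have Cex (KF : simplex * simplex) : exists C : R, 0 <= C /\
    (KF.1 \in cells T -> KF.2 \in facets_of KF.1 -> forall u, is_vP k setT u ->
    integral_simplex d.-1 KF.2 (fun x => ddot (vgrad u x) (vgrad u x)) <=
    C * integral_simplex d KF.1 (fun x => ddot (vgrad u x) (vgrad u x))).
  case: KF => K F /=; case: (boolP (K \in cells T)) => cK; last by exists 0.
  case: (boolP (F \in facets_of K)) => FK; last by exists 0.
  by have [C C0 CP] := gradient_trace k cK FK; exists C.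
have [C CP] := choice Cex.
have C0 KF : 0 <= C KF by have [] := CP KF.
(* Dominates the sum of the trace constants over the facets of any cell; the 1 makes it positive, as
   a weight has to be. *)
pose beta := 1 + \sum_KF C KF.
have beta0 : 0 < beta by rewrite ltr_pwDl// sumr_ge0.
have betaK K : \sum_(F in facets_of K) C (K, F) <= beta.
  rewrite /beta -[leLHS]add0r lerD//.
  have -> : \sum_KF C KF = \sum_K \sum_F C (K, F) by rewrite pair_bigA; apply: eq_bigr; case.
  rewrite [leRHS](bigD1 K)//=; apply: ler_wpDr; first by apply: sumr_ge0 => K' _; exact: sumr_ge0.
  by rewrite big_mkcond/=; apply: ler_sum => F _; case: ifP.
have dK K : K \in cells T -> 0 < diam K by exact: diam_gt0.
(* The factor [diam K] compensates the scaling of the penalty, so that [alpha / diam K] is at least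
   [beta] on every cell. *)
exists (1 + \sum_(K in cells T) beta * diam K).
  rewrite ltr_pwDl// sumr_ge0// => K cK; rewrite mulr_ge0 ?ltW//; exact: dK.
move=> alpha le_alpha u ub Vu rub.
have alphaK K : K \in cells T -> beta <= alpha / diam K.
  move=> cK; rewrite ler_pdivlMr ?dK//; apply: le_trans le_alpha.
  rewrite (bigD1 K)//= addrCA lerDl addr_ge0//; apply: sumr_ge0 => K' /andP[cK' _].
  rewrite mulr_ge0 ?ltW//; exact: dK.
rewrite /int_cells /int_cell_boundaries -big_split/=; apply: sumr_ge0 => K cK.
set I := integral_simplex d K _.
have I0 : 0 <= I by apply: integral_simplex_ge0 => x _; exact: ddot_ge0.
suff low F : F \in facets_of K -> - (beta^-1 * (C (K, F) * I)) <=
    integral_simplex d.-1 F (fun x =>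
      2 * ddot (otimes (ub F x - u K x) (unit_normal K F)) (vgrad (u K) x)
      + alpha / diam K * dot (ub F x - u K x) (ub F x - u K x)).
  rewrite -[leLHS](subrr I); apply: lerD => //.
  apply: (@le_trans _ _ (- (beta^-1 * ((\sum_(F in facets_of K) C (K, F)) * I)))); last first.
    by rewrite mulr_suml mulr_sumr -sumrN; apply: ler_sum.
  by rewrite lerN2 ler_pdivrMl// ler_wpM2r.
move=> FK; have cF := facetsP cK FK; have nn := unit_normal_sqr cK FK.
have rG : mregular d.-1 F (vgrad (u K)) by exact: mregular_vgrad (Vu _ cK).
have rGG := sregular_ddot rG rG.
have re : vregular d.-1 F (fun x => ub F x - u K x).
  by apply: vregularB; [exact: rub|exact: vregular_vP (Vu _ cK) _ _].
have ree := sregular_dot re re.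
have reG : sregular d.-1 F (fun x => ddot (otimes (ub F x - u K x) (unit_normal K F)) (vgrad (u K) x)).
  by apply: sregular_ddot => //; apply: mregular_otimes => //; exact: vregular_cst.
have [_ /(_ cK FK _ (Vu _ cK)) trK] := CP (K, F); rewrite /= -/I in trK.
apply: (@le_trans _ _ (- (beta^-1 * integral_simplex d.-1 F
    (fun x => ddot (vgrad (u K) x) (vgrad (u K) x))))).
  by rewrite lerN2 ler_wpM2l// invr_ge0 ltW.
rewrite -subr_ge0 opprK -integral_simplexZ// -integral_simplexD; last 2 first.
- apply: sregularD; apply: sregularM => //; exact: sregular_cst.
- by apply: sregularM => //; exact: sregular_cst.
apply: integral_simplex_ge0 => x _.
have y := ddot_young (ub F x - u K x) (vgrad (u K) x) beta0 nn.
have e0 := dot_ge0 (ub F x - u K x).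
have ae := ler_wpM2r e0 (alphaK _ cK).
lra.
Qed.

End Coercivity.

(** * The energy estimate for one time step *)

Section EnergyIdentity.
Context {R : realType} {m : nat}.
Local Notation d := m.+2.
Context {Omega : set 'rV[R]_d} {T : triangulation Omega}.
Local Notation simplex := {set vertex T}.
Local Notation point := ('rV[R]_d).
Variables (GammaD GammaN : set point) (k : nat) (nu alpha theta : R) (s0 s1 : state T).
Let sm := theta_state theta s0 s1.
Hypotheses (hO : domain Omega) (hGamma : boundary Omega = GammaD `|` GammaN).
Hypotheses (k0 : (0 < k)%N) (nu0 : 0 < nu).
Hypotheses (st0 : is_state k GammaD s0) (st1 : is_state k GammaD s1).
Hypotheses (lmass0 : local_mass k s0) (fmass0 : facet_mass k s0).
Hypotheses (lmass1 : local_mass k s1) (fmass1 : facet_mass k s1).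

Lemma theta_is_state : is_state k GammaD sm.
Proof.
have [V0 B0 Q0 P0] := st0; have [V1 B1 Q1 P1] := st1; split.
- by move=> K cK; apply: is_vPD; apply: is_vPZ; [exact: V0|exact: V1].
- move=> F cF; have [b0 z0] := B0 F cF; have [b1 z1] := B1 F cF; split.
    by apply: is_vPD; exact: is_vPZ.
  by move=> x Fx Dx; rewrite /sm /= z0// z1// !scaler0 addr0.
- by move=> K cK; apply: is_PD; apply: is_PZ; [exact: Q0|exact: Q1].
- by move=> F cF; apply: is_PD; apply: is_PZ; [exact: P0|exact: P1].
Qed.

Let V0 : is_V k (vel s0). Proof. by case: st0. Qed.
Let V1 : is_V k (vel s1). Proof. by case: st1. Qed.
Let B0 : is_Vbar k GammaD (fvel s0). Proof. by case: st0. Qed.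
Let B1 : is_Vbar k GammaD (fvel s1). Proof. by case: st1. Qed.
Let Vm : is_V k (vel sm). Proof. by case: theta_is_state. Qed.
Let Bm : is_Vbar k GammaD (fvel sm). Proof. by case: theta_is_state. Qed.
Let Qm : is_Q k (prs sm). Proof. by case: theta_is_state. Qed.
Let Pm : is_Qbar k (fprs sm). Proof. by case: theta_is_state. Qed.

Lemma vgrad_theta K x : K \in cells T ->
  vgrad (vel sm K) x = (1 - theta) *: vgrad (vel s0 K) x + theta *: vgrad (vel s1 K) x.
Proof.
move=> cK; have [p [_ up]] := is_vP_setT (V0 cK); have [q [_ uq]] := is_vP_setT (V1 cK).
have um (y : point) i : vel sm K y 0 i = meval (y 0) ((1 - theta) *: p i + theta *: q i).
  by rewrite mevalD !mevalZ -up -uq /sm /= !mxE.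
apply/matrixP => i j; have em := vgrad_meval um x i j.
have ep := vgrad_meval up x i j; have eq := vgrad_meval uq x i j.
transitivity ((1 - theta) * vgrad (vel s0 K) x i j + theta * vgrad (vel s1 K) x i j).
  by rewrite em ep eq mderivD !mderivZ mevalD !mevalZ.
by rewrite [RHS]mxE; congr (_ + _); rewrite [RHS]mxE.
Qed.

(** The weak statements at the two time levels are combined, which avoids deriving (D1) for the
    intermediate state. *)
Lemma divergence_free_theta K phi : K \in cells T -> sregular d K phi ->
  integral_simplex d K (fun x => \tr (vgrad (vel sm K) x) * phi x) = 0.
Proof.
move=> cK rphi.
have r s : is_V k (vel s) -> sregular d K (fun x => \tr (vgrad (vel s K) x) * phi x).
  by move=> Vs; apply: sregularM => //; apply: sregular_tr; exact: mregular_vgrad (Vs _ cK).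
transitivity (integral_simplex d K (fun x => (1 - theta) * (\tr (vgrad (vel s0 K) x) * phi x)
   + theta * (\tr (vgrad (vel s1 K) x) * phi x))).
  apply: eq_integral_simplex => x _; rewrite vgrad_theta// mxtraceD !mxtraceZ.
  by rewrite mulrDl !mulrA.
rewrite integral_simplexD; last 2 first.
- by apply: sregularM; [exact: sregular_cst|exact: r].
- by apply: sregularM; [exact: sregular_cst|exact: r].
rewrite integral_simplexZ; last exact: r.
rewrite integral_simplexZ; last exact: r.
rewrite (divergence_free k0 lmass0 V0 cK rphi) (divergence_free k0 lmass1 V1 cK rphi).
by rewrite !mulr0 addr0.
Qed.

Lemma normal_jump_theta F phi : F \in facets T -> sregular d.-1 F phi ->
  integral_simplex d.-1 F (fun x => jump sm F x * phi x) = 0.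
Proof.
move=> cF rphi.
have r0 := sregularM (sregular_jump V0 B0 cF) rphi.
have r1 := sregularM (sregular_jump V1 B1 cF) rphi.
transitivity (integral_simplex d.-1 F (fun x => (1 - theta) * (jump s0 F x * phi x)
   + theta * (jump s1 F x * phi x))).
  apply: eq_integral_simplex => x _; rewrite !mulrA -mulrDl; congr (_ * _).
  rewrite /jump !mulr_sumr -big_split/=; apply: eq_bigr => K _.
  by rewrite /sm /= !dotDl !dotZl; ring.
rewrite integral_simplexD; last 2 first.
- by apply: sregularM => //; exact: sregular_cst.
- by apply: sregularM => //; exact: sregular_cst.
rewrite !integral_simplexZ//.
by rewrite (normal_jump fmass0 V0 B0)// (normal_jump fmass1 V1 B1)// !mulr0 addr0.
Qed.

(** The convective integrand is w . grad(|u|^2 / 2), so Green's formula moves it to the boundary of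
    K because w is divergence free. The pressure is multiplied by the divergence of u and drops
    out. *)
Lemma cell_transport K : K \in cells T ->
  integral_simplex d K (fun x => ddot (sigma nu s0 sm K x) (vgrad (vel sm K) x)) =
  \sum_(F in facets_of K) integral_simplex d.-1 F (fun x =>
    dot (vel s0 K x) (unit_normal K F) * (dot (vel sm K x) (vel sm K x) / 2))
  - nu * integral_simplex d K (fun x => ddot (vgrad (vel sm K) x) (vgrad (vel sm K) x)).
Proof.
move=> cK; set u := vel sm K; set w := vel s0 K.
have Pu : is_vP k setT u by exact: Vm.
have Pw : is_vP k setT w by exact: V0.
have [p [_ up]] := is_vP_setT Pu.
have rG : mregular d K (vgrad u) by exact: mregular_vgrad Pu.
pose Q : mpoly d R := 2^-1 *: \sum_i p i ^+ 2.
have QE (x : point) : meval (x 0) Q = dot (u x) (u x) / 2.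
  rewrite mevalZ mulrC raddf_sum; congr (_ / _); apply: eq_bigr => i _.
  by rewrite /= rmorphXn/= up expr2.
have gradQ (x : point) : dot (w x) (grad (fun y => meval (y 0) Q) x) = ddot (otimes (u x) (w x)) (vgrad u x).
  rewrite /ddot exchange_big/=; apply: eq_bigr => j _.
  rewrite mxE derive_meval mderivZ mevalZ.
  have -> : mderiv j (\sum_i p i ^+ 2) = \sum_i mderiv j (p i ^+ 2) by exact: raddf_sum.
  have -> : meval (x 0) (\sum_i mderiv j (p i ^+ 2)) = \sum_i meval (x 0) (mderiv j (p i ^+ 2)).
    by exact: raddf_sum.
  rewrite !mulr_sumr; apply: eq_bigr => i _.
  have upx := vgrad_meval up x i j; rewrite upx otimesE up.
  by rewrite expr2 mderivM mevalD !mevalM; field.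
have := green Q cK Pw.
rewrite (divergence_free k0 lmass0 V0 cK (sregular_meval _ _ _)) add0r => green_w.
under [X in X - _]eq_bigr do under eq_integral_simplex do rewrite -QE.
rewrite -green_w -integral_simplexZ; last exact: sregular_ddot.
have ru : vregular d K u by exact: vregular_vP Pu _ _.
have rw : vregular d K w by exact: vregular_vP Pw _ _.
have rp : sregular d K (prs sm K) by exact: sregular_P (Qm cK).
transitivity (integral_simplex d K (fun x => (ddot (otimes (u x) (w x)) (vgrad u x) +
    \tr (vgrad u x) * prs sm K x) - nu * ddot (vgrad u x) (vgrad u x))).
  apply: eq_integral_simplex => x _; rewrite /sigma /sigma_a /sigma_d.
  by rewrite ddotDl ddotBl !ddotZl ddot_id addrA; congr (_ + _ - _); exact: mulrC.
have rt := sregular_tr rG.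
have ruw : sregular d K (fun x => ddot (otimes (u x) (w x)) (vgrad u x)).
  by apply: sregular_ddot => //; exact: mregular_otimes.
have rGG := sregular_ddot rG rG.
rewrite integral_simplexB; last 2 first.
- by apply: sregularD => //; exact: sregularM.
- by apply: sregularM => //; exact: sregular_cst.
rewrite integral_simplexD//; last exact: sregularM.
rewrite divergence_free_theta// addr0; congr (_ - _).
by apply: eq_integral_simplex => x _; rewrite gradQ.
Qed.

Local Notation n_ K F := (unit_normal K F).
Local Notation wn K F x := (dot (vel s0 K x) (unit_normal K F)).
Local Notation ue K F x := (fvel sm F x - vel sm K x).

(* The four terms on the right are dealt with by [lam_ge0], [outflow_ge0],
   [pressure_vanish] and [penalty_coercive]. *)
Lemma flux_split K F x : K \in cells T -> F \in facets_of K ->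
  ddot (hsigma nu alpha s0 sm K F x) (otimes (vel sm K x) (n_ K F))
  + nu * ddot (otimes (ue K F x) (n_ K F)) (vgrad (vel sm K) x)
  - wn K F x * (dot (vel sm K x) (vel sm K x) / 2)
  - ddot (hsigma nu alpha s0 sm K F x) (otimes (fvel sm F x) (n_ K F)) =
  (2^-1 - lam (wn K F x)) * wn K F x * dot (ue K F x) (ue K F x)
  - wn K F x * (dot (fvel sm F x) (fvel sm F x) / 2)
  + dot (vel sm K x - fvel sm F x) (n_ K F) * fprs sm F x
  + nu * (2 * ddot (otimes (ue K F x) (n_ K F)) (vgrad (vel sm K) x)
          + alpha / diam K * dot (ue K F x) (ue K F x)).
Proof.
move=> cK FK; have nn := unit_normal_sqr cK FK.
set u := vel sm K x; set w := vel s0 K x; set b := fvel sm F x; set n := n_ K F in nn *.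
set G := vgrad (vel sm K) x.
rewrite /hsigma /hsigma_a /hsigma_d /sigma_a -/u -/w -/b -/n -/G.
have ddotNl A B : ddot (- A) B = - ddot A B :> R by rewrite -scaleN1r ddotZl mulN1r.
rewrite !(ddotDl, ddotNl, ddotZl) !ddot_otimes !ddot_id !tr_otimes !nn !dotZl !dotBl.
rewrite !otimesBl !ddotBl (ddotC G) (ddotC G) !dotBr (dotC b u); field.
exact: lt0r_neq0 (diam_gt0 cK).
Qed.

(** On an interior facet the normals sum to 0, so the facet velocity contributes nothing; on every
    facet the sum over the adjacent cells is therefore the normal jump, tested with the facet
    pressure. *)
Lemma pressure_vanish :
  int_cell_boundaries (T := T)
    (fun K F x => dot (vel sm K x - fvel sm F x) (n_ K F) * fprs sm F x) = 0.
Proof.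
rewrite int_cell_boundariesE big1// => F cF.
have rp : sregular d.-1 F (fprs sm F) by exact: sregular_facet (card_facets cF) (Pm cF).
have ru K : K \in cells T -> sregular d.-1 F (fun x => dot (vel sm K x - fvel sm F x) (n_ K F)).
  move=> cK; apply: sregular_dot; last exact: vregular_cst.
  by apply: vregularB; [exact: vel_regular Vm cK|exact: fvel_regular Bm cF].
rewrite -integral_simplex_sum; last by move=> K /andP[cK _]; apply: sregularM; [exact: ru|].
rewrite -[RHS](normal_jump_theta cF rp); apply: eq_integral_simplex => x _.
rewrite -mulr_suml; congr (_ * _); rewrite /jump.
case bF : (boundary_facet F); first by apply: eq_bigr => K _; rewrite mul1r dotBl.
transitivity (\sum_(K in cells T | F \in facets_of K) dot (vel sm K x) (n_ K F)
  - dot (\sum_(K in cells T | F \in facets_of K) n_ K F) (fvel sm F x)).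
  by rewrite dot_suml -sumrB; apply: eq_bigr => K _; rewrite dotBl (dotC (n_ K F)).
rewrite interior_facet_normals ?bF// dot0l subr0.
by apply: eq_bigr => K _; rewrite mul0r subr0.
Qed.

(** The effect of upwinding: the expression equals |a| / 2. *)
Lemma lam_ge0 (a : R) : 0 <= (2^-1 - lam a) * a.
Proof. by rewrite /lam; case: ltP => ?; nra. Qed.

(** On interior facets the left side is a normal jump tested with |ub|^2 / 2, hence 0. On a boundary
    facet, which has a single cell, wb . n may be replaced by w . n under the integral, and the
    difference becomes (1/2 - lambda)(w . n)|ub|^2. *)
Lemma outflow_ge0 :
  int_cell_boundaries (T := T)
    (fun K F x => wn K F x * (dot (fvel sm F x) (fvel sm F x) / 2)) <=
  int_boundary GammaN (fun K F x => (1 - lam (wn K F x)) *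
    dot (fvel s0 F x) (n_ K F) * dot (fvel sm F x) (fvel sm F x)).
Proof.
rewrite int_cell_boundariesE int_boundaryE; apply: ler_sum => F cF.
have rb : vregular d.-1 F (fvel sm F) by exact: fvel_regular Bm cF.
have rbb := sregular_dot rb rb.
have rw K : K \in cells T -> sregular d.-1 F (fun x => wn K F x).
  by move=> cK; apply: sregular_dot; [exact: vel_regular V0 cK|exact: vregular_cst].
have rwb K : sregular d.-1 F (fun x => dot (fvel s0 F x) (n_ K F)).
  by apply: sregular_dot; [exact: fvel_regular B0 cF|exact: vregular_cst].
have rbb2 : sregular d.-1 F (fun x => dot (fvel sm F x) (fvel sm F x) / 2).
  by apply: sregularM => //; exact: sregular_cst.
case bF : (boundary_facet F); last first.
  rewrite [X in _ <= X]big1 // -integral_simplex_sum; last first.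
    by move=> K /andP[cK _]; apply: sregularM => //; exact: rw.
  rewrite le_eqVlt; apply/orP; left; apply/eqP.
  rewrite -[RHS](normal_jump fmass0 V0 B0 cF rbb2); apply: eq_integral_simplex => x _.
  rewrite -mulr_suml; congr (_ * _); apply: eq_bigr => K _.
  by rewrite bF mul0r subr0.
have [K cK FK] := facetsE cF.
have one : (fun K' => (K' \in cells T) && (F \in facets_of K')) =1 pred1 K.
  move=> K' /=; apply/andP/eqP => [[cK' FK']|-> //].
  by apply/esym; exact: boundary_facet_unique hO bF cK cK' FK FK'.
rewrite !(big_pred1 K one).
have -> : integral_simplex d.-1 F (fun x => \1_GammaN x *
    ((1 - lam (wn K F x)) * dot (fvel s0 F x) (n_ K F) * dot (fvel sm F x) (fvel sm F x))) =
  integral_simplex d.-1 F (fun x =>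
    (1 - lam (wn K F x)) * dot (fvel s0 F x) (n_ K F) * dot (fvel sm F x) (fvel sm F x)).
  apply: eq_integral_simplex => x Fx.
  have : boundary Omega x by move/asboolP : bF; apply; exact: relint_facet Fx.
  rewrite hGamma => -[Dx|Nx]; last by rewrite indicE mem_set// mul1r.
  by have [_ z] := Bm cF; rewrite z// dot0l !mulr0.
have jE x : jump s0 F x = wn K F x - dot (fvel s0 F x) (n_ K F).
  by rewrite /jump (big_pred1 K one) bF mul1r.
have rl : sregular d.-1 F (fun x => 1 - lam (wn K F x)).
  by apply: sregularB; [exact: sregular_cst|apply: sregular_lam; exact: rw].
have r1 := sregularM (sregularM rl (rwb K)) rbb.
have r2 : sregular d.-1 F (fun x => wn K F x * (dot (fvel sm F x) (fvel sm F x) / 2)).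
  by apply: sregularM => //; exact: rw.
have r3 := sregularM rl rbb.
rewrite -subr_ge0 -integral_simplexB//.
(* Adds the vanishing integral of the jump times (1 - lambda)|ub|^2, which replaces wb . n by w .
   n. *)
rewrite -[leRHS]addr0 -[X in _ <= _ + X](normal_jump fmass0 V0 B0 cF r3) -integral_simplexD; last 2 first.
- exact: sregularB.
- by apply: sregularM => //; exact: sregular_jump V0 B0 cF.
apply: integral_simplex_ge0 => x _; rewrite jE.
rewrite (_ : _ + _ = (2^-1 - lam (wn K F x)) * wn K F x * dot (fvel sm F x) (fvel sm F x)).
  by rewrite mulr_ge0 ?lam_ge0 ?dot_ge0.
by field.
Qed.

Lemma hsigma_regular K F : K \in cells T -> F \in facets_of K ->
  mregular d.-1 F (hsigma nu alpha s0 sm K F).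
Proof.
move=> cK FK; have cF := facetsP cK FK.
have ru := vel_regular d.-1 F Vm cK; have rw := vel_regular d.-1 F V0 cK.
have rb := fvel_regular Bm cF.
have rG : mregular d.-1 F (vgrad (vel sm K)) by exact: mregular_vgrad (Vm cK).
have rp : sregular d.-1 F (fprs sm F) by exact: sregular_facet (card_facets cF) (Pm cF).
have rn : vregular d.-1 F (fun=> n_ K F) by exact: vregular_cst.
have re := vregularB rb ru.
apply: mregularD.
  apply: mregularD; first exact: mregular_otimes.
  apply: mregular_otimes => //; apply: vregularZ => //.
  by apply: sregular_lam; exact: sregular_dot.
apply: mregularB.
  apply: mregularB; apply: mregularZ => //; first exact: mregular_cst.
  exact: sregular_cst.
by apply: mregularZ; [exact: sregular_cst|exact: mregular_otimes].
Qed.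

Local Notation GG K x := (ddot (vgrad (vel sm K) x) (vgrad (vel sm K) x)).
Local Notation penalty := (fun K F x => 2 * ddot (otimes (ue K F x) (n_ K F)) (vgrad (vel sm K) x)
          + alpha / diam K * dot (ue K F x) (ue K F x)).

Lemma increment_le0 dt :
  local_momentum k nu alpha theta dt (fun=> 0) s0 s1 ->
  facet_momentum k GammaD GammaN nu alpha theta (fun=> 0) s0 s1 ->
  0 <= int_cells (fun K x => GG K x) + int_cell_boundaries penalty ->
  int_cells (fun K x => dot (dt^-1 *: (vel s1 K x - vel s0 K x)) (vel sm K x)) <= 0.
Proof.
move=> lmom fmom coer.
have := lmom _ Vm; have := fmom _ Bm; rewrite -/sm.
have -> : int_boundary (T := T) GammaN (fun K F x => dot 0 (fvel sm F x)) = 0.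
  rewrite /int_boundary big1// => K _; rewrite big1// => F _.
  rewrite -[RHS](@integral_simplex0 _ _ _ T d.-1 F); apply: eq_integral_simplex => x _.
  by rewrite dot0l mulr0.
have -> : int_cells (T := T) (fun K x => dot 0 (vel sm K x)) = 0.
  rewrite /int_cells big1// => K _.
  rewrite -[RHS](@integral_simplex0 _ _ _ T d K); apply: eq_integral_simplex => x _.
  by rewrite dot0l.
set G := int_boundary _ _; set E := int_cell_boundaries _ => /eqP; rewrite eq_sym subr_eq0 => /eqP EG.
set A := int_cells _; set B := int_cells _; set C := int_cell_boundaries _; set D := int_cell_boundaries _ => mom.
pose cT := fun K F x => wn K F x * (dot (vel sm K x) (vel sm K x) / 2).
have BE : B = int_cell_boundaries cT - nu * int_cells (fun K x => GG K x).
  rewrite /B /int_cells /int_cell_boundaries mulr_sumr -sumrB; apply: eq_bigr => K cK.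
  exact: cell_transport.
have ru (K F : simplex) : K \in cells T -> vregular d.-1 F (vel sm K) by move=> cK; exact: vel_regular Vm cK.
have rb F : F \in facets T -> vregular d.-1 F (fvel sm F) by move=> cF; exact: fvel_regular Bm cF.
have rn K F : vregular d.-1 F (fun=> n_ K F) by exact: vregular_cst.
have rwn (K F : simplex) : K \in cells T -> sregular d.-1 F (fun x => wn K F x).
  by move=> cK; apply: sregular_dot => //; exact: vel_regular V0 cK.
have re K F : K \in cells T -> F \in facets_of K -> vregular d.-1 F (fun x => ue K F x).
  by move=> cK FK; apply: vregularB; [apply: rb; exact: facetsP FK|exact: ru].
have rG (K F : simplex) : K \in cells T -> mregular d.-1 F (vgrad (vel sm K)).
  by move=> cK; exact: mregular_vgrad (Vm cK).
have rC : bregular (fun K F x => ddot (hsigma nu alpha s0 sm K F x) (otimes (vel sm K x) (n_ K F))).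
  move=> K F cK FK; apply: sregular_ddot; first exact: hsigma_regular.
  by apply: mregular_otimes => //; exact: ru.
have rE : bregular (fun K F x => ddot (hsigma nu alpha s0 sm K F x) (otimes (fvel sm F x) (n_ K F))).
  move=> K F cK FK; apply: sregular_ddot; first exact: hsigma_regular.
  by apply: mregular_otimes => //; apply: rb; exact: facetsP FK.
have reG K F : K \in cells T -> F \in facets_of K ->
    sregular d.-1 F (fun x => ddot (otimes (ue K F x) (n_ K F)) (vgrad (vel sm K) x)).
  move=> cK FK; apply: sregular_ddot; last exact: rG.
  by apply: mregular_otimes => //; exact: re.
have rD : bregular (fun K F x => nu * ddot (otimes (ue K F x) (n_ K F)) (vgrad (vel sm K) x)).
  by move=> K F cK FK; apply: sregularM; [exact: sregular_cst|exact: reG].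
have half (K F : simplex) (u : point -> point) : K \in cells T -> vregular d.-1 F u ->
    sregular d.-1 F (fun x => wn K F x * (dot (u x) (u x) / 2)).
  move=> cK r; apply: sregularM; first exact: rwn.
  by apply: sregularM; [exact: sregular_dot|exact: sregular_cst].
have rT : bregular cT by move=> K F cK FK; apply: half => //; exact: ru.
have ree K F : K \in cells T -> F \in facets_of K ->
    sregular d.-1 F (fun x => dot (ue K F x) (ue K F x)).
  by move=> cK FK; apply: sregular_dot; exact: re.
pose c1 := fun K F x => (2^-1 - lam (wn K F x)) * wn K F x * dot (ue K F x) (ue K F x).
pose c2 := fun K F x => wn K F x * (dot (fvel sm F x) (fvel sm F x) / 2).
pose c3 := fun K F x => dot (vel sm K x - fvel sm F x) (n_ K F) * fprs sm F x.
pose c4 := fun K F x => nu * penalty K F x.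
have r1 : bregular c1.
  move=> K F cK FK; apply: sregularM; last exact: ree.
  apply: sregularM; last exact: rwn.
  by apply: sregularB; [exact: sregular_cst|apply: sregular_lam; exact: rwn].
have r2 : bregular c2.
  by move=> K F cK FK; apply: half => //; apply: rb; exact: facetsP FK.
have r3 : bregular c3.
  move=> K F cK FK; have cF := facetsP cK FK; apply: sregularM.
    by apply: sregular_dot => //; apply: vregularB; [exact: ru|exact: rb].
  exact: sregular_facet (card_facets cF) (Pm cF).
have rpen : bregular penalty.
  move=> K F cK FK; apply: sregularD; apply: sregularM; first exact: sregular_cst.
  - exact: reG.
  - exact: sregular_cst.
  - exact: ree.
have r4 : bregular c4.
  by move=> K F cK FK; apply: sregularM; [exact: sregular_cst|exact: rpen].
(* The facet terms of (D3) minus those of (D4), with the kinetic energy flux from [cell_transport]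
   removed; [flux_split] is this identity for the integrands. *)
have key : C + D - int_cell_boundaries cT - E = int_cell_boundaries c1
    - int_cell_boundaries c2 + int_cell_boundaries c3 + int_cell_boundaries c4.
  rewrite -(int_cell_boundariesD rC rD) -int_cell_boundariesB//; last exact: bregularD.
  rewrite -(int_cell_boundariesB (bregularB (bregularD rC rD) rT) rE).
  rewrite -(int_cell_boundariesB r1 r2) -(int_cell_boundariesD (bregularB r1 r2) r3).
  rewrite -(int_cell_boundariesD (bregularD (bregularB r1 r2) r3) r4).
  by apply: eq_int_cell_boundaries => K F x cK FK; exact: flux_split.
have c1_ge0 : 0 <= int_cell_boundaries c1.
  apply: sumr_ge0 => K cK; apply: sumr_ge0 => F FK; apply: integral_simplex_ge0 => x _.
  by rewrite mulr_ge0 ?lam_ge0 ?dot_ge0.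
have c2G : int_cell_boundaries c2 <= G by exact: outflow_ge0.
have c3E : int_cell_boundaries c3 = 0 by exact: pressure_vanish.
have c4E : int_cell_boundaries c4 = nu * int_cell_boundaries penalty.
  rewrite /int_cell_boundaries mulr_sumr; apply: eq_bigr => K cK.
  rewrite mulr_sumr; apply: eq_bigr => F FK; rewrite integral_simplexZ//; exact: rpen.
have coer_nu := mulr_ge0 (ltW nu0) coer; rewrite mulrDr -c4E in coer_nu.
(* The increment equals minus the integral of [c1], plus that of [c2] minus [G], minus nu times the
   coercive form: three nonpositive contributions. *)
rewrite c3E in key; rewrite BE in mom.
lra.
Qed.

Lemma energy_increment dt : 0 < dt -> 1 / 2 <= theta ->
  int_cells (fun K x => dot (dt^-1 *: (vel s1 K x - vel s0 K x)) (vel sm K x)) <= 0 ->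
  energy s1 <= energy s0.
Proof.
move=> dt0 th.
have r (u v : state T) K : is_V k (vel u) -> is_V k (vel v) -> K \in cells T ->
    sregular d K (fun x => dot (vel u K x) (vel v K x)).
  by move=> Vu Vv cK; apply: sregular_dot; [exact: vel_regular Vu cK|exact: vel_regular Vv cK].
have r0 : cregular (fun K x => dot (vel s0 K x) (vel s0 K x)) by move=> K cK; exact: r.
have r1 : cregular (fun K x => dot (vel s1 K x) (vel s1 K x)) by move=> K cK; exact: r.
pose df K x := vel s1 K x - vel s0 K x.
have rd : cregular (fun K x => dot (df K x) (df K x)).
  move=> K cK; have rdf : vregular d K (df K).
    by apply: vregularB; [exact: vel_regular V1 cK|exact: vel_regular V0 cK].
  exact: sregular_dot.
have rZ c f : cregular f -> cregular (fun (K : simplex) (x : point) => c * f K x).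
  by move=> rf K cK; apply: sregularM; [exact: sregular_cst|exact: rf].
have rD f g : cregular f -> cregular g -> cregular (fun (K : simplex) (x : point) => f K x + g K x).
  by move=> rf rg K cK; apply: sregularD; [exact: rf|exact: rg].
rewrite (_ : int_cells _ = dt^-1 * (2^-1 * int_cells (fun K x => dot (vel s1 K x) (vel s1 K x))
  + (- 2^-1) * int_cells (fun K x => dot (vel s0 K x) (vel s0 K x))
  + (theta - 2^-1) * int_cells (fun K x => dot (df K x) (df K x)))); last first.
  have ra := rZ 2^-1 _ r1; have rb := rZ (- 2^-1) _ r0; have rc := rZ (theta - 2^-1) _ rd.
  have rab := rD _ _ ra rb; have rabc := rD _ _ rab rc.
  rewrite -!int_cellsZ// -int_cellsD// -int_cellsD// -int_cellsZ//.
  apply: eq_int_cells => K x cK; rewrite dotZl; congr (_ * _).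
  by rewrite /df /sm /= !(dotDl, dotDr, dotNl, dotNr, dotZl, dotZr) (dotC (vel s1 K x) (vel s0 K x)); field.
rewrite pmulr_rle0 ?invr_gt0// => le0.
have dd : 0 <= int_cells (T := T) (fun K x => dot (df K x) (df K x)).
  by apply: int_cells_ge0 => K x _; exact: dot_ge0.
have eE s : energy (T := T) s = int_cells (fun K x => dot (vel s K x) (vel s K x)).
  by apply: eq_int_cells => K x _; exact: enorm_sqr.
have := mulr_ge0 (_ : 0 <= theta - 2^-1) dd.
rewrite !eE subr_ge0 -div1r => /(_ th); lra.
Qed.

End EnergyIdentity.

Theorem proposition6
  (R : realType) (d : nat) (hd : d = 2%N \/ d = 3%N)
  (Omega : set 'rV[R]_d) (hOmega : domain Omega)
  (T : triangulation Omega)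
  (GammaD GammaN : set 'rV[R]_d)
  (hGamma : boundary Omega = GammaD `|` GammaN)
  (hdisj : GammaD `&` GammaN = set0)
  (k : nat) (hk : (2 <= k)%N)
  (nu : R) (hnu : 0 < nu)
  (theta : R) (htheta : 1 / 2 <= theta)
  (N : nat) (t : nat -> R) (ht0 : t 0%N = 0)
  (ht : forall n : nat, (n < N)%N -> t n < t n.+1) :
  exists alpha0 : R, 0 < alpha0 /\
    forall alpha : R, alpha0 <= alpha ->
    forall n : nat, (n < N)%N ->
    forall s0 s1 : state T,
      is_state k GammaD s0 -> is_state k GammaD s1 ->
      local_mass k s0 -> facet_mass k s0 ->
      discrete_problem k GammaD GammaN nu alpha theta (t n.+1 - t n)
        (fun=> 0) (fun=> 0) s0 s1 ->
      energy s1 <= energy s0.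
Proof.
(* The sections above write the dimension as [m.+2], so that [d.-1] computes and every facet has a
   second vertex. *)
have [m dE] : exists m, d = m.+2 by case: hd => ->; [exists 0%N|exists 1%N].
subst d; have k0 : (0 < k)%N := ltnW hk.
have [alpha0 alpha0_gt0 coer] := penalty_coercive (T := T) k.
exists alpha0; split=> // alpha /coer{}coer n nN s0 s1 st0 st1 lmass0 fmass0.
move=> [lmass1 fmass1 lmom fmom].
have dt0 : 0 < t n.+1 - t n by rewrite subr_gt0 ht.
have [Vm Bm _ _] := theta_is_state theta st0 st1.
apply: (energy_increment st0 st1 dt0 htheta).
apply: (increment_le0 hOmega hGamma k0 hnu st0 st1 lmass0 fmass0 lmass1 fmass1 lmom fmom).
apply: (coer (vel (theta_state theta s0 s1)) (fvel (theta_state theta s0 s1))) => //.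
by move=> F cF; exact: fvel_regular Bm cF.
Qed.
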